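(* The distance functions $\mathrm d_{\mathrm{HR}}$, $\mathrm d_{\mathrm D}$ and $\mathrm d_{\mathrm{mr}}$ are all metrics on $\mathcal U(d)$.
   Context: Fix a positive integer $d$. For $d$-tuples of unitaries $u=(u_1,\dots,u_d)$, $v=(v_1,\dots,v_d)$ on Hilbert spaces (it suffices to consider separable ones), write $u\sim v$ if there is a $*$-isomorphism $\pi\colon C^*(u)\to C^*(v)$ with $\pi(u_i)=v_i$ for all $i$ (here $C^*(u)$ is the C*-algebra generated by $u_1,\dots,u_d$). $\mathcal U(d)$ is the set of all $\sim$-equivalence classes of $d$-tuples of unitaries; tuples are identified with the classes they belong to. For $X=(X_1,\dots,X_d)\in B(H)^d$, $\|X\|:=\max_i\|X_i\|$. For unitary tuples $u,v$ and a positive real number $c$, write $u\prec cv$ if there exist Hilbert spaces $H\subseteq K$ and operator tuples $U\in B(H)^d$, $V\in B(K)^d$ with $U\sim u$, $V\sim v$ and $U_i=P_H\,cV_i|_H$ for all $i$, where $P_H$ is the orthogonal projection of $K$ onto $H$. Put $c(u,v)=\inf\{c: u\prec cv\}$. The matrix range of $A\in B(H)^d$ is the disjoint union $\mathcal W(A)=\bigcup_n\mathcal W_n(A)$, where $\mathcal W_n(A)=\{(\phi(A_1),\dots,\phi(A_d)) : \phi\colon B(H)\to M_n(\mathbb C) \text{ unital completely positive}\}\subseteq M_n(\mathbb C)^d$; equivalent unitary tuples have the same matrix range. For matrix ranges, $\mathrm d_{\mathrm H}(\mathcal W(u),\mathcal W(v))=\sup_{n\geq 1} \mathrm d_{\mathrm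 H}(\mathcal W_n(u),\mathcal W_n(v))$, where on the right $\mathrm d_{\mathrm H}$ is the Hausdorff distance with respect to the norm $\|X\|=\max_i\|X_i\|$ on $M_n(\mathbb C)^d$. Define $$\mathrm d_{\mathrm{HR}}(u,v)=\inf\{\|u'-v'\| : u',v'\in B(H)^d \text{ for some Hilbert space } H,\ u'\sim u,\ v'\sim v\},$$ $$\mathrm d_{\mathrm D}(u,v)=\log\max\{c(u,v),c(v,u)\},\qquad \mathrm d_{\mathrm{mr}}(u,v)=\mathrm d_{\mathrm H}(\mathcal W(u),\mathcal W(v)).$$
   Formalization: d_D is proved to be a metric that may take the value +∞, since c(u,v) is the infimum of an empty set for example when d = 1, u = 1, v = −1; d_HR and d_mr are proved to be finite-valued metrics. *)

(* Defs.v *)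
From HB Require Import structures.
From mathcomp Require Import all_boot all_order all_algebra.
From mathcomp Require Import sesquilinear complex.
From mathcomp Require Import all_classical all_reals all_analysis.

Set Implicit Arguments.
Unset Strict Implicit.
Unset Printing Implicit Defensive.

Import Order.TTheory GRing.Theory Num.Theory.
Import numFieldNormedType.Exports.

Local Open Scope classical_set_scope.
Local Open Scope complex_scope.
Local Open Scope ring_scope.

(* Inner products are linear in the first argument.  The norm of a normed
   module over R[i] takes values in R[i]; [rnorm] is the same norm in R. *)
Record hilbert (R : realType) := Hilbert {
  hspace :> completeNormedModType R[i];
  inner : {dot hspace for Num.conj};
  inner_norm : forall x : hspace, inner x x = `|x| ^+ 2
}.

Definition rnorm (R : realType) (H : hilbert R) (x : H) : R := complex.Re `|x|.

Section Operators.
Variable R : realType.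
Implicit Types H K : hilbert R.

Definition bounded_op H K (A : H -> K) : Prop :=
  linear A /\ exists M : R, forall x, rnorm (A x) <= M * rnorm x.

Definition opnorm H K (A : H -> K) : R :=
  sup [set rnorm (A x) | x in [set x : H | rnorm x <= 1]].

Definition is_adjoint H (A B : H -> H) : Prop :=
  forall x y, inner H (A x) y = inner H x (B y).

Definition unitary H (U : H -> H) : Prop :=
  bounded_op U /\
  exists V : H -> H, [/\ bounded_op V, is_adjoint U V,
                         U \o V = idfun & V \o U = idfun].

Definition orthoproj H (P : H -> H) (S : set H) : Prop :=
  [/\ bounded_op P, P \o P = P, is_adjoint P P & range P = S].

(* Operators are plain functions, so the algebra operations are the pointwise
   ones; B(H) is the set of all A with [bounded_op A]. *)
Definition Cstar_subalgebra H (S : set (H -> H)) : Prop :=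
  [/\ S `<=` @bounded_op H H,
      S 0 /\ (forall A B, S A -> S B -> S (A + B)),
      (forall (a : R[i]) A, S A -> S (a *: A))
        /\ (forall A B, S A -> S B -> S (A \o B)),
      (forall A B, S A -> bounded_op B -> is_adjoint A B -> S B) &
      forall A, bounded_op A ->
        (forall e : R, 0 < e -> exists2 B, S B & opnorm (A - B) < e) -> S A].

Definition Cstar H (I : Type) (A : I -> H -> H) : set (H -> H) :=
  smallest (@Cstar_subalgebra H) (range A).

Definition star_iso H K (S : set (H -> H)) (T : set (K -> K))
    (f : (H -> H) -> (K -> K)) : Prop :=
  [/\ set_bij S T f,
      forall A B, S A -> S B -> f (A + B) = f A + f B,
      forall (a : R[i]) A, S A -> f (a *: A) = a *: f A,
      forall A B, S A -> S B -> f (A \o B) = f A \o f B &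
      forall A B, S A -> S B -> is_adjoint A B -> is_adjoint (f A) (f B)].

(* Positivity of the operator matrix (A i j) acting on the k-fold sum of H. *)
Definition positive_opmx H k (A : 'I_k -> 'I_k -> H -> H) : Prop :=
  forall x : 'I_k -> H, 0 <= \sum_i \sum_j inner H (A i j (x j)) (x i).

End Operators.

Section Matrices.
Variables (R : realType) (n : nat).

Definition cdot (x y : 'cV[R[i]]_n) : R[i] :=
  \sum_i x i ord0 * Num.conj (y i ord0).

Definition cnorm (x : 'cV[R[i]]_n) : R := Num.sqrt (complex.Re (cdot x x)).

Definition mxopnorm (A : 'M[R[i]]_n) : R :=
  sup [set cnorm (A *m x) | x in [set x | cnorm x <= 1]].

Definition positive_blockmx k (B : 'I_k -> 'I_k -> 'M[R[i]]_n) : Prop :=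
  forall x : 'I_k -> 'cV[R[i]]_n,
    0 <= \sum_i \sum_j cdot (B i j *m x j) (x i).

(* Only the values of phi on bounded operators are constrained. *)
Definition ucp (H : hilbert R) (phi : (H -> H) -> 'M[R[i]]_n) : Prop :=
  [/\ forall A B, bounded_op A -> bounded_op B ->
        phi (A + B) = phi A + phi B,
      forall (a : R[i]) A, bounded_op A -> phi (a *: A) = a *: phi A,
      phi idfun = 1%:M &
      forall k (A : 'I_k -> 'I_k -> H -> H),
        (forall i j, bounded_op (A i j)) -> positive_opmx A ->
        positive_blockmx (fun i j => phi (A i j))].

End Matrices.

Section Tuples.
Variables (R : realType) (d : nat).

Record unitary_tuple (H : hilbert R) := UnitaryTuple {
  utuple :> 'I_d -> H -> H;
  utupleP : forall i, unitary (utuple i)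
}.

Definition sim H K (u : unitary_tuple H) (v : unitary_tuple K) : Prop :=
  exists pi : (H -> H) -> (K -> K),
    star_iso (Cstar u) (Cstar v) pi /\ forall i, pi (u i) = v i.

(* Hilbert spaces carrying the tuples under study are nonzero, as is implicit
   when unital completely positive maps or states are considered. *)
Record unitaries := Unitaries {
  uspace : hilbert R;
  uspace_neq0 : exists x : uspace, x != 0;
  uops :> unitary_tuple uspace
}.

(* Classes are bare predicates: [unitaries] is too large a type for [set]. *)
Definition sim_class (u : unitaries) : unitaries -> Prop := fun v => sim u v.

(* The set U(d) of all equivalence classes. *)
Definition calU : Type :=
  {C : unitaries -> Prop | exists u, C = sim_class u}.

Definition class_of (u : unitaries) : calU :=
  exist _ (sim_class u) (ex_intro _ u erefl).

(* u \prec c v.  The inclusion of H in K is an isometric embedding j, and P is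
   the orthogonal projection of K onto (the image of) H. *)
Definition dilates (u v : unitaries) (c : R) : Prop :=
  exists (H K : hilbert R) (U : unitary_tuple H) (V : unitary_tuple K)
         (j : H -> K) (P : K -> K),
    [/\ sim U u /\ sim V v,
        linear j, forall x y, inner K (j x) (j y) = inner H x y,
        orthoproj P (range j) &
        forall i x, j (U i x) = P (c%:C *: V i (j x))].

(* Equal to +oo when no dilation exists. *)
Definition dilation_const (u v : unitaries) : \bar R :=
  ereal_inf [set c%:E | c in [set c : R | 0 < c /\ dilates u v c]].

Definition matrix_range (u : unitaries) (n : nat) : set ('I_d -> 'M[R[i]]_n) :=
  [set A | exists phi : (uspace u -> uspace u) -> 'M[R[i]]_n,
             ucp phi /\ A = (fun i => phi (u i))].

Definition opnorm_tuple (H : hilbert R) (A : 'I_d -> H -> H) : R :=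
  \big[Num.max/0]_(i < d) opnorm (A i).

Definition mxnorm_tuple n (A : 'I_d -> 'M[R[i]]_n) : R :=
  \big[Num.max/0]_(i < d) mxopnorm (A i).

End Tuples.

Arguments matrix_range {R d} u n.

Definition hausdorff_dist (R : realType) (T : Type) (dist : T -> T -> R)
    (A B : set T) : \bar R :=
  maxe
    (ereal_sup [set ereal_inf [set (dist x y)%:E | y in B] | x in A])
    (ereal_sup [set ereal_inf [set (dist x y)%:E | x in A] | y in B]).

Section Distances.
Variables (R : realType) (d : nat).
Implicit Types u v : unitaries R d.

Definition d_HR u v : \bar R :=
  ereal_inf [set r | exists (H : hilbert R) (u' v' : unitary_tuple d H),
    [/\ sim u' u, sim v' v &
        r = (opnorm_tuple (fun i => u' i - v' i))%:E]].

Definition d_D u v : \bar R :=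
  lne (maxe (dilation_const u v) (dilation_const v u)).

Definition d_mr u v : \bar R :=
  ereal_sup [set hausdorff_dist
      (fun A B : 'I_d -> 'M[R[i]]_n => mxnorm_tuple (fun i => A i - B i))
      (matrix_range u n) (matrix_range v n) | n in [set n | (1 <= n)%N]].

End Distances.

(* Metrics that may take the value +oo. *)
Definition extended_metric (R : realType) (T : Type) (D : T -> T -> \bar R) :
    Prop :=
  [/\ forall x y, (0 <= D x y)%E,
      forall x y, D x y = 0%E <-> x = y,
      forall x y, D x y = D y x &
      forall x y z, (D x z <= D x y + D y z)%E].

Definition finite_metric (R : realType) (T : Type) (D : T -> T -> \bar R) :
    Prop :=
  extended_metric D /\ forall x y, D x y \is a fin_num.

(* f descends to the quotient U(d), and the induced function satisfies P. *)
Definition on_classes (R : realType) (d : nat)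
    (P : (calU R d -> calU R d -> \bar R) -> Prop)
    (f : unitaries R d -> unitaries R d -> \bar R) : Prop :=
  exists D : calU R d -> calU R d -> \bar R,
    (forall u v, D (class_of u) (class_of v) = f u v) /\ P D.

(* Main.v *)
(* The class of a unitary tuple u is determined by the norms of the operators p(u), p a
   *-polynomial.  When one of the distances from u to v vanishes, for every finite set of
   vectors there are representatives of v and maps, isometric on these vectors, that
   almost intertwine u and v on them; evaluating p along the way, ||p(u)|| <= ||p(v)||,
   and by symmetry equality.
   - d_HR: for the triangle inequality two copies of C*(v), inside B(H) and B(K), have to
     be identified.  A Hilbert space on which both B(H) and B(K) act, and C*(v) in one way
     only, arises by alternately enlarging a C*(v)-module to a B(H)- and a B(K)-module.
     Comparison with the identity tuple shows that d_HR <= 4.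
   - d_D: a dilation is a unital completely positive map on C*(v).  Extended by Arveson and
     dilated by Stinespring it can be composed with a second dilation.  If u is compressed
     from c v with c close to 1, the unitaries V_i almost preserve the compression space.
   - d_mr: by Arveson the matrix range depends on the class only.  A compression of u to a
     finite-dimensional space is close to a unital completely positive image of v, and
     Stinespring's theorem turns the latter into the almost intertwining map.
   Hilbert spaces are constructed as reproducing kernel spaces.  Arveson's theorem is
   M. Riesz's extension theorem for a functional on quadratic forms, positive elements
   being squares up to epsilon. *)

Require Import Defs.
From HB Require Import structures.
From mathcomp Require Import all_boot all_order all_algebra.
From mathcomp Require Import sesquilinear complex.
From mathcomp Require Import all_classical all_reals all_analysis.
From mathcomp Require Import ring lra.
Set Implicit Arguments.
Unset Strict Implicit.
Unset Printing Implicit Defensive.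
Import Order.TTheory GRing.Theory Num.Theory.
Import numFieldNormedType.Exports.
Local Open Scope classical_set_scope.
Local Open Scope complex_scope.
Local Open Scope ring_scope.

(** * Complex numbers and positive kernels *)

Section ComplexModulus.
Variable R : realType.
Implicit Types z w : R[i].
Local Notation Re := (@complex.Re R).

(** One analytic input replaces the spectral theorem: for a self-adjoint [X] of norm below 1 a fixed
    point iteration inside the C*-algebra produces a square root of [1 - X]. Used for matrices over
    the algebra, it makes every unital *-representation completely positive and contractive. Both
    directions of a *-isomorphism are then contractive, which is why norms of polynomials detect the
    class. No limit of representatives is ever formed: the constants in the perturbation estimate
    for a polynomial depend on the polynomial alone, so the Hilbert spaces may change with the
    tolerance. A recurrent obstacle is faithfulness. A representation produced by Stinespring's
    theorem may lose norm, and the cure for dilations and for the amalgam is a direct summand on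
    which the algebra acts identically. The alternating enlargement closes up because its pieces can
    be paired in two ways, shifted by one step. M. Riesz's theorem is applied to real parts, with
    the forms of nonnegative real part as cone; operators that are not self-adjoint then need no
    separate treatment. *)

Definition cmod z : R := Re `|z|.

Lemma cmodE z : `|z| = (cmod z)%:C.
Proof. by rewrite /cmod normc_def. Qed.

Lemma cmod_ge0 z : 0 <= cmod z.
Proof. by have := normr_ge0 z; rewrite cmodE lecR. Qed.

Lemma cmodD z w : cmod (z + w) <= cmod z + cmod w.
Proof. by have := ler_normD z w; rewrite !cmodE -rmorphD lecR. Qed.

Lemma cmodM z w : cmod (z * w) = cmod z * cmod w.
Proof. by have := normrM z w; rewrite !cmodE -rmorphM => -[]. Qed.

Lemma cmodN z : cmod (- z) = cmod z.
Proof. by rewrite /cmod normrN. Qed.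

Lemma cmod0 : cmod 0 = 0.
Proof. by rewrite /cmod normr0. Qed.

Lemma cmod1 : cmod 1 = 1.
Proof. by rewrite /cmod normr1. Qed.

Lemma cmodJ z : cmod z^*%C = cmod z.
Proof. by rewrite /cmod normcJ. Qed.

Lemma cmod_eq0 z : cmod z = 0 -> z = 0.
Proof. by move=> z0; apply/normr0_eq0; rewrite cmodE z0. Qed.

Lemma cmod_real (a : R) : cmod a%:C = `|a|.
Proof. by rewrite /cmod normc_def /= expr0n addr0 sqrtr_sqr. Qed.

Lemma cmod_sqr z : cmod z ^+ 2 = Re z ^+ 2 + complex.Im z ^+ 2.
Proof.
by rewrite /cmod normc_def /= sqr_sqrtr // addr_ge0 ?sqr_ge0.
Qed.

Lemma Re_mulJ z : Re (z^*%C * z) = cmod z ^+ 2.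
Proof. by rewrite cmod_sqr; case: z => a b /=; ring. Qed.

Lemma mulJ z : z^*%C * z = (cmod z ^+ 2)%:C.
Proof.
by rewrite cmod_sqr; case: z => a b; apply/eqP; rewrite eq_complex /=;
  apply/andP; split; apply/eqP; ring.
Qed.

Lemma Re_le_cmod z : `|Re z| <= cmod z.
Proof. by have := normc_ge_Re z; rewrite cmodE lecR. Qed.

Lemma Re_le z : Re z <= cmod z.
Proof. exact: le_trans (ler_norm _) (Re_le_cmod z). Qed.

Lemma cmod_le_ReIm z : cmod z <= `|Re z| + `|complex.Im z|.
Proof.
rewrite -(@ler_pXn2r _ 2) ?nnegrE ?addr_ge0 ?cmod_ge0 // cmod_sqr sqrrD.
by rewrite !real_normK ?num_real // lerD2r lerDl mulrn_wge0 // mulr_ge0.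
Qed.

Lemma ReD z w : Re (z + w) = Re z + Re w.
Proof. by case: z; case: w. Qed.

Lemma ReN z : Re (- z) = - Re z.
Proof. by case: z. Qed.

Lemma ReB z w : Re (z - w) = Re z - Re w.
Proof. by case: z; case: w. Qed.

Lemma Re_sum I (r : seq I) (P : pred I) (F : I -> R[i]) :
  Re (\sum_(i <- r | P i) F i) = \sum_(i <- r | P i) Re (F i).
Proof. by elim/big_rec2: _ => // i y x _ <-; rewrite ReD. Qed.

Lemma Re_realM (a : R) z : Re (a%:C * z) = a * Re z.
Proof. by case: z => x y /=; ring. Qed.

Lemma ReJ z : Re z^*%C = Re z.
Proof. by case: z. Qed.

Lemma conjM z w : (z * w)^*%C = z^*%C * w^*%C.
Proof. exact: rmorphM. Qed.

Lemma conjD z w : (z + w)^*%C = z^*%C + w^*%C.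
Proof. exact: rmorphD. Qed.

Lemma conjN z : (- z)^*%C = - z^*%C.
Proof. exact: rmorphN. Qed.

Lemma conjB z w : (z - w)^*%C = z^*%C - w^*%C.
Proof. exact: rmorphB. Qed.

Lemma conj_sum I (r : seq I) (P : pred I) (F : I -> R[i]) :
  (\sum_(i <- r | P i) F i)^*%C = \sum_(i <- r | P i) (F i)^*%C.
Proof. exact: rmorph_sum. Qed.

Lemma realCM (a b : R) : (a * b)%:C = a%:C * b%:C.
Proof. exact: rmorphM. Qed.

Lemma Re_ge0 z : 0 <= z -> 0 <= Re z.
Proof. by rewrite lecE /= => /andP[]. Qed.

Lemma ge0_ReE z : 0 <= z -> z = (Re z)%:C.
Proof. by case: z => a b; rewrite lecE /= => /andP[/eqP -> _]. Qed.

(** The form in which most limit arguments end: the error carries a factor [K] whose sign need not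
    be known, so [e] is rescaled by [|K| + 1]. *)
Lemma ler_eps_mul (a b K : R) : (forall e, 0 < e -> a <= b + e * K) -> a <= b.
Proof.
move=> h; apply/ler_addgt0Pr => e e0.
have K0 : 0 < `|K| + 1 by rewrite ltr_wpDl.
apply: (le_trans (h (e / (`|K| + 1)) _)); first by rewrite divr_gt0.
rewrite lerD2l -mulrA ler_piMr // ?(ltW e0) // ler_pdivrMl // mulr1.
by rewrite (le_trans (ler_norm K)) // lerDl.
Qed.

Lemma cmod_eps z (K : R) : (forall e, 0 < e -> cmod z <= e * K) -> z = 0.
Proof.
move=> h; apply/cmod_eq0/le_anti; rewrite cmod_ge0 andbT.
by apply: (@ler_eps_mul _ _ K) => e e0; rewrite add0r h.
Qed.

(* Take [a] to be a real multiple of [g]. *)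
Lemma quadratic_bound (g : R[i]) (e q : R) : 0 <= q ->
  (forall a : R[i], 2 * Re (a^*%C * g) <= e + cmod a ^+ 2 * q) ->
  cmod g ^+ 2 <= e * q.
Proof.
move=> q0 h.
have {}h (t : R) : 2 * t * cmod g ^+ 2 <= e + t ^+ 2 * cmod g ^+ 2 * q.
  have := h (t%:C * g); rewrite cmodM exprMn cmod_real real_normK ?num_real //.
  by rewrite conjM conjc_real -mulrA mulJ -realCM /= mulrA.
have [q00|qN0] := eqVneq q 0.
  rewrite q00 mulr0 real_leNgt ?num_real //; apply/negP => g0.
  have := h ((e + 1) / (2 * cmod g ^+ 2)); rewrite q00 mulr0 addr0 leNgt.
  suff -> : 2 * ((e + 1) / (2 * cmod g ^+ 2)) * cmod g ^+ 2 = e + 1 by lra.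
  have gN0 : cmod g != 0 by apply: contraTneq g0 => ->; rewrite expr0n ltxx.
  by field.
have {}q0 : 0 < q by rewrite lt_def qN0.
have := h q^-1; rewrite -(@ler_pM2r _ q) //.
have -> : (e + q^-1 ^+ 2 * cmod g ^+ 2 * q) * q = e * q + cmod g ^+ 2 by field.
have -> : 2 * q^-1 * cmod g ^+ 2 * q = 2 * cmod g ^+ 2 by field.
by lra.
Qed.

(* [P e y] reads "y is within e of the limit". *)
Lemma real_approx (P : R -> R -> Prop) :
  (forall e, 0 < e -> exists y, P e y) ->
  (forall e e' y y', P e y -> P e' y' -> `|y - y'| <= e + e') ->
  exists y : R, forall e (z : R), P e z -> `|y - z| <= e.
Proof.
move=> ex cau; pose S := [set x | exists e y, P e y /\ x = y - e].
have ub e y : P e y -> ubound S (y + e).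
  move=> Py _ [e' [y' [Py' ->]]]; have := cau _ _ _ _ Py' Py.
  by rewrite ler_norml => /andP[_]; lra.
have [y1 Py1] := ex 1 ltr01.
have S0 : has_sup S by split; [exists (y1 - 1), 1, y1 | exists (y1 + 1); exact: ub].
exists (sup S) => e z Pz; rewrite ler_norml.
have h1 : sup S <= z + e by apply: ge_sup; [case: S0 | exact: ub].
have h2 : z - e <= sup S by apply: sup_upper_bound => //; exists e, z.
by apply/andP; split; lra.
Qed.

Lemma complex_approx (P : R -> R[i] -> Prop) :
  (forall e, 0 < e -> exists y, P e y) ->
  (forall e e' y y', P e y -> P e' y' -> cmod (y - y') <= e + e') ->
  exists y, forall e z, P e z -> cmod (y - z) <= e.
Proof.
move=> ex cau.
have [||a ha] := @real_approx (fun e x => exists2 y, P e y & x = Re y).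
- by move=> e /ex[y Py]; exists (Re y), y.
- move=> e e' _ _ [y Py ->] [y' Py' ->]; rewrite -ReB.
  exact: le_trans (Re_le_cmod _) (cau _ _ _ _ Py Py').
have [||b hb] := @real_approx (fun e x => exists2 y, P e y & x = complex.Im y).
- by move=> e /ex[y Py]; exists (complex.Im y), y.
- move=> e e' _ _ [y Py ->] [y' Py' ->].
  apply: le_trans (cau _ _ _ _ Py Py').
  rewrite -(@ler_pXn2r _ 2) ?nnegrE ?cmod_ge0 // cmod_sqr real_normK ?num_real //.
  by case: y {Py}; case: y' {Py'} => * /=; rewrite lerDr sqr_ge0.
exists (a +i* b) => e z Pz; apply: (@ler_eps_mul _ _ 3) => d d0.
(* The coordinatewise limits lie within [2 d] of an approximant of accuracy [d]; comparing that
   approximant with [z] costs [d + e]. Hence the factor 3. *)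
have [y Py] := ex _ d0.
rewrite (_ : _ - z = (a +i* b - y) + (y - z)); last by ring.
apply: le_trans (cmodD _ _) _.
have h1 := ha _ _ (ex_intro2 _ _ _ Py erefl).
have h2 := hb _ _ (ex_intro2 _ _ _ Py erefl).
have h3 := cau _ _ _ _ Py Pz.
have h4 := cmod_le_ReIm (a +i* b - y).
case: y Py h1 h2 h3 h4 => y1 y2 Py /= h1 h2 h3 h4.
by lra.
Qed.

End ComplexModulus.

(** * Positive kernels and the Cauchy-Schwarz inequality *)

Section Kernel.
Variables (R : realType) (X : Type) (k : X -> X -> R[i]).
Local Notation Re := (@complex.Re R).
Implicit Types (l m : seq (R[i] * X)) (f : X -> R[i]).

(* A list [l] stands for the formal combination [\sum_(p <- l) p.1 p.2]. *)
Definition kform l m : R[i] :=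
  \sum_(p <- l) \sum_(q <- m) p.1 * q.1^*%C * k p.2 q.2.

Definition kscale (a : R[i]) l := [seq (a * p.1, p.2) | p <- l].

Definition knsq l : R := Re (kform l l).

Definition psd := forall l, 0 <= kform l l.

(** The inner product of [f] with the formal combination [l], the value [f x] standing for the
    product with the point [x]; hence the conjugates. *)
Definition keval f l : R[i] := \sum_(p <- l) p.1^*%C * f p.2.

Definition kvec l : X -> R[i] := fun x => \sum_(p <- l) p.1 * k p.2 x.

Lemma keval_cat f l m : keval f (l ++ m) = keval f l + keval f m.
Proof. exact: big_cat. Qed.

Lemma keval_scale f a l : keval f (kscale a l) = a^*%C * keval f l.
Proof.
rewrite /keval big_map mulr_sumr; apply: eq_bigr => p _ /=.
by rewrite conjM mulrA.
Qed.

Lemma kform_eval l m : kform l m = keval (kvec l) m.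
Proof.
rewrite /kform exchange_big; apply: eq_bigr => q _ /=.
rewrite /kvec mulr_sumr; apply: eq_bigr => p _.
by rewrite mulrCA mulrA.
Qed.

Lemma kform_catr l m m' : kform l (m ++ m') = kform l m + kform l m'.
Proof. by rewrite !kform_eval keval_cat. Qed.

Lemma kform_catl l l' m : kform (l ++ l') m = kform l m + kform l' m.
Proof. exact: big_cat. Qed.

Lemma kform_scaler a l m : kform l (kscale a m) = a^*%C * kform l m.
Proof. by rewrite !kform_eval keval_scale. Qed.

Lemma kform_scalel a l m : kform (kscale a l) m = a * kform l m.
Proof.
rewrite /kform big_map mulr_sumr; apply: eq_bigr => p _ /=.
by rewrite mulr_sumr; apply: eq_bigr => q _; rewrite !mulrA.
Qed.

Hypothesis k_psd : psd.

Lemma knsq_ge0 l : 0 <= knsq l.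
Proof. exact: Re_ge0. Qed.

Lemma kformE l : kform l l = (knsq l)%:C.
Proof. exact: ge0_ReE. Qed.

(** In [R[i]] the relation [0 <= z] includes that [z] is real. So the imaginary part of the form at
    [l + a m] vanishes, and [a = 1] and [a = i] yield the two coordinates of the identity. *)
Lemma kformC l m : kform m l = (kform l m)^*%C.
Proof.
have h a : complex.Im (a^*%C * kform l m + a * kform m l) = 0.
  have : kform (l ++ kscale a m) (l ++ kscale a m) =
      (knsq (l ++ kscale a m))%:C by exact: kformE.
  rewrite kform_catl !kform_catr !kform_scalel !kform_scaler !kformE.
  move=> /(congr1 (@complex.Im R)).
  by case: a; case: (kform l m); case: (kform m l) => /= *; lra.
have := h 1; have := h 'i%C.
case: (kform l m); case: (kform m l) => /= *; congr (_ +i* _); lra.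
Qed.

Lemma knsq_cat_scale l a m :
  knsq (l ++ kscale a m) = knsq l + 2 * Re (a^*%C * kform l m) + cmod a ^+ 2 * knsq m.
Proof.
rewrite /knsq kform_catl !kform_catr !kform_scalel !kform_scaler (kformC l m).
have -> : a * (a^*%C * kform m m) = (cmod a ^+ 2 * knsq m)%:C.
  by rewrite mulrA [a * _]mulrC mulJ kformE realCM.
rewrite !ReD /=.
by case: a; case: (kform l m) => p q x y /=; ring.
Qed.

Lemma kform_CauchySchwarz l m : cmod (kform l m) ^+ 2 <= knsq l * knsq m.
Proof.
apply: quadratic_bound (knsq_ge0 m) _ => a.
have := knsq_ge0 (l ++ kscale (- a) m); rewrite knsq_cat_scale cmodN.
by rewrite conjN mulNr ReN; lra.
Qed.

Definition kbounded f (r : R) :=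
  0 <= r /\ forall l, cmod (keval f l) ^+ 2 <= r * knsq l.

(* Almost maximise [2 Re (f l) - |l|^2]. *)
Lemma kbounded_approx f r e : kbounded f r -> 0 < e ->
  exists l, forall m, cmod (keval f m - kform l m) ^+ 2 <= e * knsq m.
Proof.
move=> [r0 fr] e0; pose G l := 2 * Re (keval f l) - knsq l.
have Gub l : G l <= r.
  have h : Re (keval f l) ^+ 2 <= r * knsq l.
    by apply: le_trans (fr l); rewrite cmod_sqr lerDl sqr_ge0.
  have n0 := knsq_ge0 l.
  suff : Re (keval f l) <= (r + knsq l) / 2 by rewrite /G; lra.
  apply: le_trans (ler_norm _) _.
  rewrite -(@ler_pXn2r _ 2) ?nnegrE ?divr_ge0 ?addr_ge0 //.
  rewrite real_normK ?num_real //; apply: le_trans h _.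
  have := sqr_ge0 (r - knsq l); rewrite sqrrB exprMn sqrrD; lra.
have Gsup : has_sup (range G).
  by split; [exists (G [::]), [::] | exists r => _ [l _ <-]].
have [_ [l _ <-] Gl] := sup_adherent e0 Gsup.
exists l => m; apply: quadratic_bound (knsq_ge0 m) _ => a.
have : G (l ++ kscale a m) <= sup (range G) by apply: sup_upper_bound; last exists (l ++ kscale a m).
move: Gl; rewrite /G knsq_cat_scale keval_cat keval_scale ReD mulrBr ReB; lra.
Qed.

End Kernel.

(** * The Hilbert space of a positive kernel *)

Section RKHS.
Variables (R : realType) (X : Type) (k : X -> X -> R[i]) (k_psd : psd k).
Implicit Types (l m : seq (R[i] * X)) (f g : X -> R[i]).

Local Notation kform := (kform k).
Local Notation knsq := (knsq k).
Local Notation kvec := (kvec k).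

Definition knorm l : R := Num.sqrt (knsq l).

Lemma knorm_ge0 l : 0 <= knorm l. Proof. exact: sqrtr_ge0. Qed.

Lemma knorm_sqr l : knorm l ^+ 2 = knsq l.
Proof. by rewrite sqr_sqrtr // knsq_ge0. Qed.

Lemma kform_le l m : cmod (kform l m) <= knorm l * knorm m.
Proof.
rewrite -(@ler_pXn2r _ 2) ?nnegrE ?cmod_ge0 ?mulr_ge0 ?knorm_ge0 //.
by rewrite exprMn !knorm_sqr kform_CauchySchwarz.
Qed.

Lemma kevalD f g l : keval (f + g) l = keval f l + keval g l.
Proof. by rewrite -big_split; apply: eq_bigr => p _ /=; rewrite -mulrDr. Qed.

Lemma kevalZ a f l : keval (a *: f) l = a * keval f l.
Proof. by rewrite mulr_sumr; apply: eq_bigr => p _; rewrite mulrCA. Qed.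

Lemma keval0 l : keval (0 : X -> R[i]) l = 0.
Proof. by rewrite /keval big1 // => p _; rewrite mulr0. Qed.

Lemma kevalB f g l : keval (f - g) l = keval f l - keval g l.
Proof. by rewrite kevalD -scaleN1r kevalZ mulN1r. Qed.

Lemma keval1 f x : keval f [:: (1, x)] = f x.
Proof. by rewrite /keval big_seq1 conjc1 mul1r. Qed.

Definition kbnd f (r : R) := 0 <= r /\ forall l, cmod (keval f l) <= r * knorm l.

Lemma kbndD f g r s : kbnd f r -> kbnd g s -> kbnd (f + g) (r + s).
Proof.
move=> [r0 fr] [s0 gs]; split; first exact: addr_ge0.
move=> l; rewrite kevalD mulrDl; exact: le_trans (cmodD _ _) (lerD (fr l) (gs l)).
Qed.

Lemma kbndZ a f r : kbnd f r -> kbnd (a *: f) (cmod a * r).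
Proof.
move=> [r0 fr]; split; first by rewrite mulr_ge0 ?cmod_ge0.
by move=> l; rewrite kevalZ cmodM -mulrA ler_wpM2l ?cmod_ge0.
Qed.

Lemma kbnd0 : kbnd 0 0.
Proof. by split => // l; rewrite keval0 cmod0 mul0r. Qed.

Lemma kbnd_kvec l : kbnd (kvec l) (knorm l).
Proof. by split; [exact: knorm_ge0 | move=> m; rewrite -kform_eval kform_le]. Qed.

(** The space is realised as a dual: its vectors are the functions bounded as functionals on formal
    combinations. No quotient by null combinations and no abstract completion is involved. *)
Definition rk_pred : {pred X -> R[i]} := fun f => `[< exists r, kbnd f r >].

Lemma rk_pred_submod : submod_closed rk_pred.
Proof.
split; first by apply/asboolP; exists 0; exact: kbnd0.
move=> a f g /asboolP[r fr] /asboolP[s gs]; apply/asboolP.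
by exists (cmod a * r + s); apply: kbndD => //; exact: kbndZ.
Qed.

HB.instance Definition _ := GRing.isSubmodClosed.Build R[i] (X -> R[i]) rk_pred
  rk_pred_submod.

Record rkhs := Rkhs { rkf :> X -> R[i]; rkP : rkf \in rk_pred }.

HB.instance Definition _ := [isSub for rkf].
HB.instance Definition _ := [Choice of rkhs by <:].
HB.instance Definition _ := [SubChoice_isSubLmodule of rkhs by <:].

Implicit Types u v w : rkhs.

Definition rknorm u : R := inf [set r | kbnd u r].

Lemma rknorm_bnd u : kbnd u (rknorm u).
Proof.
have ne : [set r | kbnd u r] !=set0 by have /asboolP := rkP u.
split; first by apply: lb_le_inf => // r [].
move=> l; have := knorm_ge0 l; rewrite le_eqVlt => /predU1P[l0|l0].
  by have [r [_ /(_ l)]] := ne; rewrite -l0 !mulr0.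
by rewrite -ler_pdivrMr //; apply: lb_le_inf => // r [_ /(_ l)]; rewrite ler_pdivrMr.
Qed.

Lemma rknorm_le u r : kbnd u r -> rknorm u <= r.
Proof. by move=> ur; apply: ge_inf => //; exists 0 => s []. Qed.

Lemma rknorm_ge0 u : 0 <= rknorm u. Proof. by case: (rknorm_bnd u). Qed.

Lemma keval_le u l : cmod (keval u l) <= rknorm u * knorm l.
Proof. by case: (rknorm_bnd u). Qed.

Lemma rknormD u v : rknorm (u + v) <= rknorm u + rknorm v.
Proof. by apply/rknorm_le/kbndD; exact: rknorm_bnd. Qed.

Lemma rknorm0_eq0 u : rknorm u = 0 -> u = 0.
Proof.
move=> u0; apply/val_inj/funext => x; apply: cmod_eq0; apply/le_anti.
rewrite cmod_ge0 andbT -keval1.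
by apply: le_trans (keval_le _ _) _; rewrite u0 mul0r.
Qed.

Lemma rknormZ a u : rknorm (a *: u) = cmod a * rknorm u.
Proof.
have le b w : rknorm (b *: w) <= cmod b * rknorm w.
  by apply/rknorm_le/kbndZ; exact: rknorm_bnd.
have [->|a0] := eqVneq a 0.
  rewrite cmod0 mul0r; apply/le_anti; rewrite rknorm_ge0 andbT.
  by apply: le_trans (le _ _) _; rewrite cmod0 mul0r.
apply/le_anti; rewrite le /=.
have c0 : 0 < cmod a.
  by rewrite lt_def cmod_ge0 andbT; apply: contra_neq a0 => /cmod_eq0.
rewrite -ler_pdivlMl //; have := le a^-1 (a *: u).
rewrite scalerA mulVf // scale1r => /le_trans; apply.
suff -> : cmod a^-1 = (cmod a)^-1 by [].
by apply: (mulfI (lt0r_neq0 c0)); rewrite -cmodM (mulfV a0) mulfV ?cmod1 // lt0r_neq0.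
Qed.

Lemma rknorm_ler_normD u v :
  (rknorm (u + v))%:C <= (rknorm u)%:C + (rknorm v)%:C.
Proof. by rewrite -rmorphD lecR rknormD. Qed.

Lemma rknorm_normrZ a u : (rknorm (a *: u))%:C = `|a| * (rknorm u)%:C.
Proof. by rewrite rknormZ cmodE -realCM. Qed.

Lemma rknorm_normr0_eq0 u : (rknorm u)%:C = 0 -> u = 0.
Proof. by move=> /(congr1 (@complex.Re R))/= /rknorm0_eq0. Qed.

HB.instance Definition _ := Lmodule_isNormed.Build R[i] rkhs
  rknorm_ler_normD rknorm_normrZ rknorm_normr0_eq0.

Lemma rk_normE u : `|u| = (rknorm u)%:C.
Proof. by []. Qed.

Lemma rknormB u v : rknorm (u - v) = rknorm (v - u).
Proof. by have := distrC u v; rewrite !rk_normE => -[]. Qed.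

Lemma keval_sum_le f l (e : R) : 0 <= e ->
    (forall x, cmod (f x) <= e * knorm [:: (1, x)]) ->
  cmod (keval f l) <= e * \sum_(p <- l) cmod p.1 * knorm [:: (1, p.2)].
Proof.
move=> e0 fe; rewrite /keval; elim: l => [|p l ih]; first by rewrite !big_nil cmod0 mulr0.
rewrite !big_cons mulrDr; apply: le_trans (cmodD _ _) (lerD _ ih).
by rewrite cmodM cmodJ mulrCA ler_wpM2l ?cmod_ge0.
Qed.

(** Evaluation at [x] is bounded by the norm of the point [x], so approximants converge pointwise. A
    formal combination meets finitely many points only, so the bound on functionals passes to the
    pointwise limit. *)
Lemma rk_approx (P : R -> rkhs -> Prop) :
  (forall e, 0 < e -> exists y, P e y) ->
  (forall e e' y y', P e y -> P e' y' -> rknorm (y - y') <= e + e') ->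
  exists y, forall e z, P e z -> rknorm (y - z) <= e.
Proof.
move=> ex cau.
have Pge0 e u : P e u -> 0 <= e.
  by move=> Pu; have := cau _ _ _ _ Pu Pu; have := rknorm_ge0 (u - u); lra.
have lim x : exists y, forall e u, P e u -> cmod (y - u x) <= e * knorm [:: (1, x)].
  pose n := knorm [:: (1, x)]; have n0 : 0 <= n := knorm_ge0 _.
  have [||y hy] := @complex_approx R
    (fun e y => exists e' u, [/\ P e' u, e' * n <= e & y = u x]).
  - move=> e e0; have [u Pu] : exists u, P (e / (n + 1)) u.
      by apply: ex; rewrite divr_gt0 // ltr_wpDl.
    exists (u x), (e / (n + 1)), u; split => //.
    rewrite -mulrA ler_piMr ?(ltW e0) // ler_pdivrMl ?ltr_wpDl //.
    by rewrite mulr1 lerDl.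
  - move=> e e' _ _ [d [u [Pu de ->]]] [d' [u' [Pu' de' ->]]].
    apply: le_trans (lerD de de'); rewrite -mulrDl.
    apply: le_trans (ler_wpM2r n0 (cau _ _ _ _ Pu Pu')).
    by have := keval_le (u - u') [:: (1, x)]; rewrite keval1.
  by exists y => e u Pu; apply: hy; exists e, u.
pose f x := sval (cid (lim x)).
have fP x e u : P e u -> cmod ((f - rkf u) x) <= e * knorm [:: (1, x)].
  by rewrite /f; move=> Pu; apply: (svalP (cid (lim x))).
have fu e u : P e u -> kbnd (f - rkf u) e.
  move=> Pu; split; first exact: Pge0 Pu.
  move=> l; apply: (@ler_eps_mul _ _ _
    (\sum_(p <- l) cmod p.1 * knorm [:: (1, p.2)] + knorm l)) => d d0.
  have [v Pv] := ex _ d0.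
  have -> : f - rkf u = (f - rkf v) + rkf (v - u) by rewrite /= addrA subrK.
  rewrite kevalD; apply: le_trans (cmodD _ _) _.
  have h1 := keval_sum_le l (ltW d0) (fun x => fP x _ _ Pv).
  have h2 := keval_le (v - u) l.
  have h3 := ler_wpM2r (knorm_ge0 l) (cau _ _ _ _ Pv Pu).
  move: (\sum_(p <- l) _) h1 => S h1; nra.
have f_in : f \in rk_pred.
  have [u Pu] := ex _ ltr01; apply/asboolP; exists (1 + rknorm u).
  by rewrite -(subrK (rkf u) f); apply: kbndD; [exact: fu | exact: rknorm_bnd].
by exists (Rkhs f_in) => e u Pu; apply: rknorm_le; exact: fu.
Qed.

Lemma rk_ballE (x y : rkhs) (e : R) : ball x e%:C y <-> rknorm (x - y) < e.
Proof. by rewrite -ball_normE /ball_/= rk_normE ltcR. Qed.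

Lemma rkhs_complete (F : set_system rkhs) : ProperFilter F -> cauchy F -> cvg F.
Proof.
move=> FF /cauchyP F_cauchy; apply/cvg_ex.
have [||y hy] := @rk_approx (fun e u => 0 < e /\ F (ball u e%:C)).
- move=> e e0; have e0' : (0 : R[i]) < e%:C by rewrite ltcR.
  by have [u Fu] := F_cauchy _ e0'; exists u.
- move=> e e' u u' [e0 Fu] [e0' Fu'].
  have [w [/rk_ballE uw /rk_ballE u'w]] := @filter_ex _ _ _ _ (filterI Fu Fu').
  rewrite (_ : u - u' = (u - w) + (w - u')); last by rewrite addrA subrK.
  by apply: le_trans (rknormD _ _) _; rewrite (rknormB w); lra.
exists y; apply/cvg_ballP => e e0.
have eE : e = (complex.Re e)%:C by apply: ge0_ReE; exact: ltW.
rewrite eE ltcR in e0; rewrite eE.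
move: (complex.Re e) e0 => {eE}e e0.
have e2 : 0 < e / 2 by rewrite divr_gt0.
have e2' : (0 : R[i]) < (e / 2)%:C by rewrite ltcR.
have [u Fu] := F_cauchy _ e2'.
apply: filterS (Fu) => w /rk_ballE uw; apply/rk_ballE.
have h := hy _ _ (conj e2 Fu); rewrite (_ : y - w = (y - u) + (u - w)).
  by apply: le_lt_trans (rknormD _ _) _; lra.
by rewrite addrA subrK.
Qed.

HB.instance Definition _ := Uniform_isComplete.Build rkhs rkhs_complete.

Lemma kvec_in l : kvec l \in rk_pred.
Proof. by apply/asboolP; exists (knorm l); exact: kbnd_kvec. Qed.

Definition rkvec l : rkhs := Rkhs (kvec_in l).

Lemma keval_rkvec l m : keval (rkvec l) m = kform l m.
Proof. by rewrite kform_eval. Qed.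

Lemma rkvec_cat_scale l a m : rkvec (l ++ kscale a m) = rkvec l + a *: rkvec m.
Proof.
apply/val_inj/funext => x /=; rewrite /kvec big_cat big_map; congr (_ + _).
by rewrite [RHS]mulr_sumr; apply: eq_bigr => p _; rewrite -mulrA.
Qed.

Lemma rknorm_rkvec l : rknorm (rkvec l) = knorm l.
Proof.
apply/le_anti; rewrite rknorm_le /=; last exact: kbnd_kvec.
have [->|lN0] := eqVneq (knorm l) 0; first exact: rknorm_ge0.
have l0 : 0 < knorm l by rewrite lt_def lN0 knorm_ge0.
have := keval_le (rkvec l) l; rewrite keval_rkvec kformE // cmod_real.
by rewrite ger0_norm ?knsq_ge0 // -knorm_sqr expr2 ler_pM2r.
Qed.

(** The almost maximiser of [kbounded_approx] represents the functional [u] up to [e] in the dual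
    norm, which is the norm of the space. *)
Lemma rkvec_dense u e : 0 < e -> exists l, rknorm (u - rkvec l) <= e.
Proof.
move=> e0; have [|l hl] := @kbounded_approx _ _ _ k_psd u (rknorm u ^+ 2) (e ^+ 2) _
    (exprn_gt0 _ e0).
  split; first exact: sqr_ge0.
  move=> l; rewrite -knorm_sqr -exprMn ler_pXn2r ?nnegrE ?cmod_ge0 ?keval_le //.
  by rewrite mulr_ge0 ?rknorm_ge0 ?knorm_ge0.
exists l; apply: rknorm_le; split=> [|m]; first exact: ltW.
rewrite kevalB keval_rkvec -(@ler_pXn2r _ 2) ?nnegrE ?cmod_ge0 //; last first.
  by rewrite mulr_ge0 ?knorm_ge0 ?ltW.
by rewrite exprMn knorm_sqr.
Qed.

(** Against a formal combination the product is an evaluation of [u]; for general [v] it is the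
    limit along combinations tending to [v], pinned down by this error bound. *)
Lemma rkinner_ex u v :
  exists z, forall l, cmod (z - keval u l) <= rknorm u * rknorm (v - rkvec l).
Proof.
have [||z hz] := @complex_approx R
    (fun e z => exists2 l, rknorm u * rknorm (v - rkvec l) <= e & z = keval u l).
- move=> e e0; have u1 : 0 < rknorm u + 1 by rewrite ltr_wpDl ?rknorm_ge0.
  have [|l hl] := @rkvec_dense v (e / (rknorm u + 1)); first by rewrite divr_gt0.
  exists (keval u l), l => //.
  apply: le_trans (ler_wpM2l (rknorm_ge0 u) hl) _.
  rewrite mulrCA ler_piMr ?(ltW e0) // ler_pdivrMr // mul1r lerDl //.
- move=> e e' _ _ [l le ->] [m me ->]; apply: le_trans (lerD le me).
  have -> : keval u l - keval u m = keval u (l ++ kscale (- 1) m).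
    by rewrite keval_cat keval_scale conjN conjc1 mulN1r.
  apply: le_trans (keval_le _ _) _; rewrite -mulrDr ler_wpM2l ?rknorm_ge0 //.
  rewrite -rknorm_rkvec rkvec_cat_scale scaleN1r (rknormB v (rkvec l)).
  by apply: le_trans (rknormD _ _); rewrite addrA subrK.
by exists z => l; apply: hz; exists l.
Qed.

Definition rkinner u v := sval (cid (rkinner_ex u v)).

Lemma rkinnerP u v l :
  cmod (rkinner u v - keval u l) <= rknorm u * rknorm (v - rkvec l).
Proof. exact: (svalP (cid (rkinner_ex u v))). Qed.

Lemma rkinner_rkvec u l : rkinner u (rkvec l) = keval u l.
Proof.
apply/eqP; rewrite -subr_eq0; apply/eqP/cmod_eq0/le_anti; rewrite cmod_ge0 andbT.
apply: le_trans (rkinnerP _ _ _) _; rewrite subrr.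
by have -> : rknorm 0 = 0; [apply/le_anti; rewrite rknorm_ge0 rknorm_le //; exact: kbnd0 | rewrite mulr0].
Qed.

Lemma rkinner_form u v l m :
  cmod (rkinner u v - kform l m) <=
  rknorm u * rknorm (v - rkvec m) +
  rknorm (u - rkvec l) * (rknorm (v - rkvec m) + rknorm v).
Proof.
have -> : rkinner u v - kform l m =
    (rkinner u v - keval u m) + keval (u - rkvec l) m.
  by rewrite kevalB keval_rkvec addrA subrK.
apply: le_trans (cmodD _ _) _; apply: lerD; first exact: rkinnerP.
apply: le_trans (keval_le _ _) _; rewrite ler_wpM2l ?rknorm_ge0 //.
rewrite -rknorm_rkvec (rknormB v).
by apply: le_trans (rknormD _ _); rewrite subrK.
Qed.

Lemma rkinnerPl a u v w : rkinner (a *: u + v) w = a * rkinner u w + rkinner v w.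
Proof.
apply/eqP; rewrite -subr_eq0; apply/eqP.
apply: (@cmod_eps _ _ (rknorm (a *: u + v) + cmod a * rknorm u + rknorm v)) => e e0.
have [l hl] := rkvec_dense w e0.
have h1 := rkinnerP (a *: u + v) w l; have h2 := rkinnerP u w l; have h3 := rkinnerP v w l.
rewrite kevalD kevalZ in h1.
have -> : rkinner (a *: u + v) w - (a * rkinner u w + rkinner v w) =
  (rkinner (a *: u + v) w - (a * keval u l + keval v l)) -
  a * (rkinner u w - keval u l) - (rkinner v w - keval v l) by ring.
apply: le_trans (cmodD _ _) _; rewrite cmodN.
apply: le_trans (lerD (cmodD _ _) h3) _; rewrite cmodN cmodM.
apply: le_trans (lerD (lerD h1 (ler_wpM2l (cmod_ge0 _) h2)) (lexx _)) _.
rewrite mulrA -!mulrDl mulrC ler_wpM2r //.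
by rewrite !addr_ge0 ?mulr_ge0 ?rknorm_ge0 ?cmod_ge0.
Qed.

Lemma rkinnerC u v : rkinner u v = (rkinner v u)^*%C.
Proof.
apply/eqP; rewrite -subr_eq0; apply/eqP.
apply: (@cmod_eps _ _ (2 * (rknorm u + rknorm v + 1)))=> e0 e00.
pose e := Num.min e0 1.
have e_gt0 : 0 < e by rewrite lt_min e00 ltr01.
have e1 : e <= 1 by rewrite ge_min lexx orbT.
have ee0 : e <= e0 by rewrite ge_min lexx.
have [l hl] := rkvec_dense u e_gt0; have [m hm] := rkvec_dense v e_gt0.
have h1 := rkinner_form u v l m; have h2 := rkinner_form v u m l.
rewrite -cmodJ conjB -(kformC k_psd) in h2.
have -> : rkinner u v - (rkinner v u)^*%C =
  (rkinner u v - kform l m) - ((rkinner v u)^*%C - kform l m) by ring.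
apply: le_trans (cmodD _ _) _; rewrite cmodN; apply: le_trans (lerD h1 h2) _.
have := rknorm_ge0 u; have := rknorm_ge0 v.
move: (rknorm_ge0 (u - rkvec l)) (rknorm_ge0 (v - rkvec m)) hl hm.
move: (rknorm (u - _)) (rknorm (v - _)) (rknorm u) (rknorm v) => {h1 h2}a b c d a0 b0 ae be d0 c0.
have : c * b <= c * e0 by apply: ler_wpM2l => //; exact: le_trans be ee0.
have : d * a <= d * e0 by apply: ler_wpM2l => //; exact: le_trans ae ee0.
have : a * b <= e0 * 1 by apply: ler_pM => //; [exact: le_trans ae ee0 | exact: le_trans be e1].
lra.
Qed.

Lemma rkinner_norm u : rkinner u u = (rknorm u ^+ 2)%:C.
Proof.
apply/eqP; rewrite -subr_eq0; apply/eqP.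
apply: (@cmod_eps _ _ (4 * rknorm u + 2)) => e0 e00.
pose e := Num.min e0 1.
have e_gt0 : 0 < e by rewrite lt_min e00 ltr01.
have e1 : e <= 1 by rewrite ge_min lexx orbT.
have ee0 : e <= e0 by rewrite ge_min lexx.
have [l hl] := rkvec_dense u e_gt0; have h := rkinner_form u u l l.
rewrite kformE // -knorm_sqr -rknorm_rkvec in h.
have h1 : rknorm u <= rknorm (u - rkvec l) + rknorm (rkvec l).
  by apply: le_trans (rknormD _ _); rewrite subrK.
have h2 : rknorm (rkvec l) <= rknorm (u - rkvec l) + rknorm u.
  by rewrite (rknormB u); apply: le_trans (rknormD _ _); rewrite subrK.
have -> : rkinner u u - (rknorm u ^+ 2)%:C =
  (rkinner u u - (rknorm (rkvec l) ^+ 2)%:C) +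
  (rknorm (rkvec l) ^+ 2 - rknorm u ^+ 2)%:C by rewrite [in RHS]rmorphB /=; ring.
apply: le_trans (cmodD _ _) _; rewrite cmod_real.
apply: le_trans (lerD h (lexx _)) _.
have := rknorm_ge0 u; have := rknorm_ge0 (rkvec l).
move: (rknorm_ge0 (u - rkvec l)) hl h1 h2.
move: (rknorm (u - _)) (rknorm u) (rknorm (rkvec l)) => {h}a c d a0 ae h1 h2 d0 c0.
have h3 : `|d ^+ 2 - c ^+ 2| <= a * (2 * c + a).
  by rewrite ler_norml; apply/andP; split; nra.
have : c * a <= c * e0 by apply: ler_wpM2l => //; exact: le_trans ae ee0.
have : a * a <= e0 * 1 by apply: ler_pM => //; [exact: le_trans ae ee0 | exact: le_trans ae e1].
lra.
Qed.

Lemma rkinner_bilinear : bilinear_for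
  (GRing.Scale.Law.clone _ _ ( *%R) _)
  (GRing.Scale.Law.clone _ _ (Num.conj \; *%R) _) rkinner.
Proof.
split=> [w a u v|w a u v]; first exact: rkinnerPl.
rewrite !(rkinnerC w) rkinnerPl conjD conjM; reflexivity.
Qed.

HB.instance Definition _ := bilinear_isBilinear.Build R[i] rkhs rkhs R[i]
  ( *%R) (Num.conj \; *%R) rkinner rkinner_bilinear.

Lemma rkinner_hermitian (u v : rkhs) :
  rkinner u v = (-1) ^+ false * Num.conj (rkinner v u).
Proof. by rewrite expr0 mul1r [LHS]rkinnerC. Qed.

HB.instance Definition _ := isHermitianSesquilinear.Build R[i] rkhs false Num.conj
  rkinner rkinner_hermitian.

Lemma rkinner_gt0 (u : rkhs) : u != 0 -> 0 < rkinner u u.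
Proof.
move=> u0; rewrite rkinner_norm ltcR exprn_gt0 // lt_def rknorm_ge0 andbT.
by apply: contra_neq u0; exact: rknorm0_eq0.
Qed.

HB.instance Definition _ := isDotProduct.Build R[i] rkhs rkinner rkinner_gt0.

Lemma rkinner_normE (u : rkhs) : rkinner u u = `|u| ^+ 2.
Proof. by rewrite rkinner_norm rk_normE rmorphXn. Qed.

Definition rk_hilbert : hilbert R :=
  @Hilbert R rkhs rkinner rkinner_normE.

End RKHS.

(** The source of the direct sums, Stinespring spaces, orthogonal complements and column spaces
    below. Density of the span of the [g x] is expressed by the triviality of its orthogonal
    complement, so vectors and operators can be compared on the [g x]. *)
Theorem kernel_hilbert (R : realType) (X : Type) (k : X -> X -> R[i])
    (k_psd : psd k) :
  exists (M : hilbert R) (g : X -> M),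
    (forall x y, inner M (g x) (g y) = k x y) /\
    (forall z, (forall x, inner M z (g x) = 0) -> z = 0).
Proof.
exists (rk_hilbert k_psd), (fun x => rkvec k_psd [:: (1, x)]).
split=> [x y|z z0].
  by rewrite /= rkinner_rkvec keval1 /= /kvec big_seq1 mul1r.
apply/val_inj/funext => x; rewrite -keval1 -[LHS](rkinner_rkvec k_psd).
exact: z0.
Qed.

(** * Inner products, completeness and the Riesz representation theorem *)

Section HilbertBasics.
Variable R : realType.
Implicit Types H K L : hilbert R.
Local Notation Re := (@complex.Re R).

Lemma rnormE H (x : H) : `|x| = (rnorm x)%:C.
Proof. exact: ge0_ReE. Qed.

Lemma inner_rnorm H (x : H) : inner H x x = (rnorm x ^+ 2)%:C.
Proof. by rewrite inner_norm rnormE rmorphXn. Qed.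

Lemma rnorm_ge0 H (x : H) : 0 <= rnorm x.
Proof. exact: Re_ge0. Qed.

Lemma rnormD H (x y : H) : rnorm (x + y) <= rnorm x + rnorm y.
Proof. by have := ler_normD x y; rewrite !rnormE -rmorphD lecR. Qed.

Lemma rnormZ H a (x : H) : rnorm (a *: x) = cmod a * rnorm x.
Proof. by rewrite /rnorm normrZ rnormE cmodE -realCM. Qed.

Lemma rnormN H (x : H) : rnorm (- x) = rnorm x.
Proof. by rewrite /rnorm normrN. Qed.

Lemma rnormB H (x y : H) : rnorm (x - y) = rnorm (y - x).
Proof. by rewrite -rnormN opprB. Qed.

Lemma rnorm0 H : rnorm (0 : H) = 0.
Proof. by rewrite /rnorm normr0. Qed.

Lemma rnorm_eq0 H (x : H) : rnorm x = 0 -> x = 0.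
Proof. by move=> x0; apply/normr0_eq0; rewrite rnormE x0. Qed.

Lemma rnorm_le0 H (x : H) : rnorm x <= 0 -> x = 0.
Proof. by move=> x0; apply/rnorm_eq0/le_anti; rewrite x0 rnorm_ge0. Qed.

Lemma rnorm_eps H (x : H) (c : R) :
  (forall e, 0 < e -> rnorm x <= e * c) -> x = 0.
Proof.
by move=> h; apply/rnorm_le0/(@ler_eps_mul _ _ _ c) => e e0; rewrite add0r h.
Qed.

Lemma rnorm_sub_trans H (x y z : H) : rnorm (x - z) <= rnorm (x - y) + rnorm (y - z).
Proof. by apply: le_trans (rnormD _ _); rewrite addrA subrK. Qed.

Lemma innerC H (x y : H) : inner H x y = (inner H y x)^*%C.
Proof. by rewrite hermC expr0 mul1r. Qed.

Lemma innerDl H (x y z : H) : inner H (x + y) z = inner H x z + inner H y z.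
Proof. exact: linearDl. Qed.

Lemma innerDr H (x y z : H) : inner H z (x + y) = inner H z x + inner H z y.
Proof. exact: linearDr. Qed.

Lemma innerZl H a (x z : H) : inner H (a *: x) z = a * inner H x z.
Proof. exact: linearZl_LR. Qed.

Lemma innerZr H a (x z : H) : inner H z (a *: x) = a^*%C * inner H z x.
Proof. exact: linearZr_LR. Qed.

Lemma innerNl H (x z : H) : inner H (- x) z = - inner H x z.
Proof. exact: linearNl. Qed.

Lemma innerNr H (x z : H) : inner H z (- x) = - inner H z x.
Proof. exact: linearNr. Qed.

Lemma innerBl H (x y z : H) : inner H (x - y) z = inner H x z - inner H y z.
Proof. exact: linearBl. Qed.

Lemma innerBr H (x y z : H) : inner H z (x - y) = inner H z x - inner H z y.
Proof. exact: linearBr. Qed.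

Lemma inner0l H (z : H) : inner H 0 z = 0.
Proof. exact: linear0l. Qed.

Lemma inner0r H (z : H) : inner H z 0 = 0.
Proof. exact: linear0r. Qed.

Lemma inner_suml H I (r : seq I) (P : pred I) (F : I -> H) z :
  inner H (\sum_(i <- r | P i) F i) z = \sum_(i <- r | P i) inner H (F i) z.
Proof.
by elim/big_rec2: _ => [|i y x _ <-]; rewrite ?inner0l ?innerDl.
Qed.

Lemma inner_sumr H I (r : seq I) (P : pred I) (F : I -> H) z :
  inner H z (\sum_(i <- r | P i) F i) = \sum_(i <- r | P i) inner H z (F i).
Proof.
by elim/big_rec2: _ => [|i y x _ <-]; rewrite ?inner0r ?innerDr.
Qed.

Lemma rnorm_sqr H (x : H) : rnorm x ^+ 2 = Re (inner H x x).
Proof. by rewrite inner_rnorm. Qed.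

Lemma inner_ext H (x y : H) : (forall z, inner H x z = inner H y z) -> x = y.
Proof.
move=> h; apply/eqP; rewrite -subr_eq0; apply/eqP/rnorm_eq0/eqP.
by rewrite -sqrf_eq0 rnorm_sqr innerBl h subrr.
Qed.

Lemma rnormD_sqr H (x y : H) :
  rnorm (x + y) ^+ 2 = rnorm x ^+ 2 + rnorm y ^+ 2 + 2 * Re (inner H x y).
Proof.
rewrite !rnorm_sqr innerDl !innerDr !ReD (innerC y x) ReJ; ring.
Qed.

Definition lsum H X (g : X -> H) (l : seq (R[i] * X)) : H :=
  \sum_(p <- l) p.1 *: g p.2.

Lemma lsum_nil H X (g : X -> H) : lsum g [::] = 0.
Proof. exact: big_nil. Qed.

Lemma lsum_cons H X (g : X -> H) p l : lsum g (p :: l) = p.1 *: g p.2 + lsum g l.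
Proof. exact: big_cons. Qed.

Lemma lsum_sub H X (g : X -> H) l m :
  lsum g (l ++ kscale (- 1) m) = lsum g l - lsum g m.
Proof.
rewrite /lsum big_cat big_map /= -sumrN; congr (_ + _); apply: eq_bigr => p _ /=.
by rewrite mulN1r scaleNr.
Qed.

Lemma kform_lsum H X (g h : X -> H) l m :
  kform (fun x y => inner H (g x) (h y)) l m = inner H (lsum g l) (lsum h m).
Proof.
rewrite inner_suml; apply: eq_bigr => p _; rewrite inner_sumr.
by apply: eq_bigr => q _; rewrite innerZl innerZr mulrA.
Qed.

Lemma psd_inner H X (g : X -> H) : psd (fun x y => inner H (g x) (g y)).
Proof. by move=> l; rewrite kform_lsum inner_rnorm lecR sqr_ge0. Qed.

Lemma knsq_lsum H X (g : X -> H) l :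
  knsq (fun x y => inner H (g x) (g y)) l = rnorm (lsum g l) ^+ 2.
Proof. by rewrite /knsq kform_lsum rnorm_sqr. Qed.

Lemma psd_CauchySchwarz X (k : X -> X -> R[i]) x y : psd k ->
  cmod (k x y) ^+ 2 <= Re (k x x) * Re (k y y).
Proof.
move=> k_psd; have := kform_CauchySchwarz k_psd [:: (1, x)] [:: (1, y)].
by rewrite /knsq /kform !big_seq1 !conjc1 !mul1r.
Qed.

Lemma CauchySchwarz H (x y : H) : cmod (inner H x y) <= rnorm x * rnorm y.
Proof.
rewrite -(@ler_pXn2r _ 2) ?nnegrE ?cmod_ge0 ?mulr_ge0 ?rnorm_ge0 //.
by rewrite exprMn !rnorm_sqr (psd_CauchySchwarz x y (psd_inner id)).
Qed.

Lemma Re_inner_le H (x y : H) : Re (inner H x y) <= rnorm x * rnorm y.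
Proof. exact: le_trans (Re_le _) (CauchySchwarz _ _). Qed.

(** Completeness enters through a sequence of accuracy [1 / (n + 1)]; users supply a predicate, read
    as being within [e] of the limit, instead of a sequence. *)
Lemma hilbert_approx H (P : R -> H -> Prop) :
  (forall e, 0 < e -> exists y, P e y) ->
  (forall e e' y y', P e y -> P e' y' -> rnorm (y - y') <= e + e') ->
  exists y, forall e z, P e z -> rnorm (y - z) <= e.
Proof.
move=> ex cau.
have /choice[y yP] : forall n : nat, exists y, P n.+1%:R^-1 y.
  by move=> n; apply: ex; rewrite invr_gt0.
have small (e : R) : 0 < e -> exists N : nat, N.+1%:R^-1 < e.
  move=> e0; exists (Num.bound e^-1); rewrite invf_plt ?posrE //.
  by apply: lt_trans (archi_boundP _) _; rewrite ?ltr_nat // invr_ge0 ltW.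
have mono (m n : nat) : (m <= n)%N -> (n.+1%:R^-1 : R) <= m.+1%:R^-1.
  by move=> mn; rewrite lef_pV2 ?posrE // ler_nat.
have ballE (x z : H) (e : R) : ball x e%:C z <-> rnorm (x - z) < e.
  by rewrite -ball_normE /ball_/= rnormE ltcR.
have : cauchy (y @ \oo).
  apply/cauchyP => e e0.
  have eE : e = (Re e)%:C by apply: ge0_ReE; exact: ltW.
  rewrite eE ltcR in e0; rewrite eE; move: (Re e) e0 => {eE}e e0.
  have [N NE] : exists N : nat, N.+1%:R^-1 < e / 2 by apply: small; rewrite divr_gt0.
  exists (y N); exists N => // n /= Nn; apply/ballE.
  apply: le_lt_trans (cau _ _ _ _ (yP N) (yP n)) _.
  have := mono _ _ Nn; move: (n.+1%:R^-1) (N.+1%:R^-1) NE => a b; lra.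
move=> /cauchy_cvg /cvg_ex[l /cvg_ballP yl]; exists l => e z Pz.
apply: (@ler_eps_mul _ _ _ 2) => d d0.
have d0' : (0 : R[i]) < d%:C by rewrite ltcR.
have [N _ NP] := yl _ d0'; have [M Md] := small _ d0.
pose n := maxn N M.
have /ballE h1 : ball l d%:C (y n) by apply: NP; rewrite /= leq_maxl.
have h2 := cau _ _ _ _ (yP n) Pz; have h3 := mono _ _ (leq_maxr N M).
apply: le_trans (rnorm_sub_trans l (y n) z) _; rewrite -/n in h3.
by move: (n.+1%:R^-1) (M.+1%:R^-1) Md h2 h3 => a b; lra.
Qed.

(** There is no orthogonal projection in the argument: [kbounded_approx] gives vectors representing
    [f] up to [e], two such vectors of accuracies [e] and [e'] are within [e + e'], and their limit
    represents [f]. The functional is antilinear, as is the inner product in its second argument. *)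
Theorem riesz H (f : H -> R[i]) (r : R) :
  (forall a x y, f (a *: x + y) = a^*%C * f x + f y) ->
  (forall x, cmod (f x) <= r * rnorm x) ->
  exists z, forall x, f x = inner H z x.
Proof.
move=> flin fr.
have f0 : f 0 = 0.
  have := flin 1 0 0; rewrite scale1r add0r conjc1 mul1r => /eqP.
  by rewrite addrC -subr_eq subrr eq_sym => /eqP.
have fl l : keval f l = f (lsum id l).
  elim: l => [|p l ih]; first by rewrite /keval /lsum !big_nil f0.
  by rewrite /lsum big_cons flin -/(lsum id l) -ih /keval big_cons.
have f_bd : kbounded (fun x y => inner H x y) f (r ^+ 2).
  split; first exact: sqr_ge0.
  move=> l; rewrite (knsq_lsum id) fl -exprMn ler_pXn2r ?nnegrE ?cmod_ge0 //.
  exact: le_trans (cmod_ge0 _) (fr _).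
have [||z hz] := @hilbert_approx H (fun e y => 0 <= e /\
    forall m, cmod (f m - inner H y m) <= e * rnorm m).
- move=> e e0.
  have [l hl] := kbounded_approx (psd_inner id) f_bd (exprn_gt0 2 e0).
  exists (lsum id l); split; first exact: ltW.
  move=> m; rewrite -(@ler_pXn2r _ 2) ?nnegrE ?cmod_ge0 //; last first.
    by rewrite mulr_ge0 ?rnorm_ge0 ?ltW.
  have := hl [:: (1, m)]; rewrite knsq_lsum (kform_lsum id id) fl exprMn.
  by rewrite /lsum !big_seq1 scale1r.
- move=> e e' y y' [e0 hy] [e0' hy'].
  have h : rnorm (y - y') * rnorm (y - y') <= (e + e') * rnorm (y - y').
    rewrite -expr2 rnorm_sqr; apply: le_trans (Re_le _) _.
    rewrite (_ : inner H _ _ = (f (y - y') - inner H y' (y - y')) -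
      (f (y - y') - inner H y (y - y'))); last by rewrite [LHS]innerBl; ring.
    apply: le_trans (cmodD _ _) _; rewrite cmodN mulrDl addrC.
    exact: lerD.
  have [->|n0] := eqVneq (rnorm (y - y')) 0; first exact: addr_ge0.
  by move: h; rewrite ler_pM2r // lt_def n0 rnorm_ge0.
exists z => x; apply/eqP; rewrite -subr_eq0; apply/eqP.
apply: (@cmod_eps _ _ (2 * rnorm x)) => e e0.
have [l hl] := kbounded_approx (psd_inner id) f_bd (exprn_gt0 2 e0).
pose y := lsum id l.
have hy m : cmod (f m - inner H y m) <= e * rnorm m.
  rewrite -(@ler_pXn2r _ 2) ?nnegrE ?cmod_ge0 //; last first.
    by rewrite mulr_ge0 ?rnorm_ge0 ?ltW.
  have := hl [:: (1, m)]; rewrite knsq_lsum (kform_lsum id id) fl exprMn.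
  by rewrite /lsum !big_seq1 scale1r.
have zy := hz _ _ (conj (ltW e0) hy).
rewrite (_ : _ - _ = (f x - inner H y x) - inner H (z - y) x); last first.
  by rewrite innerBl; ring.
apply: le_trans (cmodD _ _) _; rewrite cmodN.
apply: le_trans (lerD (hy x) (CauchySchwarz _ _)) _.
have := ler_wpM2r (rnorm_ge0 x) zy; lra.
Qed.

End HilbertBasics.

(** * Bounded operators *)

Section BoundedOperators.
Variable R : realType.
Implicit Types H K L : hilbert R.
Local Notation Re := (@complex.Re R).

Section Linear.
Variables (H K : hilbert R) (A : H -> K).
Hypothesis A_lin : linear A.

Lemma lin0 : A 0 = 0.
Proof.
by apply: (@addIr _ (A 0)); have := A_lin 1 0 0; rewrite !scale1r !add0r.
Qed.

Lemma linD x y : A (x + y) = A x + A y.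
Proof. by have := A_lin 1 x y; rewrite !scale1r. Qed.

Lemma linZ a x : A (a *: x) = a *: A x.
Proof. by have := A_lin a x 0; rewrite lin0 !addr0. Qed.

Lemma linN x : A (- x) = - A x.
Proof. by rewrite -scaleN1r linZ scaleN1r. Qed.

Lemma linB x y : A (x - y) = A x - A y.
Proof. by rewrite linD linN. Qed.

Lemma lin_sum I (r : seq I) (P : pred I) (F : I -> H) :
  A (\sum_(i <- r | P i) F i) = \sum_(i <- r | P i) A (F i).
Proof. by elim/big_rec2: _ => [|i y x _ <-]; rewrite ?lin0 ?linD. Qed.

Lemma lin_lsum X (g : X -> H) l : A (lsum g l) = lsum (fun x => A (g x)) l.
Proof. by rewrite lin_sum; apply: eq_bigr => p _; rewrite linZ. Qed.

End Linear.

Lemma opDE H K (A B : H -> K) x : (A + B) x = A x + B x. Proof. by []. Qed.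
Lemma opNE H K (A : H -> K) x : (- A) x = - A x. Proof. by []. Qed.
Lemma opBE H K (A B : H -> K) x : (A - B) x = A x - B x. Proof. by []. Qed.
Lemma opZE H K a (A : H -> K) x : (a *: A) x = a *: A x. Proof. by []. Qed.
Lemma op0E H K x : (0 : H -> K) x = 0. Proof. by []. Qed.
Lemma op_sumE H K I (r : seq I) (P : pred I) (F : I -> H -> K) x :
  (\sum_(i <- r | P i) F i) x = \sum_(i <- r | P i) F i x.
Proof. by elim/big_rec2: _ => // i y B _ <-. Qed.

Definition opE := (opDE, opNE, opBE, opZE, op0E, op_sumE).

Lemma bop_lin H K (A : H -> K) : bounded_op A -> linear A.
Proof. by case. Qed.

Lemma linear_bop H K (A : H -> K) (r : R) :
  linear A -> (forall x, rnorm (A x) <= r * rnorm x) -> bounded_op A.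
Proof. by move=> Al Ar; split=> //; exists r. Qed.

Lemma opnorm_ubound H K (A : H -> K) : bounded_op A ->
  has_sup [set rnorm (A x) | x in [set x : H | rnorm x <= 1]].
Proof.
move=> [Al [M AM]]; split; first by exists (rnorm (A 0)), 0; rewrite //= rnorm0.
exists `|M| => _ [x /= x1 <-]; apply: le_trans (AM x) _.
apply: le_trans (ler_wpM2r (rnorm_ge0 _) (ler_norm M)) _.
by rewrite ler_piMr.
Qed.

Lemma opnorm_ge0 H K (A : H -> K) : bounded_op A -> 0 <= opnorm A.
Proof.
move=> hA; apply: le_trans (rnorm_ge0 (A 0)) _.
by apply: sup_upper_bound (opnorm_ubound hA) _ _; exists 0; rewrite //= rnorm0.
Qed.

Lemma opnormP H K (A : H -> K) x : bounded_op A -> rnorm (A x) <= opnorm A * rnorm x.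
Proof.
move=> hA; have [x0|x0] := eqVneq (rnorm x) 0.
  by rewrite (rnorm_eq0 x0) (lin0 (bop_lin hA)) !rnorm0 mulr0.
have {}x0 : 0 < rnorm x by rewrite lt_def x0 rnorm_ge0.
have c0 : cmod (rnorm x)^-1%:C = (rnorm x)^-1.
  by rewrite cmod_real ger0_norm // invr_ge0 ltW.
rewrite -ler_pdivrMr // mulrC -c0 -rnormZ -(linZ (bop_lin hA)).
apply: sup_upper_bound (opnorm_ubound hA) _ _; exists ((rnorm x)^-1%:C *: x) => //=.
by rewrite rnormZ c0 mulVf // lt0r_neq0.
Qed.

Lemma opnorm_le H K (A : H -> K) (r : R) : 0 <= r ->
  (forall x, rnorm (A x) <= r * rnorm x) -> opnorm A <= r.
Proof.
move=> r0 Ar; apply: ge_sup; first by exists (rnorm (A 0)), 0; rewrite //= rnorm0.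
by move=> _ [x /= x1 <-]; apply: le_trans (Ar x) _; rewrite ler_piMr.
Qed.

Lemma bop0 H K : bounded_op (0 : H -> K).
Proof.
apply: (@linear_bop _ _ _ 0) => [a x y|x]; first by rewrite !opE scaler0 addr0.
by rewrite opE rnorm0 mul0r.
Qed.

Lemma bop_id H : bounded_op (@idfun H).
Proof. by apply: (@linear_bop _ _ _ 1) => // x; rewrite mul1r. Qed.

Lemma bopD H K (A B : H -> K) : bounded_op A -> bounded_op B -> bounded_op (A + B).
Proof.
move=> hA hB; apply: (@linear_bop _ _ _ (opnorm A + opnorm B)) => [a x y|x].
  rewrite !opE (bop_lin hA) (bop_lin hB) scalerDr.
  by rewrite !addrA; congr (_ + _); rewrite addrAC.
by rewrite opE mulrDl; apply: le_trans (rnormD _ _) (lerD _ _); exact: opnormP.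
Qed.

Lemma bopZ H K a (A : H -> K) : bounded_op A -> bounded_op (a *: A).
Proof.
move=> hA; apply: (@linear_bop _ _ _ (cmod a * opnorm A)) => [b x y|x].
  by rewrite !opE (bop_lin hA) scalerDr !scalerA mulrC.
by rewrite opE rnormZ -mulrA ler_wpM2l ?cmod_ge0 // opnormP.
Qed.

Lemma bopN H K (A : H -> K) : bounded_op A -> bounded_op (- A).
Proof. by move=> hA; rewrite -scaleN1r; exact: bopZ. Qed.

Lemma bopB H K (A B : H -> K) : bounded_op A -> bounded_op B -> bounded_op (A - B).
Proof. by move=> hA hB; apply: bopD => //; exact: bopN. Qed.

Lemma bop_sum H K I (r : seq I) (P : pred I) (F : I -> H -> K) :
  (forall i, P i -> bounded_op (F i)) -> bounded_op (\sum_(i <- r | P i) F i).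
Proof. by move=> hF; elim/big_ind: _ => //; [exact: bop0 | exact: bopD]. Qed.

Lemma bop_comp H K L (A : K -> L) (B : H -> K) :
  bounded_op A -> bounded_op B -> bounded_op (A \o B).
Proof.
move=> hA hB; apply: (@linear_bop _ _ _ (opnorm A * opnorm B)) => [b x y|x] /=.
  by rewrite (bop_lin hB) (bop_lin hA).
apply: le_trans (opnormP _ hA) _.
by rewrite -mulrA ler_wpM2l ?opnorm_ge0 ?opnormP.
Qed.

Lemma opnormD H K (A B : H -> K) : bounded_op A -> bounded_op B ->
  opnorm (A + B) <= opnorm A + opnorm B.
Proof.
move=> hA hB; apply: opnorm_le => [|x]; first by rewrite addr_ge0 ?opnorm_ge0.
by rewrite opE mulrDl; apply: le_trans (rnormD _ _) (lerD _ _); exact: opnormP.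
Qed.

Lemma opnormZ H K a (A : H -> K) : bounded_op A -> opnorm (a *: A) <= cmod a * opnorm A.
Proof.
move=> hA; apply: opnorm_le => [|x]; first by rewrite mulr_ge0 ?cmod_ge0 ?opnorm_ge0.
by rewrite opE rnormZ -mulrA ler_wpM2l ?cmod_ge0 // opnormP.
Qed.

Lemma opnorm_comp H K L (A : K -> L) (B : H -> K) :
  bounded_op A -> bounded_op B -> opnorm (A \o B) <= opnorm A * opnorm B.
Proof.
move=> hA hB; apply: opnorm_le => [|x]; first by rewrite mulr_ge0 ?opnorm_ge0.
by apply: le_trans (opnormP _ hA) _; rewrite -mulrA ler_wpM2l ?opnorm_ge0 ?opnormP.
Qed.

Lemma opnormB H K (A B : H -> K) : opnorm (A - B) = opnorm (B - A).
Proof.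
rewrite /opnorm; congr (sup _); apply: eq_imagel => x _.
by rewrite !opE rnormB.
Qed.

Lemma opnormN H K (A : H -> K) : opnorm (- A) = opnorm A.
Proof. by rewrite -[- A]sub0r opnormB subr0. Qed.

Lemma opnorm_triangle H K (A B C : H -> K) :
  bounded_op A -> bounded_op B -> bounded_op C ->
  opnorm (A - C) <= opnorm (A - B) + opnorm (B - C).
Proof.
move=> hA hB hC; rewrite -[A - C](_ : (A - B) + (B - C) = _).
  by apply: opnormD; exact: bopB.
by rewrite addrA subrK.
Qed.

Lemma opnorm_dist H K (A B : H -> K) : bounded_op A -> bounded_op B ->
  opnorm A <= opnorm B + opnorm (A - B).
Proof.
move=> hA hB; rewrite -{1}[A](subrK B) addrC; apply: opnormD => //; exact: bopB.
Qed.

Lemma opnorm_eps H K (A : H -> K) (c : R) : bounded_op A ->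
  (forall e, 0 < e -> opnorm A <= e * c) -> A = 0.
Proof.
move=> hA h; apply/funext => x; apply: (@rnorm_eps _ _ _ (c * rnorm x)) => e e0.
apply: le_trans (opnormP x hA) _.
by rewrite mulrA ler_wpM2r ?rnorm_ge0 ?h.
Qed.

Lemma opnorm0 H K : opnorm (0 : H -> K) = 0.
Proof.
apply/le_anti; rewrite opnorm_ge0 ?andbT; last exact: bop0.
by apply: opnorm_le => // x; rewrite opE rnorm0 mul0r.
Qed.

(** For bounded [A] the vector exists by [riesz] and is unique; otherwise [xget] may fall back to 0.
    A total function allows rewriting with algebraic identities, unlike the relation
    [is_adjoint]. *)
Definition adj H K (A : H -> K) (y : K) : H :=
  xget 0 [set z | forall x, inner K (A x) y = inner H x z].

Lemma adjE H K (A : H -> K) x y : bounded_op A ->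
  inner K (A x) y = inner H x (adj A y).
Proof.
move=> hA; rewrite /adj; move: x.
suff [z hz] : exists z, forall x, inner K (A x) y = inner H x z.
  by apply: (@xgetPex _ 0 [set z | forall x, inner K (A x) y = inner H x z]); exists z.
have [||z hz] := @riesz _ H (fun x => inner K y (A x)) (rnorm y * opnorm A).
- by move=> a u v; rewrite (bop_lin hA) innerDr innerZr.
- move=> x; apply: le_trans (CauchySchwarz _ _) _.
  by rewrite -mulrA ler_wpM2l ?rnorm_ge0 ?opnormP.
by exists z => x; rewrite (innerC (A x)) hz -innerC.
Qed.

Lemma adjEr H K (A : H -> K) x y : bounded_op A ->
  inner H (adj A y) x = inner K y (A x).
Proof. by move=> hA; rewrite innerC -adjE // -innerC. Qed.

Lemma inner_extr H (x y : H) : (forall z, inner H z x = inner H z y) -> x = y.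
Proof. by move=> h; apply: inner_ext => z; rewrite innerC h -innerC. Qed.

Lemma adj_uniq H K (A : H -> K) (B : K -> H) : bounded_op A ->
  (forall x y, inner K (A x) y = inner H x (B y)) -> adj A = B.
Proof.
by move=> hA hB; apply/funext => y; apply: inner_extr => x; rewrite -adjE.
Qed.

Lemma rnorm_adj H K (A : H -> K) y : bounded_op A ->
  rnorm (adj A y) <= opnorm A * rnorm y.
Proof.
move=> hA; have [->|n0] := eqVneq (rnorm (adj A y)) 0.
  by rewrite mulr_ge0 ?opnorm_ge0 ?rnorm_ge0.
rewrite -(@ler_pM2r _ (rnorm (adj A y))); last by rewrite lt_def n0 rnorm_ge0.
rewrite -expr2 rnorm_sqr adjEr // innerC ReJ; apply: le_trans (Re_inner_le _ _) _.
by rewrite mulrAC ler_wpM2r ?rnorm_ge0 ?opnormP.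
Qed.

Lemma bop_adj H K (A : H -> K) : bounded_op A -> bounded_op (adj A).
Proof.
move=> hA; apply: (@linear_bop _ _ _ (opnorm A)) => [a x y|y]; last exact: rnorm_adj.
by apply: inner_extr => z; rewrite innerDr innerZr -!adjE // innerDr innerZr.
Qed.

Lemma adjK H K (A : H -> K) : bounded_op A -> adj (adj A) = A.
Proof. by move=> hA; apply: adj_uniq; [exact: bop_adj | move=> x y; exact: adjEr]. Qed.

Lemma adj_comp H K L (A : K -> L) (B : H -> K) :
  bounded_op A -> bounded_op B -> adj (A \o B) = adj B \o adj A.
Proof.
move=> hA hB; apply: adj_uniq; first exact: bop_comp.
by move=> x y /=; rewrite !adjE.
Qed.

Lemma adjD H K (A B : H -> K) :
  bounded_op A -> bounded_op B -> adj (A + B) = adj A + adj B.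
Proof.
move=> hA hB; apply: adj_uniq; first exact: bopD.
by move=> x y; rewrite !opE innerDl innerDr !adjE.
Qed.

Lemma adjZ H K a (A : H -> K) : bounded_op A -> adj (a *: A) = a^*%C *: adj A.
Proof.
move=> hA; apply: adj_uniq; first exact: bopZ.
by move=> x y; rewrite !opE innerZl innerZr adjE // conjcK.
Qed.

Lemma adjB H K (A B : H -> K) :
  bounded_op A -> bounded_op B -> adj (A - B) = adj A - adj B.
Proof.
move=> hA hB; apply: adj_uniq; first exact: bopB.
by move=> x y; rewrite !opE innerBl innerBr !adjE.
Qed.

Lemma adj_id H : adj (@idfun H) = idfun.
Proof. by apply: adj_uniq => //; exact: bop_id. Qed.

Lemma adj0 H K : adj (0 : H -> K) = 0.
Proof.
by apply: adj_uniq => [|x y]; [exact: bop0 | rewrite !opE inner0l inner0r].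
Qed.

Lemma opnorm_adj H K (A : H -> K) : bounded_op A -> opnorm (adj A) <= opnorm A.
Proof.
by move=> hA; apply: opnorm_le => [|y]; [exact: opnorm_ge0 | exact: rnorm_adj].
Qed.

Lemma is_adjointE H (A B : H -> H) : bounded_op A -> is_adjoint A B <-> B = adj A.
Proof.
move=> hA; split=> [hB|-> x y]; last exact: adjE.
by rewrite (adj_uniq hA hB).
Qed.

Definition isometry H K (j : H -> K) :=
  linear j /\ forall x y, inner K (j x) (j y) = inner H x y.

Lemma isometry_rnorm H K (j : H -> K) x : isometry j -> rnorm (j x) = rnorm x.
Proof.
move=> [_ ji]; apply/eqP; rewrite -(@eqrXn2 _ 2) ?rnorm_ge0 //.
by rewrite !rnorm_sqr ji.
Qed.

Lemma isometry_bop H K (j : H -> K) : isometry j -> bounded_op j.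
Proof.
move=> ji; apply: (@linear_bop _ _ _ 1); first by case: ji.
by move=> x; rewrite mul1r isometry_rnorm.
Qed.

Lemma isometry_adjK H K (j : H -> K) x : isometry j -> adj j (j x) = x.
Proof.
move=> ji; have jb := isometry_bop ji; apply: inner_extr => z.
by rewrite -adjE //; case: ji.
Qed.

(** * Operators determined by a total family *)

Section Total.
Variables (M : hilbert R) (X : Type) (g : X -> M).

Definition total := forall z, (forall x, inner M z (g x) = 0) -> z = 0.

Hypothesis g_total : total.

(** Combinations that almost represent the functional of [z] on the span form a Cauchy family; [z]
    minus their limit is orthogonal to every [g x], hence zero. *)
Lemma total_dense z e : 0 < e -> exists l, rnorm (z - lsum g l) <= e.
Proof.
pose f x := inner M z (g x).
have fl l : keval f l = inner M z (lsum g l).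
  by rewrite inner_sumr; apply: eq_bigr => p _; rewrite innerZr.
have f_bd : kbounded (fun x y => inner M (g x) (g y)) f (rnorm z ^+ 2).
  split; first exact: sqr_ge0.
  move=> l; rewrite knsq_lsum fl -exprMn ler_pXn2r ?nnegrE ?cmod_ge0 ?CauchySchwarz //.
  by rewrite mulr_ge0 ?rnorm_ge0.
have ex d : 0 < d -> exists l, forall m,
    cmod (inner M (z - lsum g l) (lsum g m)) <= d * rnorm (lsum g m).
  move=> d0; have [l hl] := kbounded_approx (psd_inner g) f_bd (exprn_gt0 2 d0).
  exists l => m; rewrite -(@ler_pXn2r _ 2) ?nnegrE ?cmod_ge0 //; last first.
    by rewrite mulr_ge0 ?rnorm_ge0 ?ltW.
  by have := hl m; rewrite knsq_lsum kform_lsum fl exprMn innerBl.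
have [||y hy] := @hilbert_approx _ M (fun d y => 0 <= d /\ exists2 l, y = lsum g l &
    forall m, cmod (inner M (z - lsum g l) (lsum g m)) <= d * rnorm (lsum g m)).
- by move=> d d0; have [l hl] := ex _ d0; exists (lsum g l); split; [exact: ltW | exists l].
- move=> d d' _ _ [d0 [l -> hl]] [d0' [l' -> hl']].
  set y := _ - _; have [->|n0] := eqVneq (rnorm y) 0; first exact: addr_ge0.
  have yE : y = lsum g (l ++ kscale (- 1) l') by rewrite lsum_sub.
  have y0 : 0 < rnorm y by rewrite lt_def n0 rnorm_ge0.
  rewrite -(ler_pM2r y0) -expr2 rnorm_sqr; apply: le_trans (Re_le _) _.
  rewrite {1}(_ : y = (z - lsum g l') - (z - lsum g l)); last first.
    by rewrite opprB addrC addrA subrK.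
  rewrite innerBl; apply: le_trans (cmodD _ _) _; rewrite cmodN mulrDl addrC.
  by rewrite yE; exact: lerD.
move=> e0; have -> : z = y.
  apply/eqP; rewrite -subr_eq0; apply/eqP/g_total => x.
  apply: (@cmod_eps _ _ (2 * rnorm (g x))) => d d0.
  have [l hl] := ex _ d0.
  have {}hy := hy _ _ (conj (ltW d0) (ex_intro2 _ _ l erefl hl)).
  have {hl} := hl [:: (1, x)]; rewrite /lsum big_seq1 scale1r => hl.
  rewrite (_ : z - y = (z - lsum g l) - (y - lsum g l)); last first.
    by rewrite opprB addrA subrK.
  rewrite innerBl; apply: le_trans (cmodD _ _) _; rewrite cmodN.
  apply: le_trans (lerD hl (CauchySchwarz _ _)) _.
  have := ler_wpM2r (rnorm_ge0 (g x)) hy; lra.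
have [l hl] := ex _ e0; exists l; apply: hy; split; first exact: ltW.
by exists l.
Qed.

Lemma total_ext K (A B : M -> K) : bounded_op A -> bounded_op B ->
  (forall x, A (g x) = B (g x)) -> A = B.
Proof.
move=> hA hB AB; apply/funext => z; apply: inner_ext => w.
have hD : bounded_op (A - B) by exact: bopB.
apply/eqP; rewrite -subr_eq0 -innerBl -opBE adjE //.
suff -> : adj (A - B) w = 0 by rewrite inner0r.
by apply: g_total => x; rewrite adjEr // opBE AB subrr inner0r.
Qed.

(** The norm bound on combinations contains well-definedness: applied to a difference it shows that
    combinations with equal values under [g] have equal values under [h]. An operator on a kernel
    space is thus given by its values on the [g x] and one estimate. *)
Lemma total_extend K (h : X -> K) (r : R) : 0 <= r ->
  (forall l, rnorm (lsum h l) <= r * rnorm (lsum g l)) ->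
  exists T : M -> K, [/\ bounded_op T, forall x, T (g x) = h x &
    forall z, rnorm (T z) <= r * rnorm z].
Proof.
move=> r0 hr.
have r1 : 0 < r + 1 by rewrite ltr_wpDl.
have lim z : exists y, forall l, rnorm (y - lsum h l) <= r * rnorm (z - lsum g l).
  have [||y hy] := @hilbert_approx _ K
      (fun e y => exists2 l, y = lsum h l & r * rnorm (z - lsum g l) <= e).
  - move=> e e0; have [|l hl] := total_dense z (e := e / (r + 1)).
      by rewrite divr_gt0.
    exists (lsum h l), l => //; apply: le_trans (ler_wpM2l r0 hl) _.
    by rewrite mulrCA ler_piMr ?(ltW e0) // ler_pdivrMr // mul1r lerDl.
  - move=> e e' _ _ [l -> le] [m -> me]; rewrite -lsum_sub; apply: le_trans (hr _) _.
    apply: le_trans (lerD le me); rewrite -mulrDr lsum_sub ler_wpM2l //.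
    by rewrite (rnormB z); exact: rnorm_sub_trans.
  by exists y => l; apply: hy; exists l.
have [T hT] := choice lim.
have T_bd z : rnorm (T z) <= r * rnorm z.
  by have := hT z [::]; rewrite /lsum !big_nil !subr0.
have T_lin : linear T.
  move=> a z w; apply/eqP; rewrite -subr_eq0; apply/eqP.
  apply: (@rnorm_eps _ _ _ (2 * r * (cmod a + 1))) => e e0.
  have [l hl] := total_dense z e0; have [m hm] := total_dense w e0.
  pose n := kscale a l ++ m.
  have nE Y (K' : hilbert R) (u : Y -> K') (l' m' : seq (R[i] * Y)) :
      lsum u (kscale a l' ++ m') = a *: lsum u l' + lsum u m'.
    rewrite /lsum big_cat big_map /= scaler_sumr; congr (_ + _).
    by apply: eq_bigr => p _; rewrite scalerA.
  have split_le (K' : hilbert R) (x1 x2 y1 y2 : K') (c : R) :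
      rnorm (x1 - x2) <= c -> rnorm (y1 - y2) <= c ->
      rnorm (a *: x1 + y1 - (a *: x2 + y2)) <= c * (cmod a + 1).
    move=> h1 h2; rewrite opprD addrACA -scalerBr mulrDr mulr1.
    apply: le_trans (rnormD _ _) (lerD _ h2).
    by rewrite rnormZ mulrC ler_wpM2r ?cmod_ge0.
  apply: le_trans (rnorm_sub_trans _ (lsum h n) _) _.
  rewrite (rnormB (lsum h n)).
  have h1 : rnorm (T (a *: z + w) - lsum h n) <= r * (e * (cmod a + 1)).
    by apply: le_trans (hT _ _) _; rewrite ler_wpM2l // nE split_le.
  have h2 : rnorm (a *: T z + T w - lsum h n) <= r * e * (cmod a + 1).
    rewrite nE; apply: split_le.
      exact: le_trans (hT _ _) (ler_wpM2l r0 hl).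
    exact: le_trans (hT _ _) (ler_wpM2l r0 hm).
  lra.
exists T; split => //; first exact: linear_bop T_bd.
move=> x; apply/eqP; rewrite -subr_eq0; apply/eqP/rnorm_le0.
have := hT (g x) [:: (1, x)].
by rewrite /lsum !big_seq1 !scale1r subrr rnorm0 mulr0.
Qed.

End Total.

Lemma op_approx H K (P : R -> (H -> K) -> Prop) :
  (forall e, 0 < e -> exists A, P e A) ->
  (forall e A, P e A -> bounded_op A) ->
  (forall e e' A B, P e A -> P e' B -> forall x, rnorm (A x - B x) <= (e + e') * rnorm x) ->
  exists2 T, bounded_op T & forall e A, P e A -> forall x, rnorm (T x - A x) <= e * rnorm x.
Proof.
move=> ex bd cau.
have lim x : exists y, forall e A, P e A -> rnorm (y - A x) <= e * rnorm x.
  have [||y hy] := @hilbert_approx _ K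
      (fun e y => exists d A, [/\ P d A, d * rnorm x <= e & y = A x]).
  - move=> e e0; have x1 : 0 < rnorm x + 1 by rewrite ltr_wpDl ?rnorm_ge0.
    have [A PA] := ex _ (divr_gt0 e0 x1).
    exists (A x), (e / (rnorm x + 1)), A; split => //.
    by rewrite -mulrA ler_piMr ?(ltW e0) // ler_pdivrMl // mulr1 lerDl.
  - move=> e e' _ _ [d [A [PA de ->]]] [d' [B [PB de' ->]]].
    by apply: le_trans (cau _ _ _ _ PA PB x) _; rewrite mulrDl lerD.
  by exists y => e A PA; apply: hy; exists e, A.
have [T hT] := choice lim.
have T_lin : linear T.
  move=> a z w; apply/eqP; rewrite -subr_eq0; apply/eqP.
  apply: (@rnorm_eps _ _ _ (rnorm (a *: z + w) + (cmod a * rnorm z + rnorm w))) => e e0.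
  have [A PA] := ex _ e0; rewrite mulrDr.
  apply: le_trans (rnorm_sub_trans _ (A (a *: z + w)) _) (lerD (hT _ _ _ PA) _).
  rewrite rnormB (bop_lin (bd _ _ PA)) opprD addrACA -scalerBr mulrDr.
  apply: le_trans (rnormD _ _) (lerD _ (hT _ _ _ PA)).
  by rewrite rnormZ mulrCA ler_wpM2l ?cmod_ge0 ?(hT _ _ _ PA).
have [A PA] := ex _ ltr01; exists T => // [|e B PB x]; last exact: hT.
apply: (@linear_bop _ _ _ (1 + opnorm A)) => // x.
rewrite -{1}[T x](subrK (A x)); apply: le_trans (rnormD _ _) _.
by rewrite mulrDl; apply: lerD (hT _ _ _ PA) (opnormP _ (bd _ _ PA)).
Qed.

End BoundedOperators.

(** * Direct sums and square roots *)

Section DirectSum.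
Variables (R : realType) (I : eqType).
Implicit Types (M N : I -> hilbert R) (L : hilbert R).

(** This says that [L] is the Hilbert sum of the [M i], in terms of the embeddings. The same [L] can
    therefore be viewed as a sum in several ways. *)
Definition orth_family M L (g : forall i, M i -> L) :=
  [/\ forall i, isometry (g i),
      forall i j x y, i != j -> inner L (g i x) (g j y) = 0 &
      total (fun u : {i & M i} => g (tag u) (tagged u))].

(** The coordinate at [i] of a vector that lies in a single summand: transported along the equality
    of indices, and 0 when they differ. *)
Definition component N i (u : {i & N i}) : N i :=
  if @eqP _ (tag u) i is ReflectT e then eq_rect _ (fun i => N i) (tagged u) _ e else 0.

Lemma component_eq N i (x : N i) : component i (Tagged N x) = x.
Proof.
rewrite /component /=; case: eqP => // e.
by rewrite (_ : e = erefl) //; exact: eq_irrelevance.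
Qed.

Lemma component_neq N i (u : {i & N i}) : tag u != i -> component i u = 0.
Proof. by rewrite /component; case: eqP. Qed.

Lemma component_sum N i (V : nmodType) (F : forall j, N j -> V) (s : seq I) (x : N i) :
  (forall j, F j 0 = 0) -> uniq s -> i \in s ->
  \sum_(j <- s) F j (component j (Tagged N x)) = F i x.
Proof.
move=> F0 s_uniq si; rewrite (bigD1_seq i) //= component_eq big1 ?addr0 // => j ij.
by rewrite component_neq ?F0 //= eq_sym.
Qed.

Section Operators.
Variables (M : I -> hilbert R) (L : hilbert R) (g : forall i, M i -> L).
Arguments g : clear implicits.
Hypothesis g_orth : orth_family g.

Lemma orth_sum_norm (s : seq I) (x : forall i, M i) : uniq s ->
  rnorm (\sum_(i <- s) g i (x i)) ^+ 2 = \sum_(i <- s) rnorm (x i) ^+ 2.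
Proof.
have [gi go _] := g_orth.
elim: s => [|i s ih] /=; first by rewrite !big_nil rnorm0 expr0n.
move=> /andP[si s_uniq]; rewrite !big_cons rnormD_sqr ih // isometry_rnorm //.
rewrite inner_sumr [X in complex.Re X]big1_seq ?mulr0 ?addr0 // => j /= js.
by apply: go; apply: contraNneq si => ->.
Qed.

(** Sorting a formal combination by summands, over a list [s] of the indices that occur, leaves one
    vector per summand, so that Pythagoras applies to the block diagonal operator with blocks
    [D i]. *)
Lemma orth_lsum (D : forall i, M i -> M i) (s : seq I) (l : seq (R[i] * {i & M i})) :
  (forall i, bounded_op (D i)) -> uniq s -> {subset [seq tag p.2 | p <- l] <= s} ->
  lsum (fun u => g (tag u) (D (tag u) (tagged u))) l =
  \sum_(i <- s) g i (D i (lsum (fun u => component i u) l)).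
Proof.
have [gi go _] := g_orth.
move=> Db s_uniq; elim: l => [|[a [j x]] l ih] ls.
  rewrite lsum_nil big1 // => i _.
  by rewrite lsum_nil (lin0 (bop_lin (Db i))) (lin0 (proj1 (gi i))).
rewrite lsum_cons ih; last by move=> i il; apply: ls; rewrite inE il orbT.
rewrite -(@component_sum M j _ (fun i y => a *: g i (D i y)) s) //; last first.
- by apply: ls; rewrite inE eqxx.
- by move=> i; rewrite (lin0 (bop_lin (Db i))) (lin0 (proj1 (gi i))) scaler0.
rewrite -big_split; apply: eq_bigr => i _ /=; rewrite lsum_cons /=.
by rewrite (linD (bop_lin (Db i))) (linD (proj1 (gi i)))
  (linZ (bop_lin (Db i))) (linZ (proj1 (gi i))).
Qed.

Lemma orth_family_op (D : forall i, M i -> M i) (r : R) :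
  (forall i, bounded_op (D i)) -> (forall i, opnorm (D i) <= r) -> 0 <= r ->
  exists2 T : L -> L, bounded_op T & forall i x, T (g i x) = g i (D i x).
Proof.
move=> Db Dr r0; have [gi go gt] := g_orth.
have [|T [Tb TE _]] := @total_extend _ _ _ _ gt L
  (fun u => g (tag u) (D (tag u) (tagged u))) r r0.
  move=> l; pose s := undup [seq tag p.2 | p <- l].
  have s_uniq : uniq s by rewrite undup_uniq.
  have ls : {subset [seq tag p.2 | p <- l] <= s} by move=> i; rewrite mem_undup.
  have := orth_lsum (D := fun i => idfun) (fun i => @bop_id _ (M i)) s_uniq ls.
  rewrite (orth_lsum Db s_uniq ls) => /= ->.
  rewrite -(@ler_pXn2r _ 2) ?nnegrE ?mulr_ge0 ?rnorm_ge0 // exprMn.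
  rewrite (orth_sum_norm (fun i => D i _)) // (orth_sum_norm (fun i => lsum _ _)) //.
  rewrite mulr_sumr; apply: ler_sum => i _; rewrite -exprMn.
  rewrite ler_pXn2r ?nnegrE ?mulr_ge0 ?rnorm_ge0 //.
  by apply: le_trans (opnormP _ (Db i)) _; rewrite ler_wpM2r ?rnorm_ge0.
exists T => // i x; exact: (TE (Tagged (fun i => M i) x)).
Qed.

End Operators.

(** The kernel on the disjoint union of the summands is the inner product within a summand and 0
    across summands. On a formal combination it is the sum over [i] of the squared norms of the
    [i]-th components, hence positive. *)
Theorem direct_sum N : exists (L : hilbert R) (g : forall i, N i -> L), orth_family g.
Proof.
pose k (u v : {i & N i}) := inner (N (tag u)) (tagged u) (component (tag u) v).
have kE s u v : uniq s -> tag u \in s ->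
    k u v = \sum_(i <- s) inner (N i) (component i u) (component i v).
  move=> s_uniq; case: u => i x si /=.
  rewrite (component_sum (F := fun j y => inner (N j) y (component j v))) //.
  by move=> j; rewrite inner0l.
have k_psd : psd k.
  move=> l; pose s := undup [seq tag p.2 | p <- l].
  suff -> : kform k l l = \sum_(i <- s)
      inner (N i) (lsum (fun u => component i u) l) (lsum (fun u => component i u) l).
    by apply: sumr_ge0 => i _; rewrite inner_rnorm lecR sqr_ge0.
  under [RHS]eq_bigr do rewrite -kform_lsum.
  rewrite /kform [RHS]exchange_big; apply: eq_big_seq => p pl.
  rewrite exchange_big; apply: eq_bigr => q _ /=.
  rewrite (kE s) ?undup_uniq // ?mulr_sumr // mem_undup; exact: (map_f (fun p => tag p.2)).
have [L [g [gk gt]]] := kernel_hilbert k_psd.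
pose h i (x : N i) : L := g (Tagged (fun i => N i) x).
exists L, h; split.
- move=> i; split.
    move=> a x y; apply/eqP; rewrite -subr_eq0; apply/eqP/gt => u.
    by rewrite innerBl innerDl innerZl !gk /k /= innerDl innerZl subrr.
  by move=> x y; rewrite gk /k /= component_eq.
- by move=> i j x y ij; rewrite gk /k component_neq ?inner0r //= eq_sym.
- by move=> z hz; apply: gt => -[i x]; exact: (hz (Tagged (fun i => N i) x)).
Qed.

End DirectSum.

Section FiniteDirectSum.
Variables (R : realType) (I : finType) (M : I -> hilbert R) (L : hilbert R).
Variable g : forall i, M i -> L.
Arguments g : clear implicits.
Hypothesis g_orth : orth_family g.

Lemma orth_bop i : bounded_op (g i).
Proof. by apply: isometry_bop; case: g_orth. Qed.

Lemma orth_adj i j (x : M j) : i != j -> adj (g i) (g j x) = 0.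
Proof.
have [_ go _] := g_orth; move=> ij; apply: inner_extr => z.
by rewrite -adjE ?go ?inner0r //; exact: orth_bop.
Qed.

Lemma orth_resolution z : \sum_i g i (adj (g i) z) = z.
Proof.
have [gi go gt] := g_orth; apply/eqP; rewrite -subr_eq0; apply/eqP/gt => -[j x] /=.
rewrite innerBl inner_suml (bigD1 j) //= big1 => [|i ij]; last exact: go.
rewrite addr0; have [_ ->] := gi j.
by rewrite adjEr ?subrr //; exact: orth_bop.
Qed.

End FiniteDirectSum.

(** * Square roots in a C*-algebra *)

Section SquareRoot.
Variables (R : realType) (H : hilbert R) (S : set (H -> H)).
Hypothesis S_alg : Cstar_subalgebra S.

Lemma Cstar_bop A : S A -> bounded_op A.
Proof. by case: S_alg => h _ _ _ _; exact: h. Qed.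

Lemma Cstar0 : S 0. Proof. by case: S_alg => _ []. Qed.

Lemma CstarD A B : S A -> S B -> S (A + B).
Proof. by case: S_alg => _ [_ h] _ _ _; exact: h. Qed.

Lemma CstarZ a A : S A -> S (a *: A).
Proof. by case: S_alg => _ _ [h _] _ _; exact: h. Qed.

Lemma CstarN A : S A -> S (- A).
Proof. by rewrite -scaleN1r; exact: CstarZ. Qed.

Lemma CstarB A B : S A -> S B -> S (A - B).
Proof. by move=> hA hB; apply/CstarD/CstarN. Qed.

Lemma Cstar_comp A B : S A -> S B -> S (A \o B).
Proof. by case: S_alg => _ _ [_ h] _ _; exact: h. Qed.

Lemma Cstar_adj A : S A -> S (adj A).
Proof.
move=> SA; have Ab := Cstar_bop SA; case: S_alg => _ _ _ h _.
by apply: (h A) => //; [exact: bop_adj | move=> x y; exact: adjE].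
Qed.

Lemma Cstar_sum I (r : seq I) (P : pred I) (F : I -> H -> H) :
  (forall i, P i -> S (F i)) -> S (\sum_(i <- r | P i) F i).
Proof. by move=> hF; elim/big_ind: _ => //; [exact: Cstar0 | exact: CstarD]. Qed.

Lemma Cstar_closed A : bounded_op A ->
  (forall e : R, 0 < e -> exists2 B, S B & opnorm (A - B) < e) -> S A.
Proof. by case: S_alg => _ _ _ _; exact. Qed.

Lemma opnormZ_real (a : R) (A : H -> H) : 0 <= a -> bounded_op A ->
  opnorm (a%:C *: A) <= a * opnorm A.
Proof.
by move=> a0 hA; apply: le_trans (opnormZ _ hA) _; rewrite cmod_real ger0_norm.
Qed.

Lemma opnorm_sqrB (A B : H -> H) (r : R) : bounded_op A -> bounded_op B ->
  opnorm A <= r -> opnorm B <= r ->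
  opnorm ((A \o A) - (B \o B)) <= 2 * r * opnorm (A - B).
Proof.
move=> hA hB Ar Br; have hAB := bopB hA hB.
have -> : (A \o A) - (B \o B) = (A \o (A - B)) + ((A - B) \o B).
  apply/funext => x; rewrite !opE /= ?opE (linB (bop_lin hA)).
  by rewrite addrA subrK.
apply: le_trans (opnormD (bop_comp hA hAB) (bop_comp hAB hB)) _.
apply: le_trans (lerD (opnorm_comp hA hAB) (opnorm_comp hAB hB)) _.
have n0 := opnorm_ge0 hAB.
have := ler_wpM2r n0 Ar; have := ler_wpM2l n0 Br; lra.
Qed.

(* The map [Y |-> (X + Y^2) / 2] contracts the ball of radius [r < 1]. *)
Lemma sqrt_id_sub X (r : R) : S X -> adj X = X -> opnorm X <= r -> r < 1 ->
  exists Y, [/\ S Y, adj Y = Y & X = Y + Y - (Y \o Y)].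
Proof.
move=> SX X_sa Xr r1; have Xb := Cstar_bop SX.
have r0 : 0 <= r by apply: le_trans Xr; exact: opnorm_ge0.
pose F Y : H -> H := (2^-1)%:C *: (X + (Y \o Y)).
have half0 : 0 <= 2^-1 :> R by rewrite invr_ge0.
have SF Y : S Y -> S (F Y) by move=> SY; apply/CstarZ/CstarD/Cstar_comp.
have FB A B : bounded_op A -> bounded_op B -> opnorm A <= r -> opnorm B <= r ->
    opnorm (F A - F B) <= r * opnorm (A - B).
  move=> hA hB Ar Br; rewrite /F -scalerBr.
  have -> : X + (A \o A) - (X + (B \o B)) = (A \o A) - (B \o B).
    by rewrite opprD addrACA subrr add0r.
  apply: le_trans (opnormZ_real half0 _) _; first by apply: bopB; exact: bop_comp.
  have := opnorm_sqrB hA hB Ar Br; lra.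
pose Y := fix Y n := if n is m.+1 then F (Y m) else 0.
have SY n : S (Y n) by elim: n => [|n ih]; [exact: Cstar0 | exact: SF].
have Yb n := Cstar_bop (SY n).
have Yr n : opnorm (Y n) <= r.
  elim: n => [|n ih]; first by rewrite opnorm0.
  apply: le_trans (opnormZ_real half0 _) _; first by apply/bopD/bop_comp.
  have h1 := opnormD Xb (bop_comp (Yb n) (Yb n)).
  have h2 := opnorm_comp (Yb n) (Yb n).
  have h3 : opnorm (Y n) * opnorm (Y n) <= r * 1.
    by apply: ler_pM; rewrite ?opnorm_ge0 //; exact: le_trans ih (ltW r1).
  lra.
have Y_cau n k : opnorm (Y (n + k)%N - Y n) <= r ^+ n.
  elim: n => [|n ih].
    by rewrite add0n subr0 expr0; exact: le_trans (Yr k) (ltW r1).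
  rewrite addSn exprS; apply: le_trans (FB _ _ _ _ (Yr _) (Yr _)) _ => //.
  exact: ler_wpM2l.
have Y_cau2 m n : opnorm (Y m - Y n) <= r ^+ m + r ^+ n.
  wlog mn : m n / (n <= m)%N.
    by move=> h; case/orP: (leq_total n m) => [/h //|/h hmn]; rewrite opnormB [r ^+ m + _]addrC.
  by rewrite -(subnKC mn); apply: le_trans (Y_cau _ _) _; rewrite lerDr exprn_ge0.
have small (e : R) : 0 < e -> exists n, r ^+ n <= e.
  move=> e0; have r1' : `|r| < 1 by rewrite ger0_norm.
  have /cvgrPdist_lt /(_ _ e0)[N _ hN] := cvg_expr r1'.
  by exists N; have := hN N (leqnn N); rewrite sub0r normrN ger0_norm ?exprn_ge0 // => /ltW.
have [|||Z Zb hZ] := @op_approx _ H H (fun e A => exists2 n, A = Y n & r ^+ n <= e).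
- by move=> e /small[n ne]; exists (Y n), n.
- by move=> e _ [n -> _].
- move=> e e' _ _ [m -> me] [n -> ne] x; rewrite -opBE.
  apply: le_trans (opnormP _ (bopB (Yb m) (Yb n))) _.
  by rewrite ler_wpM2r ?rnorm_ge0 //; apply: le_trans (Y_cau2 _ _) (lerD me ne).
have {}hZ n : opnorm (Z - Y n) <= r ^+ n.
  by apply: opnorm_le => [|x]; [exact: exprn_ge0 | apply: hZ; exists n].
have Zr : opnorm Z <= r.
  apply: (@ler_eps_mul _ _ _ 1) => e /small[n ne]; rewrite mulr1.
  have h1 := opnorm_dist Zb (Yb n); have h2 := Yr n; have h3 := hZ n; lra.
have SZ : S Z.
  apply: Cstar_closed => // e e0; have [n ne] : exists n, r ^+ n <= e / 2.
    by apply: small; rewrite divr_gt0.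
  by exists (Y n) => //; have := hZ n; lra.
exists Z; split => //.
  have hAZ := bop_adj Zb.
  apply/eqP; rewrite -subr_eq0; apply/eqP; apply: (@opnorm_eps _ _ _ _ 2).
    exact: bopB.
  move=> e /small[n ne].
  have Yn_sa : adj (Y n) = Y n.
    elim: n {ne} => [|n ih]; first exact: adj0.
    have hb := bop_comp (Yb n) (Yb n).
    rewrite [Y n.+1]/(F (Y n)) /F (adjZ _ (bopD Xb hb)) conjc_real (adjD Xb hb).
    by rewrite (adj_comp (Yb n) (Yb n)) ih X_sa.
  have h1 := hZ n; rewrite opnormB in h1.
  have h2 := opnorm_adj (bopB Zb (Yb n)); rewrite adjB // Yn_sa in h2.
  have := opnorm_triangle hAZ (Yb n) Zb; have := hZ n; lra.
have FZ : Z = F Z.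
  have hFZ := Cstar_bop (SF _ SZ).
  apply/eqP; rewrite -subr_eq0; apply/eqP; apply: (@opnorm_eps _ _ _ _ 2).
    exact: bopB.
  move=> e /small[n ne].
  have := opnorm_triangle Zb (Yb n.+1) hFZ; have := hZ n.+1.
  have h := FB _ _ (Yb n) Zb (Yr n) Zr; rewrite (opnormB (Y n)) in h.
  have h' := ler_wpM2l r0 (hZ n).
  have h3 : r * r ^+ n <= 1 * r ^+ n by rewrite ler_wpM2r ?exprn_ge0 // ltW.
  rewrite exprS; lra.
(* The fixed point equation reads [2 Z = X + Z^2]; equivalently, [1 - X] is the square of
   [1 - Z]. *)
rewrite {1 2}FZ /F -scalerDl -rmorphD /= (_ : 2^-1 + 2^-1 = 1 :> R); last by lra.
by rewrite scale1r addrK.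
Qed.

End SquareRoot.

(** * Representations are completely positive *)

Section PositiveOperators.
Variable R : realType.
Implicit Types H K L N : hilbert R.
Local Notation Re := (@complex.Re R).

Lemma psd_pos H (T : H -> H) : linear T -> (forall z, 0 <= inner H (T z) z) ->
  psd (fun z w => inner H (T z) w).
Proof. by move=> Tl Tp l; rewrite (kform_lsum T id) -(lin_lsum Tl). Qed.

Lemma pos_selfadj H (T : H -> H) : bounded_op T -> (forall z, 0 <= inner H (T z) z) ->
  adj T = T.
Proof.
move=> Tb Tp; apply: adj_uniq => // x y.
have := kformC (psd_pos (bop_lin Tb) Tp) [:: (1, y)] [:: (1, x)].
by rewrite !(kform_lsum T id) /lsum !big_seq1 !scale1r => ->; rewrite -innerC.
Qed.

Lemma pos_norm_le H (T : H -> H) (c : R) : bounded_op T -> 0 <= c ->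
  (forall z, 0 <= inner H (T z) z) ->
  (forall z, Re (inner H (T z) z) <= c * rnorm z ^+ 2) ->
  forall z, rnorm (T z) <= c * rnorm z.
Proof.
move=> Tb c0 Tp Tc z; have := psd_CauchySchwarz z (T z) (psd_pos (bop_lin Tb) Tp).
rewrite inner_rnorm cmod_real ger0_norm ?sqr_ge0 // => h.
have [->|n0] := eqVneq (rnorm (T z)) 0; first by rewrite mulr_ge0 ?rnorm_ge0.
have {}n0 : 0 < rnorm (T z) by rewrite lt_def n0 rnorm_ge0.
rewrite -(@ler_pXn2r _ 2) ?nnegrE ?mulr_ge0 ?rnorm_ge0 //.
suff: (rnorm (T z) ^+ 2) ^+ 2 <= (c * rnorm z) ^+ 2 * rnorm (T z) ^+ 2.
  by rewrite expr2 ler_pM2r // exprn_gt0.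
apply: le_trans h _.
have -> : (c * rnorm z) ^+ 2 * rnorm (T z) ^+ 2 =
  c * rnorm z ^+ 2 * (c * rnorm (T z) ^+ 2) by ring.
by apply: ler_pM; rewrite ?Re_ge0.
Qed.

(** The positivity of [positive_opmx] over an arbitrary finite index type: booleans, points of a
    finite set and pairs occur as indices. *)
Definition posmx (T : finType) H (A : T -> T -> H -> H) : Prop :=
  forall x : T -> H, 0 <= \sum_i \sum_j inner H (A i j (x j)) (x i).

(** Contractivity is not among the clauses; it is a consequence of positivity, see [rep_opnorm].
    Values outside [S] are arbitrary. *)
Definition is_rep H N (S : set (H -> H)) (t : (H -> H) -> (N -> N)) : Prop :=
  [/\ forall A, S A -> bounded_op (t A),
      (forall A B, S A -> S B -> t (A + B) = t A + t B) /\
      (forall a A, S A -> t (a *: A) = a *: t A),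
      forall A B, S A -> S B -> t (A \o B) = t A \o t B,
      forall A, S A -> t (adj A) = adj (t A) &
      t idfun = idfun].

Section RepBasics.
Variables (H N : hilbert R) (S : set (H -> H)) (t : (H -> H) -> (N -> N)).
Hypotheses (S_alg : Cstar_subalgebra S) (t_rep : is_rep S t).

Lemma rep_bop A : S A -> bounded_op (t A). Proof. by case: t_rep => h *; exact: h. Qed.
Lemma repD A B : S A -> S B -> t (A + B) = t A + t B.
Proof. by case: t_rep => _ [h _] *; exact: h. Qed.
Lemma repZ a A : S A -> t (a *: A) = a *: t A.
Proof. by case: t_rep => _ [_ h] *; exact: h. Qed.
Lemma rep_comp A B : S A -> S B -> t (A \o B) = t A \o t B.
Proof. by case: t_rep => _ _ h *; exact: h. Qed.
Lemma rep_adj A : S A -> t (adj A) = adj (t A).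
Proof. by case: t_rep => _ _ _ h *; exact: h. Qed.
Lemma rep_id : t idfun = idfun. Proof. by case: t_rep. Qed.
Lemma rep0 : t 0 = 0.
Proof. by rewrite -(scale0r (0 : H -> H)) repZ ?scale0r //; exact: Cstar0. Qed.
Lemma repB A B : S A -> S B -> t (A - B) = t A - t B.
Proof.
by move=> SA SB; rewrite -[- B]scaleN1r repD ?repZ ?scaleN1r //; exact: CstarN.
Qed.
Lemma rep_sum I (r : seq I) (P : pred I) (F : I -> H -> H) :
  (forall i, P i -> S (F i)) ->
  t (\sum_(i <- r | P i) F i) = \sum_(i <- r | P i) t (F i).
Proof.
move=> hF; elim: r => [|i r ih]; first by rewrite !big_nil rep0.
rewrite !big_cons; case: ifP => // Pi; rewrite repD ?ih //; first exact: hF.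
exact: Cstar_sum.
Qed.
End RepBasics.

(** * Matrices over a C*-algebra as operators on a finite direct sum *)

Section MatrixAlgebra.
Variables (H : hilbert R) (S : set (H -> H)).
Hypotheses (S_alg : Cstar_subalgebra S) (S1 : S idfun).
Variables (T : finType) (L : hilbert R) (g : T -> H -> L).
Hypothesis g_orth : @orth_family R T (fun=> H) L g.
Implicit Types (A : T -> T -> H -> H) (B C : L -> L).

Let gb i : bounded_op (g i).
Proof. exact: (orth_bop (M := fun=> H) g_orth). Qed.

Let gab i : bounded_op (adj (g i)).
Proof. exact: bop_adj. Qed.

Let adj_g i j x : adj (g i) (g j x) = if i == j then x else 0.
Proof.
case: eqP => [<-|/eqP ij]; last exact: (orth_adj (M := fun=> H) g_orth).
by apply: isometry_adjK; case: g_orth.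
Qed.

Definition mxop A : L -> L := \sum_i \sum_j (g i \o A i j \o adj (g j)).
Definition mxentry B i j : H -> H := adj (g i) \o B \o g j.

Let entry_bop B i j : bounded_op B -> bounded_op (mxentry B i j).
Proof. by move=> hB; apply: bop_comp (bop_comp _ hB) _. Qed.

Lemma mxop_bop A : (forall i j, bounded_op (A i j)) -> bounded_op (mxop A).
Proof.
move=> hA; apply: bop_sum => i _; apply: bop_sum => j _.
exact: bop_comp (bop_comp (gb i) (hA i j)) _.
Qed.

Lemma mxop_inner A z w :
  inner L (mxop A z) w = \sum_i \sum_j inner H (A i j (adj (g j) z)) (adj (g i) w).
Proof.
rewrite /mxop op_sumE inner_suml; apply: eq_bigr => i _.
by rewrite op_sumE inner_suml; apply: eq_bigr => j _ /=; rewrite adjE.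
Qed.

Lemma mxentry_mxop A i j : (forall i j, bounded_op (A i j)) ->
  mxentry (mxop A) i j = A i j.
Proof.
move=> hA; apply/funext => x; rewrite /mxentry /= /mxop op_sumE.
rewrite (lin_sum (bop_lin (gab i))) (bigD1 i) //= [X in _ + X]big1 ?addr0 => [|k ki].
  rewrite op_sumE (lin_sum (bop_lin (gab i))) (bigD1 j) //= [X in _ + X]big1 ?addr0.
    by rewrite !adj_g !eqxx.
  by move=> k kj; rewrite !adj_g (negPf kj) (lin0 (bop_lin (hA _ _))) eqxx.
rewrite op_sumE (lin_sum (bop_lin (gab i))) big1 // => m _ /=.
by rewrite adj_g eq_sym (negPf ki).
Qed.

Lemma mxentry_comp B C i j : bounded_op B -> bounded_op C ->
  mxentry (B \o C) i j = \sum_l (mxentry B i l \o mxentry C l j).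
Proof.
move=> hB hC; apply/funext => x; rewrite op_sumE /mxentry /=.
rewrite -(lin_sum (bop_lin (gab i))) -(lin_sum (bop_lin hB)).
by rewrite (orth_resolution (M := fun=> H) g_orth).
Qed.

Lemma mxentry_adj B i j : bounded_op B -> mxentry (adj B) i j = adj (mxentry B j i).
Proof.
move=> hB; rewrite /mxentry (adj_comp (bop_comp (gab j) hB) (gb i)).
by rewrite (adj_comp (gab j) hB) (adjK (gb j)).
Qed.

Lemma opnorm_g i : opnorm (g i) <= 1.
Proof.
apply: opnorm_le => // x; rewrite mul1r isometry_rnorm //.
by case: g_orth.
Qed.

(** The matrix algebra over [S] is again a C*-algebra of operators, on the sum [L] of copies of [H].
    So the square root of a matrix over [S] has its entries in [S], where [t] is multiplicative. *)
Definition mx_alg : set (L -> L) := [set B | bounded_op B /\ forall i j, S (mxentry B i j)].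

Lemma mxentryD B C i j : mxentry (B + C) i j = mxentry B i j + mxentry C i j.
Proof. by apply/funext => x; rewrite /mxentry /= !opE /= (linD (bop_lin (gab i))). Qed.

Lemma mxentryZ a B i j : mxentry (a *: B) i j = a *: mxentry B i j.
Proof. by apply/funext => x; rewrite /mxentry /= !opE /= (linZ (bop_lin (gab i))). Qed.

Lemma mxentryB B C i j : mxentry (B - C) i j = mxentry B i j - mxentry C i j.
Proof. by rewrite mxentryD -[- C]scaleN1r mxentryZ scaleN1r. Qed.

Lemma mxentry1 i j : mxentry idfun i j = if i == j then idfun else 0.
Proof. by apply/funext => x; rewrite /mxentry /= adj_g; case: eqP. Qed.

Lemma mx_alg_Cstar : Cstar_subalgebra mx_alg.
Proof.
split.
- by move=> B [].
- split.
    split=> [|i j]; first exact: bop0.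
    rewrite (_ : mxentry 0 i j = 0); first exact: Cstar0.
    by apply/funext => x; rewrite /mxentry /= op0E (lin0 (bop_lin (gab i))).
  move=> B C [hB SB] [hC SC]; split=> [|i j]; first exact: bopD.
  by rewrite mxentryD; exact: CstarD.
- split=> [a B [hB SB]|B C [hB SB] [hC SC]].
    by split=> [|i j]; [exact: bopZ | rewrite mxentryZ; exact: CstarZ].
  split=> [|i j]; first exact: bop_comp.
  by rewrite mxentry_comp //; apply: Cstar_sum => // l _; exact: Cstar_comp.
- move=> B C [hB SB] hC; rewrite is_adjointE // => ->; split=> [|i j].
    exact: bop_adj.
  by rewrite mxentry_adj //; exact: Cstar_adj.
- move=> B hB appr; split=> // i j; apply: Cstar_closed => //; first exact: entry_bop.
  move=> e e0; have [C [hC SC] hBC] := appr e e0; exists (mxentry C i j) => //.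
  apply: le_lt_trans hBC; rewrite -mxentryB.
  have hD := bopB hB hC.
  apply: le_trans (opnorm_comp (bop_comp (gab i) hD) (gb j)) _.
  apply: le_trans (ler_wpM2l (opnorm_ge0 _) (opnorm_g j)) _.
    exact: bop_comp.
  rewrite mulr1; apply: le_trans (opnorm_comp (gab i) hD) _.
  rewrite ler_piMl ?opnorm_ge0 //.
  exact: le_trans (opnorm_adj (gb i)) (opnorm_g i).
Qed.

(* Up to a factor, [A + e] is the square of [1 - Y] with [Y] self-adjoint. *)
Lemma rep_posmx_eps N (t : (H -> H) -> (N -> N)) A (e : R) : is_rep S t ->
  (forall i j, S (A i j)) -> posmx A -> 0 < e ->
  forall x : T -> N,
    0 <= \sum_i \sum_j inner N (t (A i j) (x j)) (x i) +
      e%:C * \sum_i inner N (x i) (x i).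
Proof.
move=> t_rep SA A_pos e0 x.
have hA i j : bounded_op (A i j) := Cstar_bop S_alg (SA i j).
pose Ah := mxop A; have Ahb : bounded_op Ah by exact: mxop_bop.
have Ah_pos z : 0 <= inner L (Ah z) z by rewrite mxop_inner; exact: A_pos.
pose c := opnorm Ah; have c0 : 0 <= c := opnorm_ge0 Ahb.
have ce0 : 0 < c + e by rewrite ltr_wpDl.
pose D : L -> L := (c%:C *: idfun) - Ah.
have Db : bounded_op D by apply: bopB => //; apply/bopZ/bop_id.
have DE z : inner L (D z) z = (c * rnorm z ^+ 2 - Re (inner L (Ah z) z))%:C.
  rewrite /D opBE opZE innerBl innerZl inner_rnorm -realCM rmorphB /=.
  by rewrite -ge0_ReE.
have D_pos z : 0 <= inner L (D z) z.
  rewrite DE lecR subr_ge0; apply: le_trans (Re_inner_le _ _) _.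
  by rewrite expr2 mulrA ler_wpM2r ?rnorm_ge0 ?opnormP.
have D_le z : Re (inner L (D z) z) <= c * rnorm z ^+ 2.
  by rewrite DE /= gerBl Re_ge0.
(* Since [0 <= D <= c], the norm of [X] is at most [c / (c + e) < 1], and [1 - X] is
   [(A + e) / (c + e)]. The positive [e] is what keeps the norm below 1. *)
pose X := ((c + e)^-1)%:C *: D.
have ce1 : 0 <= (c + e)^-1 by rewrite invr_ge0 ltW.
have DS : mx_alg D.
  split=> // i j; rewrite mxentryB mxentryZ mxentry1 mxentry_mxop //.
  apply: CstarB => //; apply: CstarZ => //.
  by case: eqP => // _; exact: Cstar0.
have SX : mx_alg X by apply: CstarZ => //; exact: mx_alg_Cstar.
have X_sa : adj X = X by rewrite adjZ // conjc_real pos_selfadj.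
have Xc : opnorm X <= c / (c + e).
  apply: le_trans (opnormZ_real ce1 Db) _; rewrite mulrC ler_wpM2r //.
  exact: opnorm_le c0 (pos_norm_le Db c0 D_pos D_le).
have c_lt1 : c / (c + e) < 1 by rewrite ltr_pdivrMr // mul1r ltrDl.
have [Y [[Yb SY] Y_sa XY]] := sqrt_id_sub mx_alg_Cstar SX X_sa Xc c_lt1.
pose B : L -> L := idfun - Y.
have Bb : bounded_op B by apply: bopB => //; exact: bop_id.
have B_sa : adj B = B by rewrite adjB ?adj_id ?Y_sa //; exact: bop_id.
pose b := mxentry B.
have Sb i j : S (b i j).
  rewrite /b mxentryB mxentry1; apply: CstarB => //.
  by case: eqP => // _; exact: Cstar0.
(* Entrywise, the square of the self-adjoint matrix [b] is a Gram matrix of operators; a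
   *-representation turns it into a Gram matrix again. *)
have bE i j : A i j + e%:C *: (if i == j then idfun else 0) =
    (c + e)%:C *: \sum_l (adj (b l i) \o b l j).
  rewrite (_ : \sum_l _ = mxentry (B \o B) i j); last first.
    rewrite mxentry_comp //; apply: eq_bigr => l _.
    by rewrite -mxentry_adj // B_sa.
  have -> : B \o B = idfun - X.
    apply/funext => z; rewrite XY /B /= !opE /= (linB (bop_lin Yb)).
    by rewrite !opprD !opprK -!addrA.
  rewrite mxentryB mxentryZ mxentryB mxentryZ mxentry1 mxentry_mxop //.
  rewrite scalerBr scalerA -realCM mulfV ?lt0r_neq0 // scale1r opprB addrCA.
  rewrite (_ : (c + e)%:C = e%:C + c%:C); last by rewrite addrC rmorphD.
  by rewrite scalerDl addrK.
have tE i j : inner N (t (A i j) (x j)) (x i) =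
    (c + e)%:C * (\sum_l inner N (t (b l j) (x j)) (t (b l i) (x i))) -
    e%:C * (if i == j then inner N (x i) (x i) else 0).
  have SI : S (if i == j then idfun else 0) by case: eqP => // _; exact: Cstar0.
  have Sbb : forall l, true -> S (adj (b l i) \o b l j).
    by move=> l _; apply: Cstar_comp => //; exact: Cstar_adj.
  have := congr1 t (bE i j).
  rewrite (repD t_rep) //; last exact: CstarZ.
  rewrite !(repZ t_rep) //; last exact: Cstar_sum.
  rewrite (rep_sum S_alg t_rep) // => /(congr1 (fun F => inner N (F (x j)) (x i))).
  rewrite !opE innerDl !innerZl => /(canRL (addrK _)) ->.
  congr (_ * _ - _ * _); last first.
    by case: eqP => [->|_]; rewrite ?(rep_id t_rep) // (rep0 S_alg t_rep) inner0l.
  rewrite inner_suml; apply: eq_bigr => l _.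
  rewrite (rep_comp t_rep) ?(rep_adj t_rep) //=; last exact: Cstar_adj.
  by rewrite adjEr //; exact: (rep_bop t_rep (Sb _ _)).
suff -> : \sum_i \sum_j inner N (t (A i j) (x j)) (x i) +
    e%:C * \sum_i inner N (x i) (x i) =
  (c + e)%:C * \sum_l inner N (\sum_j t (b l j) (x j)) (\sum_j t (b l j) (x j)).
  rewrite mulr_ge0 //; first by rewrite lecR ltW.
  by apply: sumr_ge0 => l _; rewrite inner_rnorm lecR sqr_ge0.
have -> : \sum_i \sum_j inner N (t (A i j) (x j)) (x i) =
    (c + e)%:C * (\sum_i \sum_j \sum_l inner N (t (b l j) (x j)) (t (b l i) (x i))) -
    e%:C * \sum_i inner N (x i) (x i).
  rewrite !mulr_sumr -sumrB; apply: eq_bigr => i _.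
  rewrite mulr_sumr (eq_bigr _ (fun j _ => tE i j)) sumrB; congr (_ - _).
  by rewrite (bigD1 i) //= eqxx big1 ?addr0 // => j ji; rewrite eq_sym (negPf ji) mulr0.
rewrite subrK; congr (_ * _).
under [RHS]eq_bigr => l _ do rewrite inner_sumr.
rewrite [RHS]exchange_big; apply: eq_bigr => i _ /=.
rewrite exchange_big; apply: eq_bigr => l _ /=.
by rewrite inner_suml.
Qed.

End MatrixAlgebra.

Lemma ge0_eps (q s : R[i]) : 0 <= s -> (forall e : R, 0 < e -> 0 <= q + e%:C * s) -> 0 <= q.
Proof.
move=> s0 h; rewrite (ge0_ReE s0) in h; move: (Re s) h => {s0}s h.
have Im0 : complex.Im q = 0.
  have := h 1 ltr01; rewrite lecE => /andP[/eqP + _].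
  by case: q {h} => a b /=; lra.
rewrite lecE Im0 eqxx /= -oppr_le0; apply: (@ler_eps_mul _ _ _ s) => e /h.
by rewrite lecE => /andP[_]; case: q {h Im0} => a b /=; lra.
Qed.

Theorem rep_posmx H N S (t : (H -> H) -> (N -> N)) (T : finType) (A : T -> T -> H -> H) :
  Cstar_subalgebra S -> S idfun -> is_rep S t -> (forall i j, S (A i j)) ->
  posmx A -> posmx (fun i j => t (A i j)).
Proof.
move=> S_alg S1 t_rep SA A_pos x.
have [L [g g_orth]] := direct_sum (fun _ : T => H).
apply: (@ge0_eps _ (\sum_i inner N (x i) (x i))).
  by apply: sumr_ge0 => i _; rewrite inner_rnorm lecR sqr_ge0.
by move=> e e0; apply: (rep_posmx_eps S_alg S1 g_orth t_rep SA A_pos e0).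
Qed.

(** The operator [opnorm A ^+ 2 - A^* A] is positive and lies in [S]; by [rep_posmx] for matrices of
    size 1 so is its image, which is the asserted bound. *)
Lemma rep_opnorm H N S (t : (H -> H) -> (N -> N)) A :
  Cstar_subalgebra S -> S idfun -> is_rep S t -> S A -> opnorm (t A) <= opnorm A.
Proof.
move=> S_alg S1 t_rep SA; have hA := Cstar_bop S_alg SA.
have htA := rep_bop t_rep SA; have c0 := opnorm_ge0 hA.
pose c := opnorm A ^+ 2; pose D := (c%:C *: idfun) - (adj A \o A).
have SAA : S (adj A \o A) by apply: Cstar_comp => //; exact: Cstar_adj.
have SD : S D by apply: CstarB => //; exact: CstarZ.
have D_pos : posmx (fun _ _ : 'I_1 => D).
  move=> x; rewrite !big_ord1 /D !opE innerBl innerZl /= adjEr // !inner_rnorm.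
  rewrite -realCM -rmorphB lecR subr_ge0 /c -exprMn.
  by rewrite ler_pXn2r ?nnegrE ?mulr_ge0 ?rnorm_ge0 ?opnormP.
apply: opnorm_le => // x.
have := rep_posmx S_alg S1 t_rep (fun _ _ => SD) D_pos (fun=> x).
rewrite !big_ord1 /D (repB S_alg t_rep) //; last exact: CstarZ.
rewrite (repZ t_rep) // (rep_id t_rep) (rep_comp t_rep) ?(rep_adj t_rep) //; last exact: Cstar_adj.
rewrite !opE innerBl innerZl /= adjEr // !inner_rnorm -realCM -rmorphB lecR subr_ge0.
by rewrite /c -exprMn ler_pXn2r ?nnegrE ?mulr_ge0 ?rnorm_ge0.
Qed.

End PositiveOperators.

(** * Arveson's extension theorem *)

Section RieszExtension.
Variables (R : realType) (V : lmodType R[i]) (C : set V) (G0 : set (V * R)).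

(** Only real scalars act although [V] is complex. That such a set is the graph of a function
    follows from [graph_pos] once 0 lies in [C]. *)
Definition real_subspace (G : set (V * R)) :=
  G (0, 0) /\ forall (t : R) p q, G p -> G q -> G (t%:C *: p.1 + q.1, t * p.2 + q.2).

Definition graph_pos (G : set (V * R)) := forall p, G p -> C p.1 -> 0 <= p.2.

Hypothesis C_add : forall v w, C v -> C w -> C (v + w).
Hypothesis C_scale : forall (t : R) v, 0 <= t -> C v -> C (t%:C *: v).
Hypotheses (G0_sub : real_subspace G0) (G0_pos : graph_pos G0).

(** The value at [e] has to lie above the values at all [w] below [e] and below those at all [v]
    above [e]; the supremum of the former will do. The two cofinality hypotheses make it a supremum
    of a nonempty bounded set. *)
Lemma graph_extend (G : set (V * R)) e : G0 `<=` G -> real_subspace G -> graph_pos G ->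
  (exists2 p, G0 p & C (p.1 - e)) -> (exists2 p, G0 p & C (e - p.1)) ->
  exists l, [/\ real_subspace [set p | exists t : R, exists2 q, G q &
      p = (q.1 + t%:C *: e, q.2 + t * l)] &
    graph_pos [set p | exists t : R, exists2 q, G q &
      p = (q.1 + t%:C *: e, q.2 + t * l)]].
Proof.
move=> G0G G_sub G_pos [p0 Gp0 Cp0] [p1 Gp1 Cp1].
have [G00 Glin] := G_sub.
pose S := [set b | exists2 w, G (w, b) & C (e - w)].
have Sub v a b : G (v, a) -> C (v - e) -> S b -> b <= a.
  move=> Gv Cv [w Gw Cw]; have h : G (v - w, a - b).
    have := Glin (-1) (w, b) (v, a) Gw Gv; rewrite rmorphN rmorph1 scaleN1r mulN1r /=.
    by rewrite [- w + v]addrC [- b + a]addrC.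
  rewrite -subr_ge0; apply: (G_pos _ h) => /=.
  by rewrite (_ : v - w = (v - e) + (e - w)); [exact: C_add | rewrite addrA subrK].
have S0 : has_sup S.
  split; first by exists p1.2, p1.1; rewrite -?surjective_pairing //; exact: G0G.
  exists p0.2 => b Sb; apply: (Sub p0.1) Sb => //.
  by rewrite -surjective_pairing; exact: G0G.
exists (sup S); split.
  split; first by exists 0, (0, 0); rewrite //= scale0r mul0r !addr0.
  move=> t _ _ [s [p Gp ->]] [s' [q Gq ->]] /=.
  exists (t * s + s'), (t%:C *: p.1 + q.1, t * p.2 + q.2); first exact: Glin.
  rewrite /= scalerDr scalerA -realCM addrACA -scalerDl -rmorphD /=.
  by congr (_, _); ring.
move=> _ [t [[v a] Gv ->]] /= Cv.
(* Dividing by [t], an element [v + t e] of the cone says that [e] lies above [- v / t] if [t > 0],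
   and below it if [t < 0]. *)
have [t0|t0|t0] := ltrgt0P t; last by move: Cv; rewrite t0 scale0r mul0r !addr0; exact: G_pos Gv.
  have : - t^-1 * a <= sup S.
    apply: sup_upper_bound => //; exists ((- t^-1)%:C *: v).
      by have := Glin (- t^-1) _ _ Gv G00; rewrite /= !addr0.
    have ti : 0 < t^-1 by rewrite invr_gt0.
    have := C_scale (ltW ti) Cv.
    rewrite scalerDr scalerA -realCM mulVf ?lt0r_neq0 // scale1r addrC.
    by rewrite rmorphN scaleNr opprK.
  by rewrite mulNr lerNl -(ler_pM2l t0) mulrA mulfV ?lt0r_neq0 // mul1r mulrN; lra.
have t0' : 0 < - t^-1 by rewrite oppr_gt0 invr_lt0.
have : sup S <= - t^-1 * a.
  apply: ge_sup; first by case: S0.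
  move=> b; apply: (Sub ((- t^-1)%:C *: v)).
    by have := Glin (- t^-1) _ _ Gv G00; rewrite /= !addr0.
  have := C_scale (ltW t0') Cv.
  rewrite scalerDr scalerA -realCM mulNr mulVf ?ltr0_neq0 //.
  by rewrite (_ : (-1)%:C = -1 :> R[i]) ?scaleN1r // rmorphN rmorph1.
rewrite -(ler_nM2l t0) mulrA mulrN mulfV ?ltr0_neq0 // mulN1r; lra.
Qed.

(* M. Riesz: a positive functional on a cofinal subspace extends.  Functionals
   are handled through their graphs. *)
Theorem riesz_extension (E : set V) :
  (forall e, E e -> exists2 p, G0 p & C (p.1 - e)) ->
  (forall e, E e -> exists2 p, G0 p & C (e - p.1)) ->
  exists G, [/\ G0 `<=` G, real_subspace G, graph_pos G &
    forall e, E e -> exists a, G (e, a)].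
Proof.
move=> Eub Elb.
(* Zorn's lemma also asks about the empty chain. Joining [G0] to [A] makes its union, the empty set,
   good. *)
pose good A := real_subspace (G0 `|` A) /\ graph_pos (G0 `|` A).
have [F Fgood Ftot|A [[A_sub A_pos] Amax]] := @Zorn_bigcup _ good.
  have in2 p q : (G0 `|` \bigcup_(X in F) X) p -> (G0 `|` \bigcup_(X in F) X) q ->
      (G0 p /\ G0 q) \/ exists2 X, F X & (G0 `|` X) p /\ (G0 `|` X) q.
    move=> [Gp|[X FX Xp]] [Gq|[Y FY Yq]].
    - by left.
    - by right; exists Y => //; split; [left | right].
    - by right; exists X => //; split; [right | left].
    - have [XY|YX] := Ftot _ _ FX FY; right.
        by exists Y => //; split; right => //; exact: XY.
      by exists X => //; split; right => //; exact: YX.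
  split.
    split; first by left; case: G0_sub.
    move=> t p q hp hq; have [[Gp Gq]|[X FX [Xp Xq]]] := in2 _ _ hp hq.
      by left; case: G0_sub => _; exact.
    have [[_ Xlin] _] := Fgood _ FX.
    by case: (Xlin t _ _ Xp Xq) => [Gr|Xr]; [left | right; exists X].
  move=> p hp; have [[Gp _]|[X FX [Xp _]]] := in2 _ _ hp hp; first exact: G0_pos.
  by have [_] := Fgood _ FX; apply.
exists (G0 `|` A); split => // e Ee.
apply: contrapT => nAe.
have G0A : G0 `<=` G0 `|` A by move=> p; left.
have [l [G'_sub G'_pos]] := graph_extend G0A A_sub A_pos (Eub _ Ee) (Elb _ Ee).
set G' := [set p | _] in G'_sub G'_pos.
have GG' : (G0 `|` A) `<=` G'.
  by move=> p Gp; exists 0, p => //; rewrite scale0r mul0r !addr0 -surjective_pairing.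
have G'e : G' (e, l).
  by exists 1, (0, 0); [case: A_sub | rewrite /= scale1r mul1r !add0r].
apply: (Amax G'); last first.
  rewrite /good; have -> : G0 `|` G' = G' by apply/setUidPr => p Gp; apply: GG'; left.
  by [].
split=> [p Ap|G'A]; first by apply: GG'; right.
by apply: nAe; exists l; right; exact: G'A.
Qed.

End RieszExtension.

(** * Extension of completely positive forms *)

Section Arveson.
Variables (R : realType) (H : hilbert R).
Local Notation Re := (@complex.Re R).
Local Notation Im := (@complex.Im R).

(* [Phi A x y] plays the role of [<phi(A) x, y>] for a completely positive [phi];
   no linear structure is needed on the index type [X]. *)
Definition cp_form (S : set (H -> H)) X (Phi : (H -> H) -> X -> X -> R[i]) : Prop :=
  [/\ forall A B x y, S A -> S B -> Phi (A + B) x y = Phi A x y + Phi B x y,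
      forall a A x y, S A -> Phi (a *: A) x y = a * Phi A x y &
      forall (T : finType) (A : T -> T -> H -> H) (x : T -> X),
        (forall i j, S (A i j)) -> posmx A ->
        0 <= \sum_i \sum_j Phi (A i j) (x j) (x i)].

Lemma cp_form_id_ge0 S X (Phi : (H -> H) -> X -> X -> R[i]) x :
  S idfun -> cp_form S Phi -> 0 <= Phi idfun x x.
Proof.
move=> S1 [_ _ Ppos]; have := Ppos 'I_1 (fun _ _ => idfun) (fun=> x).
rewrite !big_ord1; apply => // h; rewrite !big_ord1.
by rewrite inner_rnorm lecR sqr_ge0.
Qed.

Lemma cp_form_adj S X (Phi : (H -> H) -> X -> X -> R[i]) A x y :
  Cstar_subalgebra S -> S idfun -> cp_form S Phi -> S A ->
  Phi (adj A) y x = (Phi A x y)^*%C.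
Proof.
move=> S_alg S1 hPhi SA; have [Padd Pscale Ppos] := hPhi.
have key B : S B -> Im (Phi B x y + Phi (adj B) y x) = 0.
  move=> SB; have hB := Cstar_bop S_alg SB.
  have hx := cp_form_id_ge0 x S1 hPhi; have hy := cp_form_id_ge0 y S1 hPhi.
  pose c := (opnorm B)%:C.
  pose M (i j : bool) := if i == j then c *: idfun else if i then adj B else B.
  have := Ppos bool M (fun i => if i then x else y).
  rewrite !big_bool /M /= !Pscale // => h.
  have : 0 <= c * Phi idfun x x + Phi (adj B) y x + (Phi B x y + c * Phi idfun y y).
    apply: h => [i j|z].
      by case: i; case: j; rewrite /=; [apply: CstarZ | apply: Cstar_adj | | apply: CstarZ].
    rewrite !big_bool /= adjEr // !opE !innerZl !inner_rnorm -!realCM.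
    rewrite (innerC (z false) (B _)) lecE /=.
    have := CauchySchwarz (B (z true)) (z false).
    have := opnormP (z true) hB; have := opnorm_ge0 hB.
    have := Re_le_cmod (inner H (B (z true)) (z false)).
    move: (rnorm_ge0 (z true)) (rnorm_ge0 (z false)) (rnorm_ge0 (B (z true))).
    move: (rnorm _) (rnorm (z false)) (rnorm (B _)) (cmod _) (opnorm B) => p q r m n.
    case: (inner _ _ _) => a b /= p0 q0 r0; rewrite ler_norml => /andP[h1 h2] n0 h3 h4.
    apply/andP; split; first by apply/eqP; ring.
    have h5 : r * q <= n * p * q by rewrite ler_wpM2r.
    have h6 : 0 <= n * (p - q) ^+ 2 by rewrite mulr_ge0 ?sqr_ge0.
    nra.
  rewrite (ge0_ReE hx) (ge0_ReE hy) lecE => /andP[/eqP + _].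
  by case: (Phi B x y); case: (Phi (adj B) y x) => /= *; lra.
have h1 := key _ SA; have := key _ (CstarZ S_alg 'i%C SA).
rewrite adjZ ?Pscale //; [|exact: Cstar_adj|exact: Cstar_bop SA].
move: h1; case: (Phi A x y); case: (Phi (adj A) y x) => /= a b a' b' h1 h2.
by congr (_ +i* _); lra.
Qed.

Section Extension.
Variables (S : set (H -> H)) (X : choiceType) (Phi0 : (H -> H) -> X -> X -> R[i]).
Hypotheses (S_alg : Cstar_subalgebra S) (S1 : S idfun) (Phi0_cp : cp_form S Phi0).

Let V := (X -> H) -> R[i].
Let term : Type := (H -> H) * (X * X).

(** The operator matrix with the single entry [A] in row [x] and column [y], seen as a function on
    families of vectors. Finite matrices over the possibly infinite index set [X] become elements of
    one vector space, with sums and positivity pointwise. *)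
Definition qform (A : H -> H) (y x : X) : V := fun h => inner H (A (h y)) (h x).

Let qsum (l : seq term) : V := \sum_(t <- l) qform t.1 t.2.1 t.2.2.

(** Single entries are not self-adjoint. Taking nonnegative real part as the cone, and the real part
    of the state as the functional, allows all entries at once. *)
Definition accretive : set V := [set v | forall h, 0 <= Re (v h)].

Definition state_graph : set (V * R) := [set p | exists l : seq term,
  [/\ forall t, t \in l -> S t.1, p.1 = qsum l &
      p.2 = Re (\sum_(t <- l) Phi0 t.1 t.2.1 t.2.2)]].

(** Complete positivity speaks of matrices, the graph of lists of terms. Terms at the same place are
    added up to one entry of a matrix over the finite set of occurring indices; this is done both
    for [Phi0] and for the forms. *)
Lemma regroup (W : nmodType) (F : (H -> H) -> X -> X -> W) (l : seq term) (pts : seq X) :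
  (forall y x, F 0 y x = 0) ->
  (forall A B y x, S A -> S B -> F (A + B) y x = F A y x + F B y x) ->
  (forall t, t \in l -> [/\ S t.1, t.2.1 \in pts & t.2.2 \in pts]) ->
  \sum_(i : seq_sub pts) \sum_(j : seq_sub pts)
    F (\sum_(t <- l | (t.2.1 == val j) && (t.2.2 == val i)) t.1) (val j) (val i) =
  \sum_(t <- l) F t.1 t.2.1 t.2.2.
Proof.
move=> F0 FD lS.
have -> : \sum_(t <- l) F t.1 t.2.1 t.2.2 = \sum_(i : seq_sub pts) \sum_(j : seq_sub pts)
   \sum_(t <- l | (t.2.1 == val j) && (t.2.2 == val i)) F t.1 (val j) (val i).
  under [RHS]eq_bigr => i _ do under eq_bigr => j _ do rewrite big_mkcond.
  under [RHS]eq_bigr => i _ do rewrite exchange_big.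
  rewrite [RHS]exchange_big; apply: eq_big_seq => t tl; have [_ ty tx] := lS _ tl.
  rewrite (bigD1 (SeqSub tx)) //= (bigD1 (SeqSub ty)) //= !eqxx /=.
  rewrite big1 => [|j hj]; last first.
    by case: eqP => // e; case/eqP: hj; apply: val_inj; rewrite /= e.
  rewrite addr0 big1 ?addr0 // => i hi; rewrite big1 // => j _.
  by case: (t.2.2 =P val i) => [e|]; rewrite ?andbF //; case/eqP: hi; apply: val_inj; rewrite /= e.
apply: eq_bigr => i _; apply: eq_bigr => j _.
have {lS}lS t : t \in l -> S t.1 by move=> /lS[].
elim: l lS => [|t l ih] lS; first by rewrite !big_nil F0.
have Sl : S (\sum_(t <- l | (t.2.1 == val j) && (t.2.2 == val i)) t.1).
  rewrite big_seq_cond; apply: Cstar_sum => // u /andP[ul _].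
  by apply: lS; rewrite inE ul orbT.
rewrite !big_cons; case: ifP => _; last by apply: ih => u ul; apply: lS; rewrite inE ul orbT.
rewrite FD ?ih // => [u ul|]; first by apply: lS; rewrite inE ul orbT.
by apply: lS; rewrite inE eqxx.
Qed.

(** If the form of the matrix [B] has nonnegative real part, then [B + B^*] is positive, and [Phi0]
    takes on it twice the real part of its value on [B]. Since 0 is accretive, the result also makes
    the functional independent of the way a form is written as a sum. *)
Lemma state_graph_pos : graph_pos accretive state_graph.
Proof.
have [Padd Pscale Ppos] := Phi0_cp.
move=> [_ _] [l [lS /= -> ->]] q_acc.
pose pts := [seq t.2.1 | t <- l] ++ [seq t.2.2 | t <- l].
have lP t : t \in l -> [/\ S t.1, t.2.1 \in pts & t.2.2 \in pts].
  move=> tl; split; first exact: lS.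
    by rewrite mem_cat (map_f (fun t : term => t.2.1)).
  by rewrite mem_cat orbC (map_f (fun t : term => t.2.2)).
pose B (i j : seq_sub pts) := \sum_(t <- l | (t.2.1 == val j) && (t.2.2 == val i)) t.1.
have SB i j : S (B i j).
  rewrite /B big_seq_cond; apply: Cstar_sum => // t /andP[/lS].
  by [].
have hB i j := Cstar_bop S_alg (SB i j).
have P0 y x : Phi0 0 y x = 0.
  by have := Pscale 0 0 y x (Cstar0 S_alg); rewrite scale0r mul0r.
have sumE : \sum_i \sum_j Phi0 (B i j) (val j) (val i) = \sum_(t <- l) Phi0 t.1 t.2.1 t.2.2.
  by apply: regroup lP => // A A' y x SA SA'; exact: Padd.
have {}q_acc (h : seq_sub pts -> H) : 0 <= Re (\sum_i \sum_j inner H (B i j (h j)) (h i)).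
  pose h' x := if insub x is Some i then h i else 0.
  have h'E i : h' (val i) = h i by rewrite /h' valK.
  have := q_acc h'; rewrite /qsum.
  have -> : (\sum_(t <- l) qform t.1 t.2.1 t.2.2) h' =
      \sum_(t <- l) qform t.1 t.2.1 t.2.2 h'.
    by elim/big_rec2: _ => // t v w _ <-.
  rewrite -(regroup (F := fun A y x => qform A y x h') _ _ lP).
  - under eq_bigr => i _ do under eq_bigr => j _ do rewrite /qform !h'E.
    by [].
  - by move=> y x; rewrite /qform opE inner0l.
  - by move=> A A' y x _ _; rewrite /qform opE innerDl.
have := Ppos (seq_sub pts) (fun i j => B i j + adj (B j i)) val.
have adj_sum (F : seq_sub pts -> seq_sub pts -> R[i]) G :
    (forall i j, G i j = (F j i)^*%C) ->
    \sum_i \sum_j (F i j + G i j) = (2 * Re (\sum_i \sum_j F i j))%:C.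
  move=> FG; have -> : \sum_i \sum_j (F i j + G i j) =
      \sum_i \sum_j F i j + (\sum_i \sum_j F i j)^*%C.
    rewrite conj_sum; under [in RHS]eq_bigr => i _ do idtac.
    under [X in _ = _ + X]eq_bigr => i _ do rewrite conj_sum.
    rewrite [X in _ = _ + X]exchange_big -big_split; apply: eq_bigr => i _ /=.
    by rewrite -big_split; apply: eq_bigr => j _ /=; rewrite FG.
  by case: (\sum_i _) => a b; apply/eqP; rewrite eq_complex /=;
    apply/andP; split; apply/eqP; ring.
have -> : \sum_i \sum_j Phi0 (B i j + adj (B j i)) (val j) (val i) =
    (2 * Re (\sum_(t <- l) Phi0 t.1 t.2.1 t.2.2))%:C.
  rewrite -sumE -(adj_sum _ (fun i j => Phi0 (adj (B j i)) (val j) (val i))).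
    apply: eq_bigr => i _; apply: eq_bigr => j _; rewrite Padd //; exact: (Cstar_adj S_alg (SB _ _)).
  by move=> i j; exact: (cp_form_adj _ _ S_alg S1 Phi0_cp (SB j i)).
rewrite lecR pmulr_rge0 //; apply => [i j|h].
  by apply: CstarD => //; exact: Cstar_adj.
rewrite (_ : \sum_i _ = (2 * Re (\sum_i \sum_j inner H (B i j (h j)) (h i)))%:C).
  by rewrite lecR mulr_ge0 //; exact: q_acc.
rewrite -(adj_sum _ (fun i j => inner H (adj (B j i) (h j)) (h i))).
  by apply: eq_bigr => i _; apply: eq_bigr => j _; rewrite opE innerDl.
by move=> i j; rewrite adjEr // -innerC.
Qed.

Lemma state_graph_subspace : real_subspace state_graph.
Proof.
have [Padd Pscale _] := Phi0_cp; split.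
  by exists [::]; split=> //=; rewrite ?/qsum big_nil.
move=> r [_ _] [_ _] [l [lS /= -> ->]] [m [mS /= -> ->]].
exists ([seq (r%:C *: t.1, t.2) | t <- l] ++ m); split=> [t||].
- rewrite mem_cat => /orP[/mapP[u ul ->]|/mS//] /=.
  by apply: CstarZ => //; exact: lS.
- rewrite /qsum big_cat big_map scaler_sumr /=; congr (_ + _).
  apply: eq_bigr => t _; apply/funext => h.
  by rewrite /qform /= opE innerZl.
- rewrite /= big_cat big_map ReD -Re_realM mulr_sumr; congr (Re _ + _).
  by apply: eq_big_seq => t tl /=; rewrite Pscale //; exact: lS.
Qed.

(** By Cauchy-Schwarz the scalar [opnorm A], placed at the diagonal places of [y] and [x],
    dominates; these entries lie in [S] because the identity does. This is the cofinality asked for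
    by [riesz_extension], the bound from below coming from [- A]. *)
Lemma qform_ubound A y x : bounded_op A ->
  exists2 p, state_graph p & accretive (p.1 - qform A y x).
Proof.
move=> hA; pose c := opnorm A; have c0 : 0 <= c := opnorm_ge0 hA.
pose l : seq term := [:: (c%:C *: idfun, (y, y)); (c%:C *: idfun, (x, x))].
exists (qsum l, Re (\sum_(t <- l) Phi0 t.1 t.2.1 t.2.2)).
  exists l; split=> // t; rewrite !inE => /orP[] /eqP -> /=; exact: CstarZ.
move=> h; rewrite /= /qsum !big_cons big_nil addr0.
rewrite /GRing.add /GRing.opp /= /qform /= !opE !innerZl !inner_rnorm -!realCM.
rewrite ReB ReD /=.
have := Re_inner_le (A (h y)) (h x); have := opnormP (h y) hA; rewrite -/c.
move: (rnorm_ge0 (h y)) (rnorm_ge0 (h x)) (rnorm_ge0 (A (h y))).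
move: (rnorm _) (rnorm (h x)) (rnorm (A _)) => p q r p0 q0 r0 h1 h2.
have h5 : r * q <= c * p * q by rewrite ler_wpM2r.
have h6 : 0 <= c * (p - q) ^+ 2 by rewrite mulr_ge0 ?sqr_ge0.
have h7 : 0 <= c * (p ^+ 2) by rewrite mulr_ge0 ?sqr_ge0.
have h8 : 0 <= c * (q ^+ 2) by rewrite mulr_ge0 ?sqr_ge0.
nra.
Qed.

Lemma qformN A y x : qform (- A) y x = - qform A y x.
Proof. by apply/funext => h; rewrite /qform opE innerNl. Qed.

Lemma qformD A B y x : qform (A + B) y x = qform A y x + qform B y x.
Proof. by apply/funext => h; rewrite /qform opE innerDl. Qed.

Lemma qformZ a A y x : qform (a *: A) y x = a *: qform A y x.
Proof. by apply/funext => h; rewrite /qform opE innerZl. Qed.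

Theorem arveson : exists Phi : (H -> H) -> X -> X -> R[i],
  cp_form (@bounded_op R H H) Phi /\ forall A x y, S A -> Phi A x y = Phi0 A x y.
Proof.
have [Padd Pscale _] := Phi0_cp.
have [||||G [G0G [G00 Glin] G_pos GE]] := riesz_extension _ _ state_graph_subspace state_graph_pos
    (E := [set v | exists A y x, bounded_op A /\ v = qform A y x]).
- by move=> v w hv hw h; rewrite /GRing.add /= ReD addr_ge0.
- by move=> r v r0 hv h; rewrite /GRing.scale /= Re_realM mulr_ge0.
- by move=> _ [A [y [x [hA ->]]]]; exact: qform_ubound.
- move=> _ [A [y [x [hA ->]]]].
  have [[v a] Gp acc] := qform_ubound y x (bopN hA).
  exists (- v, - a); last by move: acc; rewrite /= qformN opprK opprK addrC.
  have [G00' Glin'] := state_graph_subspace; have := Glin' (-1) _ _ Gp G00'.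
  by rewrite rmorphN rmorph1 scaleN1r mulN1r /= !addr0.
pose r A y x := xget 0 [set a | G (qform A y x, a)].
have rP A y x : bounded_op A -> G (qform A y x, r A y x).
  move=> hA; apply: (@xgetPex _ 0 [set a | G (qform A y x, a)]).
  by apply: GE; exists A, y, x.
have acc0 : accretive 0 by move=> h.
have Guniq v a b : G (v, a) -> G (v, b) -> a = b.
  have le c d : G (v, c) -> G (v, d) -> c <= d.
    move=> Gc Gd; have := Glin (-1) _ _ Gc Gd.
    rewrite rmorphN rmorph1 scaleN1r mulN1r /= addNr => /G_pos /=.
    by rewrite addrC subr_ge0; apply.
  by move=> Ga Gb; apply/le_anti; rewrite !le.
have rD A B y x : bounded_op A -> bounded_op B -> r (A + B) y x = r A y x + r B y x.
  move=> hA hB; apply: Guniq (rP _ _ _ (bopD hA hB)) _; rewrite qformD.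
  by have := Glin 1 _ _ (rP A y x hA) (rP B y x hB); rewrite rmorph1 scale1r mul1r.
have rZ t A y x : bounded_op A -> r (t%:C *: A) y x = t * r A y x.
  move=> hA; apply: Guniq (rP _ _ _ (bopZ _ hA)) _; rewrite qformZ.
  by have := Glin t _ _ (rP A y x hA) G00; rewrite /= !addr0.
have Gsum I (s : seq I) (F : I -> V * R) : (forall i, G (F i)) ->
    G (\sum_(i <- s) (F i).1, \sum_(i <- s) (F i).2).
  move=> hF; elim: s => [|i s ih]; first by rewrite !big_nil.
  rewrite !big_cons; have := Glin 1 _ _ (hF i) ih.
  by rewrite rmorph1 scale1r mul1r.
have sumE I (s : seq I) (F : I -> V) h : (\sum_(i <- s) F i) h = \sum_(i <- s) F i h.
  by elim/big_rec2: _ => // i v w _ <-.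
(* A complex linear [f] with real part [r] satisfies [Im (f A) = - r (i A)]. *)
exists (fun A y x => r A y x +i* (- r ('i%C *: A) y x)); split; last first.
  move=> A y x SA.
  have rS B : S B -> r B y x = Re (Phi0 B y x).
    move=> SB; apply: Guniq (rP _ _ _ (Cstar_bop S_alg SB)) _; apply: G0G.
    exists [:: (B, (y, x))]; split=> [t||]; first by rewrite inE => /eqP ->.
      by rewrite /qsum big_seq1.
    by rewrite big_seq1.
  rewrite !rS //; last exact: CstarZ.
  by rewrite Pscale //; case: (Phi0 A y x) => a b /=; congr (_ +i* _); ring.
split.
- move=> A B y x hA hB; rewrite scalerDr !rD //; try exact: bopZ.
  by apply/eqP; rewrite eq_complex /= opprD !eqxx.
- move=> [a b] A y x hA; have hiA := bopZ 'i%C hA.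
  have -> : (a +i* b) *: A = (a%:C *: A) + (b%:C *: ('i%C *: A)).
    rewrite scalerA -scalerDl; congr (_ *: _).
    by apply/eqP; rewrite eq_complex /=; apply/andP; split; apply/eqP; ring.
  rewrite scalerDr !rD ?rZ //; try by do ?apply: bopZ.
  have -> : 'i%C *: (a%:C *: A) = a%:C *: ('i%C *: A) by rewrite !scalerA mulrC.
  have -> : 'i%C *: (b%:C *: ('i%C *: A)) = (- b)%:C *: A.
    rewrite !scalerA; congr (_ *: _).
    by apply/eqP; rewrite eq_complex /=; apply/andP; split; apply/eqP; ring.
  by rewrite !rZ //; apply/eqP; rewrite eq_complex /=; apply/andP; split; apply/eqP; ring.
- move=> T A x hA A_pos.
  have key (B : T -> T -> H -> H) : (forall i j, bounded_op (B i j)) ->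
      (forall h : T -> H, 0 <= Re (\sum_i \sum_j inner H (B i j (h j)) (h i))) ->
      0 <= \sum_i \sum_j r (B i j) (x j) (x i).
    move=> hB B_acc.
    have := Gsum _ (index_enum T) (fun i => (\sum_j qform (B i j) (x j) (x i),
      \sum_j r (B i j) (x j) (x i))).
    move=> /(_ _)/G_pos; apply => [i|h] /=.
      by apply: (Gsum _ _ (fun j => (qform (B i j) (x j) (x i), r (B i j) (x j) (x i)))) => j;
        exact: rP.
    rewrite sumE; under eq_bigr => i _ do rewrite sumE.
    exact: (B_acc (fun i => h (x i))).
  have ReA : 0 <= \sum_i \sum_j r (A i j) (x j) (x i).
    by apply: key => // h; exact/Re_ge0/A_pos.
  (* For positive [A] and real [s] the form of [s i A] has real part 0, so it lies in the cone;
     [s = 1] and [s = -1] together force the imaginary part to vanish. *)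
  have ImA : \sum_i \sum_j r ('i%C *: A i j) (x j) (x i) = 0.
    have iA (s : R) : 0 <= \sum_i \sum_j r (s%:C *: ('i%C *: A i j)) (x j) (x i).
      apply: key => [i j|h]; first by do 2!apply: bopZ.
      have -> : \sum_i \sum_j inner H ((s%:C *: ('i%C *: A i j)) (h j)) (h i) =
          (s%:C * 'i%C) * \sum_i \sum_j inner H (A i j (h j)) (h i).
        rewrite mulr_sumr; apply: eq_bigr => i _; rewrite mulr_sumr.
        by apply: eq_bigr => j _; rewrite !opE !innerZl mulrA.
      rewrite (ge0_ReE (A_pos h)) /=; lra.
    have sE (s : R) : \sum_i \sum_j r (s%:C *: ('i%C *: A i j)) (x j) (x i) =
        s * \sum_i \sum_j r ('i%C *: A i j) (x j) (x i).
      rewrite mulr_sumr; apply: eq_bigr => i _; rewrite mulr_sumr.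
      by apply: eq_bigr => j _; rewrite rZ //; exact: bopZ.
    apply/le_anti; have := iA (-1); have := iA 1; rewrite !sE; lra.
  have cE (a b : T -> T -> R) : \sum_i \sum_j (a i j +i* b i j) =
      (\sum_i \sum_j a i j) +i* (\sum_i \sum_j b i j).
    have c1 (u v : T -> R) : \sum_i (u i +i* v i) = (\sum_i u i) +i* (\sum_i v i).
      by elim/big_rec3: _ => // i p q w _ ->.
    by under eq_bigr => i _ do rewrite c1; exact: c1.
  rewrite cE; under [X in _ +i* X]eq_bigr => i _ do rewrite sumrN.
  by rewrite sumrN ImA oppr0 lecR.
Qed.

End Extension.
End Arveson.

(** * Stinespring's theorem *)

Section Stinespring.
Variable R : realType.
Implicit Types H K L M N : hilbert R.
Local Notation Re := (@complex.Re R).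

Lemma bop_Cstar H : Cstar_subalgebra (@bounded_op R H H).
Proof.
split=> //.
- by split=> [|A B]; [exact: bop0 | exact: bopD].
- by split=> [a A|A B]; [exact: bopZ | exact: bop_comp].
Qed.

Lemma total_eq M X (g : X -> M) z w : total g ->
  (forall x, inner M z (g x) = inner M w (g x)) -> z = w.
Proof.
move=> g_total h; apply/eqP; rewrite -subr_eq0; apply/eqP/g_total => x.
by rewrite innerBl h subrr.
Qed.

(** The space has the kernel [Phi (B^* A) x y] on pairs [(A, x)], [(B, y)]; [s D] multiplies the
    first entry by [D], and [j x] is the pair [(1, x)]. As [X] is a mere index set, linearity of [j]
    makes no sense here and is recovered in the applications. *)
Theorem stinespring H X (Phi : (H -> H) -> X -> X -> R[i]) :
  cp_form (@bounded_op R H H) Phi ->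
  exists (M : hilbert R) (s : (H -> H) -> (M -> M)) (j : X -> M),
    is_rep (@bounded_op R H H) s /\
    forall A x y, bounded_op A -> inner M (s A (j x)) (j y) = Phi A x y.
Proof.
move=> [Padd Pscale Ppos].
pose Y : Type := {A : H -> H | bounded_op A} * X.
pose op (u : Y) : H -> H := sval u.1.
have opb u : bounded_op (op u) by exact: svalP u.1.
pose k (u v : Y) := Phi (adj (op v) \o op u) u.2 v.2.
(* Inserting a positive [B] keeps the kernel positive. [B = 1] is the kernel itself, and
   [B = opnorm D ^+ 2 - D^* D] shows that multiplication by [D] is bounded. *)
pose twist (B : H -> H) (u v : Y) := Phi (adj (op v) \o (B \o op u)) u.2 v.2.
have twist_pos B l : bounded_op B -> (forall z, 0 <= inner H (B z) z) ->
    0 <= kform (twist B) l l.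
  move=> hB B_pos; pose a (p : R[i] * Y) : H -> H := p.1 *: op p.2.
  have ab p : bounded_op (a p) by exact: bopZ.
  have -> : kform (twist B) l l = \sum_(q <- l) \sum_(p <- l)
      Phi (adj (a q) \o (B \o a p)) p.2.2 q.2.2.
    rewrite /kform exchange_big; apply: eq_bigr => q _; apply: eq_bigr => p _.
    have -> : adj (a q) \o (B \o a p) =
        (p.1 * q.1^*%C) *: (adj (op q.2) \o (B \o op p.2)).
      apply/funext => z; rewrite opZE /= /a adjZ // !opE (linZ (bop_lin hB)).
      by rewrite (linZ (bop_lin (bop_adj (opb _)))) scalerA mulrC.
    rewrite Pscale //; apply: bop_comp; first exact: bop_adj.
    exact: bop_comp.
  pose f i := tnth (in_tuple l) i.
  rewrite big_tnth; under eq_bigr => i _ do rewrite big_tnth.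
  apply: (Ppos _ (fun i j => adj (a (f i)) \o (B \o a (f j))) (fun i => (f i).2.2)).
    by move=> i j; apply: bop_comp; [exact: bop_adj | exact: bop_comp].
  move=> h; suff -> : \sum_i \sum_j inner H ((adj (a (f i)) \o (B \o a (f j))) (h j)) (h i) =
      inner H (B (\sum_j a (f j) (h j))) (\sum_j a (f j) (h j)) by [].
  rewrite inner_sumr; apply: eq_bigr => i _; rewrite (lin_sum (bop_lin hB)) inner_suml.
  by apply: eq_bigr => j _ /=; rewrite adjEr.
have kE : k = twist idfun by [].
have k_psd : psd k.
  move=> l; rewrite kE; apply: twist_pos; first exact: bop_id.
  by move=> z; rewrite inner_rnorm lecR sqr_ge0.
have [M [g [gk g_total]]] := kernel_hilbert k_psd.
(* The points of [Y] carry proofs of boundedness; the vectors do not depend on them. *)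
have opP u v : op u = op v -> u.2 = v.2 -> g u = g v.
  by move=> uv uv2; apply: (total_eq g_total) => w; rewrite !gk /k uv uv2.
pose mulY D (hD : bounded_op D) (u : Y) : Y :=
  (exist _ (D \o op u) (bop_comp hD (opb u)), u.2).
have ext D : exists T : M -> M, forall hD : bounded_op D,
    bounded_op T /\ forall u, T (g u) = g (mulY D hD u).
  have [hD|nD] := pselect (bounded_op D); last by exists 0 => hD; case: (nD hD).
  have [||T [Tb TE _]] := @total_extend _ _ _ _ g_total M (fun u => g (mulY D hD u)) (opnorm D).
  - exact: opnorm_ge0.
  - move=> l; rewrite -(@ler_pXn2r _ 2) ?nnegrE ?mulr_ge0 ?rnorm_ge0 ?opnorm_ge0 //.
    rewrite exprMn !rnorm_sqr -!kform_lsum.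
    have -> : kform (fun x y => inner M (g (mulY D hD x)) (g (mulY D hD y))) l l =
        kform (twist (adj D \o D)) l l.
      apply: eq_bigr => p _; apply: eq_bigr => q _; rewrite gk /k /mulY /= /op /=.
      by rewrite (adj_comp hD (svalP q.2.1)).
    have -> : kform (fun x y => inner M (g x) (g y)) l l = kform (twist idfun) l l.
      by apply: eq_bigr => p _; apply: eq_bigr => q _; rewrite gk.
    pose c := opnorm D ^+ 2.
    have hDD : bounded_op (adj D \o D) by apply: bop_comp => //; exact: bop_adj.
    have := @twist_pos ((c%:C *: idfun) - (adj D \o D)) l.
    have -> : kform (twist ((c%:C *: idfun) - (adj D \o D))) l l =
        c%:C * kform (twist idfun) l l - kform (twist (adj D \o D)) l l.
      rewrite /kform mulr_sumr -sumrB; apply: eq_bigr => p _.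
      rewrite mulr_sumr -sumrB; apply: eq_bigr => q _.
      rewrite mulrCA -mulrBr; congr (_ * _); rewrite /twist.
      have -> : adj (op q.2) \o (((c%:C *: idfun) - (adj D \o D)) \o op p.2) =
          (c%:C *: (adj (op q.2) \o (idfun \o op p.2))) +
          (-1) *: (adj (op q.2) \o ((adj D \o D) \o op p.2)).
        apply/funext => z; rewrite !opE /= ?opE scaleN1r.
        have al := bop_lin (bop_adj (opb q.2)).
        by rewrite (linB al) (linZ al).
      have h1 : bounded_op (adj (op q.2) \o (idfun \o op p.2)).
        by apply: bop_comp; [exact: bop_adj | exact: opb].
      have h2 : bounded_op (adj (op q.2) \o ((adj D \o D) \o op p.2)).
        by apply: bop_comp; [exact: bop_adj | exact: bop_comp].
      by rewrite Padd ?Pscale ?mulN1r //; exact: bopZ.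
    move=> h; have {h} : 0 <= c%:C * kform (twist idfun) l l - kform (twist (adj D \o D)) l l.
      apply: h => [|z]; first by apply: bopB => //; apply/bopZ/bop_id.
      rewrite !opE innerBl innerZl /= adjEr // !inner_rnorm.
      rewrite -realCM -rmorphB lecR subr_ge0 /c -exprMn.
      by rewrite ler_pXn2r ?nnegrE ?mulr_ge0 ?rnorm_ge0 ?opnorm_ge0 ?opnormP.
    by move=> /Re_ge0; rewrite ReB Re_realM subr_ge0.
  exists T => hD'; split=> // u; rewrite TE; exact: opP.
have [s sP] := choice ext.
have sb D (hD : bounded_op D) : bounded_op (s D) := (sP D hD).1.
have sE D (hD : bounded_op D) u : s D (g u) = g (mulY D hD u) := (sP D hD).2 u.
pose j x : M := g (exist _ idfun (bop_id H), x).
exists M, s, j; split; last first.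
  move=> A x y hA; rewrite /j (sE A hA) gk /k /mulY /op /= adj_id.
  by [].
split.
- exact: sb.
- split=> [A B hA hB|a A hA].
    have hAB := bopD hA hB.
    apply: (total_ext g_total); [exact: sb|by apply: bopD; exact: sb|].
    move=> u; rewrite opE !sE; apply: (total_eq g_total) => v.
    rewrite innerDl !gk /k /= -Padd; try by apply: bop_comp; [exact: bop_adj|exact: bop_comp].
    congr (Phi _ _ _); apply/funext => z; rewrite /= !opE /=.
    by rewrite (linD (bop_lin (bop_adj (opb v)))).
  have haA := bopZ a hA.
  apply: (total_ext g_total); [exact: sb|by apply: bopZ; exact: sb|].
  move=> u; rewrite opE !sE; apply: (total_eq g_total) => v.
  rewrite innerZl !gk /k /= -Pscale; last by apply: bop_comp; [exact: bop_adj|exact: bop_comp].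
  congr (Phi _ _ _); apply/funext => z; rewrite /= !opE /=.
  by rewrite (linZ (bop_lin (bop_adj (opb v)))).
- move=> A B hA hB; have hAB := bop_comp hA hB.
  apply: (total_ext g_total); [exact: sb|by apply: bop_comp; exact: sb|].
  by move=> u /=; rewrite !sE; exact: opP.
- move=> A hA; have hAa := bop_adj hA.
  apply: (total_ext g_total); [exact: sb|by apply: bop_adj; exact: sb|].
  move=> u; rewrite (sE _ hAa); apply: (total_eq g_total) => v.
  rewrite (adjEr _ _ (sb _ hA)) (sE _ hA) !gk /k /=.
  by rewrite /op /= (adj_comp hA (svalP v.1)).
- apply: (total_ext g_total); [by apply: sb; exact: bop_id|exact: bop_id|].
  by move=> u /=; rewrite (sE _ (bop_id H)); exact: opP.
Qed.

(** The defect of linearity is orthogonal to the range of [j] and is itself a combination of values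
    of [j], so it is orthogonal to itself. *)
Lemma inner_preserving_isometry N M (j : N -> M) :
  (forall x y, inner M (j x) (j y) = inner N x y) -> isometry j.
Proof.
move=> jP; split=> // a x y; apply/eqP; rewrite -subr_eq0; apply/eqP/rnorm_eq0/eqP.
rewrite -sqrf_eq0 rnorm_sqr; set z := _ - _.
have zj w : inner M z (j w) = 0.
  by rewrite /z innerBl innerDl innerZl !jP innerDl innerZl subrr.
by rewrite {2}/z innerBr innerDr innerZr !zj mulr0 addr0 subrr.
Qed.

(* Dilate an Arveson extension of [t]: since [t] is multiplicative, [S] preserves
   [range j]. *)
Theorem rep_extension H N (S : set (H -> H)) (t : (H -> H) -> (N -> N)) :
  Cstar_subalgebra S -> S idfun -> is_rep S t ->
  exists (M : hilbert R) (s : (H -> H) -> (M -> M)) (j : N -> M),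
    [/\ is_rep (@bounded_op R H H) s, isometry j &
        forall A x, S A -> s A (j x) = j (t A x)].
Proof.
move=> S_alg S1 t_rep.
pose Phi0 A (x y : N) := inner N (t A x) y.
have Phi0_cp : cp_form S Phi0.
  split=> [A B x y SA SB|a A x y SA|T A x SA A_pos].
  - by rewrite /Phi0 (repD t_rep) // innerDl.
  - by rewrite /Phi0 (repZ t_rep) // innerZl.
  - exact: rep_posmx S_alg S1 t_rep SA A_pos x.
have [Phi [Phi_cp PhiE]] := arveson S_alg S1 Phi0_cp.
have [M [s [j [s_rep sE]]]] := stinespring Phi_cp.
have bS A : S A -> bounded_op A := @Cstar_bop _ _ _ S_alg A.
have sS A x y : S A -> inner M (s A (j x)) (j y) = inner N (t A x) y.
  by move=> SA; rewrite sE ?PhiE //; exact: bS.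
have j_iso : isometry j.
  apply: inner_preserving_isometry => x y.
  by have := sS _ x y S1; rewrite (rep_id s_rep) (rep_id t_rep).
exists M, s, j; split => // A x SA; have hA := bS _ SA.
have hsA := rep_bop s_rep hA; have htA := rep_bop t_rep SA.
apply/eqP; rewrite -subr_eq0; apply/eqP/rnorm_eq0/eqP; rewrite -sqrf_eq0 rnorm_sqr.
rewrite innerBl !innerBr (innerC (j _) (s A _)) !sS // (proj2 j_iso).
have -> : inner M (s A (j x)) (s A (j x)) = inner N (t A x) (t A x).
  have SAA : S (adj A \o A) by apply: Cstar_comp => //; exact: Cstar_adj.
  have := sS _ x x SAA.
  rewrite (rep_comp s_rep (bop_adj hA) hA) (rep_comp t_rep (Cstar_adj S_alg SA) SA).
  by rewrite (rep_adj s_rep hA) (rep_adj t_rep SA) /= !adjEr.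
by rewrite -(innerC (t A x)) !subrr.
Qed.

End Stinespring.

(** * Equivalence of unitary tuples *)

Section Polynomials.
Variables (R : realType) (d : nat).
Implicit Types H K L M N : hilbert R.
Local Notation Re := (@complex.Re R).

Inductive starpoly :=
| PVar of 'I_d
| PStar of 'I_d
| POne
| PAdd of starpoly & starpoly
| PScale of R[i] & starpoly
| PMul of starpoly & starpoly.

Fixpoint peval H (u : 'I_d -> H -> H) (p : starpoly) : H -> H :=
  match p with
  | PVar i => u i
  | PStar i => adj (u i)
  | POne => idfun
  | PAdd p q => peval u p + peval u q
  | PScale a p => a *: peval u p
  | PMul p q => peval u p \o peval u q
  end.

Fixpoint pstar (p : starpoly) : starpoly :=
  match p with
  | PVar i => PStar i
  | PStar i => PVar i
  | POne => POne
  | PAdd p q => PAdd (pstar p) (pstar q)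
  | PScale a p => PScale a^*%C (pstar p)
  | PMul p q => PMul (pstar q) (pstar p)
  end.

Definition PSub p q := PAdd p (PScale (-1) q).

Section Eval.
Variables (H : hilbert R) (u : 'I_d -> H -> H).
Hypothesis ub : forall i, bounded_op (u i).

Lemma peval_bop p : bounded_op (peval u p).
Proof.
elim: p => [i|i||p ihp q ihq|a p ihp|p ihp q ihq] /=.
- exact: ub.
- by apply: bop_adj; exact: ub.
- exact: bop_id.
- exact: bopD.
- exact: bopZ.
- exact: bop_comp.
Qed.

Lemma peval_star p : peval u (pstar p) = adj (peval u p).
Proof.
elim: p => [i|i||p ihp q ihq|a p ihp|p ihp q ihq] /=.
- by [].
- by rewrite (adjK (ub i)).
- by rewrite adj_id.
- by rewrite (adjD (peval_bop p) (peval_bop q)) ihp ihq.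
- by rewrite (adjZ _ (peval_bop p)) ihp.
- by rewrite (adj_comp (peval_bop p) (peval_bop q)) ihp ihq.
Qed.

Lemma peval_sub p q : peval u (PSub p q) = peval u p - peval u q.
Proof. by rewrite /= scaleN1r. Qed.

Lemma rep_peval N S (t : (H -> H) -> (N -> N)) p :
  Cstar_subalgebra S -> S idfun -> is_rep S t -> (forall i, S (u i)) ->
  S (peval u p) /\ t (peval u p) = peval (fun i => t (u i)) p.
Proof.
move=> S_alg S1 t_rep Su.
elim: p => [i|i||p [Sp tp] q [Sq tq]|a p [Sp tp]|p [Sp tp] q [Sq tq]] /=.
- by [].
- by split; [exact: Cstar_adj | exact: rep_adj t_rep _ (Su i)].
- by rewrite (rep_id t_rep).
- by split; [exact: CstarD | rewrite (repD t_rep Sp Sq) tp tq].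
- by split; [exact: CstarZ | rewrite (repZ t_rep _ Sp) tp].
- by split; [exact: Cstar_comp | rewrite (rep_comp t_rep Sp Sq) tp tq].
Qed.

End Eval.

(** * Joint limits of polynomials at two tuples *)

Section Approximants.
Variables (H K : hilbert R) (u : 'I_d -> H -> H) (v : 'I_d -> K -> K).
Hypotheses (ub : forall i, bounded_op (u i)) (vb : forall i, bounded_op (v i)).

(* [A] and [B] are the values at [u] and [v] of the same limit of polynomials. *)
Definition colimit (A : H -> H) (B : K -> K) := [/\ bounded_op A, bounded_op B &
  forall e : R, 0 < e -> exists p, opnorm (A - peval u p) <= e /\ opnorm (B - peval v p) <= e].

(** Errors up to a constant factor suffice, and [e <= 1] may be assumed; the latter bounds the
    approximants in the estimate for products. *)
Lemma colimit_scaled A B (c : R) : bounded_op A -> bounded_op B -> 0 <= c ->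
  (forall e : R, 0 < e -> e <= 1 -> exists p,
     opnorm (A - peval u p) <= e * c /\ opnorm (B - peval v p) <= e * c) ->
  colimit A B.
Proof.
move=> hA hB c0 h; split => // e e0.
have c1 : 0 < c + 1 by rewrite ltr_wpDl.
pose e' := Num.min (e / (c + 1)) 1.
have e'0 : 0 < e' by rewrite lt_min ltr01 divr_gt0.
have [|p [hp1 hp2]] := h e' e'0; first by rewrite ge_min lexx orbT.
have e'c : e' * c <= e.
  have h1 : e' <= e / (c + 1) by rewrite ge_min lexx.
  apply: le_trans (ler_wpM2r c0 h1) _.
  by rewrite -mulrA ler_piMr ?(ltW e0) // ler_pdivrMl // mulr1 lerDl.
by exists p; split; [exact: le_trans hp1 e'c | exact: le_trans hp2 e'c].
Qed.

Lemma colimitD A B A' B' : colimit A B -> colimit A' B' -> colimit (A + A') (B + B').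
Proof.
move=> [hA hB AB] [hA' hB' AB'].
apply: (@colimit_scaled _ _ 2); [exact: bopD|exact: bopD|by []|move=> e e0 _].
have [p [p1 p2]] := AB e e0; have [q [q1 q2]] := AB' e e0; exists (PAdd p q).
have hp := peval_bop ub p; have hp' := peval_bop vb p.
have hq := peval_bop ub q; have hq' := peval_bop vb q.
split; rewrite /= opprD addrACA.
  by apply: le_trans (opnormD (bopB hA hp) (bopB hA' hq)) _; lra.
by apply: le_trans (opnormD (bopB hB hp') (bopB hB' hq')) _; lra.
Qed.

Lemma colimitZ a A B : colimit A B -> colimit (a *: A) (a *: B).
Proof.
move=> [hA hB AB].
apply: (@colimit_scaled _ _ (cmod a)); [exact: bopZ|exact: bopZ|exact: cmod_ge0|move=> e e0 _].
have [p [p1 p2]] := AB e e0; exists (PScale a p).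
have hp := peval_bop ub p; have hp' := peval_bop vb p.
split; rewrite /= -scalerBr.
  by apply: le_trans (opnormZ _ (bopB hA hp)) _; rewrite mulrC ler_wpM2r ?cmod_ge0.
by apply: le_trans (opnormZ _ (bopB hB hp')) _; rewrite mulrC ler_wpM2r ?cmod_ge0.
Qed.

Lemma opnorm_prod_dist L (A A' P P' : L -> L) (e : R) : bounded_op A -> bounded_op A' ->
  bounded_op P -> bounded_op P' -> e <= 1 ->
  opnorm (A - P) <= e -> opnorm (A' - P') <= e ->
  opnorm ((A \o A') - (P \o P')) <= e * (opnorm A + opnorm A' + 1).
Proof.
move=> hA hA' hP hP' e1 AP AP'.
have -> : (A \o A') - (P \o P') = (A \o (A' - P')) + ((A - P) \o P').
  by apply/funext => x; rewrite !opE /= ?opE (linB (bop_lin hA)) addrA subrK.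
have hD := bopB hA hP; have hD' := bopB hA' hP'.
apply: le_trans (opnormD (bop_comp hA hD') (bop_comp hD hP')) _.
apply: le_trans (lerD (opnorm_comp hA hD') (opnorm_comp hD hP')) _.
have h1 := ler_wpM2l (opnorm_ge0 hA) AP'.
have h2 : opnorm P' <= opnorm A' + 1.
  by have := opnorm_dist hP' hA'; rewrite opnormB; lra.
have h3 : opnorm (A - P) * opnorm P' <= e * (opnorm A' + 1).
  by apply: ler_pM => //; exact: opnorm_ge0.
lra.
Qed.

Lemma colimit_comp A B A' B' : colimit A B -> colimit A' B' -> colimit (A \o A') (B \o B').
Proof.
move=> [hA hB AB] [hA' hB' AB'].
have nA := opnorm_ge0 hA; have nA' := opnorm_ge0 hA'.
have nB := opnorm_ge0 hB; have nB' := opnorm_ge0 hB'.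
apply: (@colimit_scaled _ _ ((opnorm A + opnorm A' + 1) + (opnorm B + opnorm B' + 1)));
  [exact: bop_comp|exact: bop_comp|by rewrite !addr_ge0|move=> e e0 e1].
have [p [p1 p2]] := AB e e0; have [q [q1 q2]] := AB' e e0; exists (PMul p q).
have hp := peval_bop ub p; have hp' := peval_bop vb p.
have hq := peval_bop ub q; have hq' := peval_bop vb q.
split.
  apply: le_trans (opnorm_prod_dist hA hA' hp hq e1 p1 q1) _.
  by rewrite ler_wpM2l ?(ltW e0) // lerDl !addr_ge0.
apply: le_trans (opnorm_prod_dist hB hB' hp' hq' e1 p2 q2) _.
by rewrite ler_wpM2l ?(ltW e0) // lerDr !addr_ge0.
Qed.

Lemma colimit_adj A B : colimit A B -> colimit (adj A) (adj B).
Proof.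
move=> [hA hB AB]; split; [exact: bop_adj|exact: bop_adj|move=> e e0].
have [p [p1 p2]] := AB e e0; exists (pstar p).
have hp := peval_bop ub p; have hp' := peval_bop vb p.
rewrite (peval_star ub) (peval_star vb) -(adjB hA hp) -(adjB hB hp').
split; first exact: le_trans (opnorm_adj (bopB hA hp)) p1.
exact: le_trans (opnorm_adj (bopB hB hp')) p2.
Qed.

Lemma colimit_peval p : colimit (peval u p) (peval v p).
Proof.
split; [exact: peval_bop|exact: peval_bop|move=> e e0].
by exists p; rewrite !subrr !opnorm0 ltW.
Qed.

Hypothesis v_le_u : forall p, opnorm (peval v p) <= opnorm (peval u p).

Lemma colimit_norm A B : colimit A B -> opnorm B <= opnorm A.
Proof.
move=> [hA hB AB]; apply: (@ler_eps_mul _ _ _ 2) => e e0.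
have [p [p1 p2]] := AB e e0; have := v_le_u p.
have hp := peval_bop ub p; have hp' := peval_bop vb p.
have := opnorm_dist hB hp'; have := opnorm_dist hp hA; rewrite (opnormB (peval u p)); lra.
Qed.

Lemma colimit_uniq A B B' : colimit A B -> colimit A B' -> B = B'.
Proof.
move=> AB AB'; have := colimitD AB (colimitZ (-1) AB'); rewrite !scaleN1r subrr.
move=> h; have := colimit_norm h; rewrite opnorm0 => h0; have [_ hB _] := h.
apply/eqP; rewrite -subr_eq0; apply/eqP; apply: (@opnorm_eps _ _ _ _ 0) => // e _.
by rewrite mulr0.
Qed.

(** Polynomials that converge at [u] are Cauchy at [v], since differences of polynomials are
    polynomials and their norms at [v] are dominated by those at [u]. *)
Lemma colimit_ex A : bounded_op A ->
  (forall e : R, 0 < e -> exists p, opnorm (A - peval u p) <= e) -> exists B, colimit A B.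
Proof.
move=> hA appr.
have [|||B hB BP] := @op_approx _ K K
    (fun e B => exists2 p, opnorm (A - peval u p) <= e & B = peval v p).
- by move=> e /appr[p pe]; exists (peval v p), p.
- by move=> e _ [p _ ->]; exact: peval_bop.
- move=> e e' _ _ [p pe ->] [q qe ->] x.
  have hp := peval_bop ub p; have hq := peval_bop ub q.
  rewrite -opBE -peval_sub; apply: le_trans (opnormP _ (peval_bop vb _)) _.
  rewrite ler_wpM2r ?rnorm_ge0 //; apply: le_trans (v_le_u _) _.
  rewrite peval_sub; have := opnorm_triangle hp hA hq.
  by rewrite (opnormB (peval u p) A); lra.
exists B; split => // e e0; have [p pe] := appr e e0; exists p; split => //.
apply: opnorm_le => [|x]; first exact: ltW.
by apply: BP; exists p.
Qed.

End Approximants.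

Lemma colimit_sym H K (u : 'I_d -> H -> H) (v : 'I_d -> K -> K) A B :
  colimit u v A B -> colimit v u B A.
Proof. by move=> [hA hB AB]; split=> // e /AB[p [p1 p2]]; exists p. Qed.

Section GeneratedAlgebra.
Variables (H : hilbert R) (u : 'I_d -> H -> H).
Hypothesis ub : forall i, bounded_op (u i).

Lemma Cstar_alg : Cstar_subalgebra (Cstar u).
Proof.
have sub S : Cstar_subalgebra S -> range u `<=` S -> Cstar u `<=` S.
  by move=> S_alg uS A; apply.
split.
- by apply: sub; [exact: bop_Cstar | move=> _ [i _ <-]].
- split=> [S [S_alg _]|A B hA hB S hS]; first exact: Cstar0.
  by case: (hS) => S_alg _; apply: CstarD; [|exact: hA|exact: hB].
- split=> [a A hA S hS|A B hA hB S hS]; case: (hS) => S_alg _.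
    by apply: CstarZ => //; exact: hA.
  by apply: Cstar_comp; [|exact: hA|exact: hB].
- move=> A B hA hB AB S hS; case: (hS) => -[_ _ _ h _] _.
  by apply: (h A) => //; exact: hA.
- move=> A hA appr S hS; case: (hS) => S_alg _; apply: (Cstar_closed S_alg) => // e /appr[B hB Be].
  by exists B => //; exact: hB.
Qed.

Lemma Cstar_gen i : Cstar u (u i).
Proof. by move=> S [_]; apply; exists i. Qed.

(** The limits of polynomials in [u] form a C*-subalgebra containing the generators; its closure
    properties are those of [colimit] for the pair [u], [u]. *)
Lemma Cstar_colimit A : Cstar u A -> colimit u u A A.
Proof.
move=> /(_ [set A | colimit u u A A]); apply; split; last first.
  by move=> _ [i _ <-]; exact: (colimit_peval ub ub (PVar i)).
split.
- by move=> B [].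
- split=> [|A' B]; last exact: colimitD.
  have := colimit_peval ub ub (PScale 0 POne); by rewrite /= scale0r.
- by split=> [a A' h|A' B]; [exact: colimitZ | exact: colimit_comp].
- by move=> A' B h hB; rewrite is_adjointE => [->|]; [exact: colimit_adj | case: h].
- move=> A' hA' appr; split=> // e e0.
  have e2 : 0 < e / 2 by rewrite divr_gt0.
  have [B [hB _ BP] Be] := appr _ e2; have [p [pe _]] := BP _ e2; exists p.
  by have := opnorm_triangle hA' hB (peval_bop ub p); split; lra.
Qed.

End GeneratedAlgebra.

Section NormComparison.
Variables (H K : hilbert R) (u : 'I_d -> H -> H) (v : 'I_d -> K -> K).
Hypotheses (ub : forall i, bounded_op (u i)) (vb : forall i, bounded_op (v i)).
Hypotheses (u1 : Cstar u idfun).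

Lemma Cstar_colimit_ex A : (forall p, opnorm (peval v p) <= opnorm (peval u p)) ->
  Cstar u A -> exists B, colimit u v A B.
Proof.
move=> v_le_u /(Cstar_colimit ub)[hA _ AP].
by apply: colimit_ex => // e /AP[p [pe _]]; exists p.
Qed.

(** A limit of polynomials at [u] is sent to the limit of the same polynomials at [v]. Domination of
    norms makes the second limit exist and depend on the first only, and the algebraic identities
    are the closure properties of [colimit]. *)
Lemma pnorm_rep : (forall p, opnorm (peval v p) <= opnorm (peval u p)) ->
  exists2 t : (H -> H) -> (K -> K), is_rep (Cstar u) t & forall i, t (u i) = v i.
Proof.
move=> v_le_u; have u_alg := Cstar_alg ub.
have ext A : exists B, Cstar u A -> colimit u v A B.
  have [uA|] := pselect (Cstar u A); last by exists 0.
  by have [B AB] := Cstar_colimit_ex v_le_u uA; exists B.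
have [t tP] := choice ext.
have tE A B : Cstar u A -> colimit u v A B -> t A = B.
  by move=> /tP h1; exact: colimit_uniq h1.
exists t => [|i]; last first.
  by apply: tE; [exact: Cstar_gen | exact: (colimit_peval ub vb (PVar i))].
split.
- by move=> A /tP[].
- split=> [A B uA uB|a A uA]; apply: tE.
  + exact: (CstarD u_alg).
  + by apply: colimitD => //; exact: tP.
  + exact: (CstarZ u_alg).
  + by apply: colimitZ => //; exact: tP.
- move=> A B uA uB; apply: tE; first exact: (Cstar_comp u_alg).
  by apply: colimit_comp => //; exact: tP.
- move=> A uA; apply: tE; first exact: (Cstar_adj u_alg).
  by apply: colimit_adj => //; exact: tP.
- by apply: tE => //; exact: (colimit_peval ub vb POne).
Qed.

End NormComparison.

Lemma peval_Cstar H (u : 'I_d -> H -> H) p : (forall i, bounded_op (u i)) ->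
  Cstar u idfun -> Cstar u (peval u p).
Proof.
move=> ub u1; have u_alg := Cstar_alg ub.
have id_rep : is_rep (Cstar u) id by split=> // A; exact: Cstar_bop.
by have [] := rep_peval p u_alg u1 id_rep (@Cstar_gen _ u).
Qed.

Lemma colimit_Cstar H K (u : 'I_d -> H -> H) (v : 'I_d -> K -> K) A B :
  (forall i, bounded_op (v i)) -> Cstar v idfun -> colimit u v A B -> Cstar v B.
Proof.
move=> vb v1 [_ hB AB]; apply: (Cstar_closed (Cstar_alg vb)) => // e e0.
have e2 : 0 < e / 2 by rewrite divr_gt0.
have [p [_ pe]] := AB _ e2.
by exists (peval v p); [exact: peval_Cstar | lra].
Qed.

(** With equal norms, passing to limits works in both directions, and [colimit] is symmetric.
    Uniqueness of limits gives injectivity, their existence surjectivity. *)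
Lemma pnorm_star_iso H K (u : 'I_d -> H -> H) (v : 'I_d -> K -> K) :
  (forall i, bounded_op (u i)) -> (forall i, bounded_op (v i)) ->
  Cstar u idfun -> Cstar v idfun ->
  (forall p, opnorm (peval v p) = opnorm (peval u p)) ->
  exists t, star_iso (Cstar u) (Cstar v) t /\ forall i, t (u i) = v i.
Proof.
move=> ub vb u1 v1 uv.
have vu p : opnorm (peval v p) <= opnorm (peval u p) by rewrite uv.
have uv' p : opnorm (peval u p) <= opnorm (peval v p) by rewrite uv.
have [t t_rep tu] := pnorm_rep ub vb u1 vu.
have tP A : Cstar u A -> colimit u v A (t A).
  move=> /(Cstar_colimit ub)[hA _ AP].
  have uA : Cstar u A by apply: (@colimit_Cstar H H u u A A ub u1); split.
  split=> // [|e /AP[p [pe _]]]; first exact: (rep_bop t_rep uA).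
  exists p; split=> //; have up := peval_Cstar p ub u1.
  have -> : peval v p = t (peval u p).
    have [_ ->] := rep_peval p (Cstar_alg ub) u1 t_rep (@Cstar_gen _ u).
    by congr (peval _ p); apply/funext => i.
  rewrite -(repB (Cstar_alg ub) t_rep uA up); apply: le_trans pe.
  exact: (rep_opnorm (Cstar_alg ub) u1 t_rep (CstarB (Cstar_alg ub) uA up)).
exists t; split=> //; split.
- split.
  + by move=> A uA; exact: (colimit_Cstar vb v1 (tP _ uA)).
  + move=> A B /set_mem uA /set_mem uB AB.
    have hA := colimit_sym (tP _ uA); have hB := colimit_sym (tP _ uB).
    by rewrite AB in hA; exact: (colimit_uniq vb ub uv' hA hB).
  + move=> B vB; have [A BA] := Cstar_colimit_ex vb ub uv' vB.
    have uA := colimit_Cstar ub u1 BA; exists A => //.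
    exact: (colimit_uniq ub vb vu (tP _ uA) (colimit_sym BA)).
- by move=> A B; exact: repD.
- by move=> a A; exact: repZ.
- by move=> A B; exact: rep_comp.
- move=> A B uA uB; have hA := Cstar_bop (Cstar_alg ub) uA.
  rewrite is_adjointE // => ->; rewrite (rep_adj t_rep uA).
  by apply/is_adjointE => //; exact: (rep_bop t_rep uA).
Qed.

(** * Equivalence through norms of polynomials *)

Section UnitaryTuples.
Hypothesis d_gt0 : (0 < d)%N.

Lemma ut_bop H (u : unitary_tuple d H) i : bounded_op (u i).
Proof. by have [] := utupleP u i. Qed.

Lemma ut_adjK H (u : unitary_tuple d H) i : adj (u i) \o u i = idfun.
Proof.
have [ub [V [Vb uV _ Vu]]] := utupleP u i.
by move/(is_adjointE _ ub): uV Vu => ->.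
Qed.

Lemma ut_adjKr H (u : unitary_tuple d H) i : u i \o adj (u i) = idfun.
Proof.
have [ub [V [Vb uV Vu _]]] := utupleP u i.
by move/(is_adjointE _ ub): uV Vu => ->.
Qed.

Lemma unitaryP H (U : H -> H) : bounded_op U -> adj U \o U = idfun -> U \o adj U = idfun ->
  unitary U.
Proof.
move=> Ub U1 U2; split=> //; exists (adj U); split=> //; first exact: bop_adj.
by move=> x y; exact: adjE.
Qed.

Lemma ut_isometry H (u : unitary_tuple d H) i : isometry (u i).
Proof.
have ub := ut_bop u i; split; first exact: bop_lin.
by move=> x y; rewrite adjE //; have := congr1 (fun f => f y) (ut_adjK u i) => /= ->.
Qed.

(** The identity arises as [u_i^* u_i]; this is where at least one unitary must be present. *)
Lemma ut_Cstar1 H (u : unitary_tuple d H) : Cstar u idfun.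
Proof.
have u_alg := Cstar_alg (ut_bop u); pose i := Ordinal d_gt0.
rewrite -(ut_adjK u i); apply: (Cstar_comp u_alg); last exact: Cstar_gen.
exact: (Cstar_adj u_alg (@Cstar_gen _ u i)).
Qed.

Lemma star_iso_inverse H K (S : set (H -> H)) (T : set (K -> K)) f :
  Cstar_subalgebra S -> star_iso S T f ->
  exists g, star_iso T S g /\ forall A, S A -> g (f A) = A.
Proof.
move=> S_alg [[fun_f inj_f surj_f] fD fZ fM fA].
have ex B : exists A, T B -> S A /\ f A = B.
  have [TB|] := pselect (T B); last by exists 0.
  by have [A SA AB] := surj_f B TB; exists A.
have [g gP] := choice ex.
have gS B (TB : T B) : S (g B) := (gP B TB).1.
have gK B (TB : T B) : f (g B) = B := (gP B TB).2.
have fT A (SA : S A) : T (f A) := fun_f A SA.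
have inj A B : S A -> S B -> f A = f B -> A = B.
  by move=> SA SB; apply: inj_f; exact: mem_set.
have gf A : S A -> g (f A) = A.
  by move=> SA; apply: inj => //; [exact: gS (fT _ SA) | exact: gK (fT _ SA)].
have TD A B (TA : T A) (TB : T B) : T (A + B).
  have := fT _ (CstarD S_alg (gS _ TA) (gS _ TB)).
  by rewrite (fD _ _ (gS _ TA) (gS _ TB)) (gK _ TA) (gK _ TB).
have TZ a A (TA : T A) : T (a *: A).
  have := fT _ (CstarZ S_alg a (gS _ TA)).
  by rewrite (fZ _ _ (gS _ TA)) (gK _ TA).
have TM A B (TA : T A) (TB : T B) : T (A \o B).
  have := fT _ (Cstar_comp S_alg (gS _ TA) (gS _ TB)).
  by rewrite (fM _ _ (gS _ TA) (gS _ TB)) (gK _ TA) (gK _ TB).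
exists g; split=> //; split.
- split=> [B TB|A B /set_mem TA /set_mem TB gAB|A SA]; first exact: gS.
    by rewrite -(gK _ TA) gAB (gK _ TB).
  by exists (f A); [exact: fT | exact: gf].
- move=> A B TA TB; have hA := gS _ TA; have hB := gS _ TB.
  apply: (inj _ _ (gS _ (TD _ _ TA TB)) (CstarD S_alg hA hB)).
  by rewrite (fD _ _ hA hB) (gK _ TA) (gK _ TB) (gK _ (TD _ _ TA TB)).
- move=> a A TA; have hA := gS _ TA.
  apply: (inj _ _ (gS _ (TZ a _ TA)) (CstarZ S_alg a hA)).
  by rewrite (fZ _ _ hA) (gK _ TA) (gK _ (TZ a _ TA)).
- move=> A B TA TB; have hA := gS _ TA; have hB := gS _ TB.
  apply: (inj _ _ (gS _ (TM _ _ TA TB)) (Cstar_comp S_alg hA hB)).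
  by rewrite (fM _ _ hA hB) (gK _ TA) (gK _ TB) (gK _ (TM _ _ TA TB)).
- move=> A B TA TB AB; have SgA := gS _ TA; have hgA := Cstar_bop S_alg SgA.
  apply/is_adjointE => //; apply: inj; [exact: gS|exact: Cstar_adj|].
  have h : is_adjoint A (f (adj (g A))).
    rewrite -{1}(gK _ TA); apply: fA => //; first exact: Cstar_adj.
    by apply/is_adjointE.
  rewrite gK //; apply/funext => x; apply: inner_extr => z.
  by rewrite -AB h.
Qed.

Lemma star_iso_is_rep H K (u : unitary_tuple d H) (v : unitary_tuple d K) t :
  star_iso (Cstar u) (Cstar v) t -> (forall i, t (u i) = v i) -> is_rep (Cstar u) t.
Proof.
move=> [[fun_t _ _] tD tZ tM tA] tu.
have u_alg := Cstar_alg (ut_bop u).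
have tadj A : Cstar u A -> t (adj A) = adj (t A).
  move=> uA; have hA := Cstar_bop u_alg uA; apply/is_adjointE.
    by have := fun_t _ uA; exact: (Cstar_bop (Cstar_alg (ut_bop v))).
  by apply: tA => //; [exact: (Cstar_adj u_alg uA) | exact/is_adjointE].
split=> //.
- by move=> A uA; have := fun_t _ uA; exact: (Cstar_bop (Cstar_alg (ut_bop v))).
- pose i := Ordinal d_gt0; have ui := @Cstar_gen _ u i.
  rewrite -(ut_adjK u i) (tM _ _ (Cstar_adj u_alg ui) ui) (tadj _ ui) tu.
  exact: ut_adjK.
Qed.

Lemma sim_reps H K (u : unitary_tuple d H) (v : unitary_tuple d K) : sim u v ->
  exists (t : (H -> H) -> (K -> K)) (t' : (K -> K) -> (H -> H)),
  [/\ is_rep (Cstar u) t /\ is_rep (Cstar v) t',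
      forall A, Cstar u A -> Cstar v (t A), forall B, Cstar v B -> Cstar u (t' B),
      (forall A, Cstar u A -> t' (t A) = A) /\ (forall B, Cstar v B -> t (t' B) = B) &
      forall i, t (u i) = v i].
Proof.
move=> [t [t_iso tu]]; have u_alg := Cstar_alg (ut_bop u).
have [t' [t'_iso t't]] := star_iso_inverse u_alg t_iso.
have t'v i : t' (v i) = u i by rewrite -tu t't //; exact: Cstar_gen.
have [[fun_t _ _] _ _ _ _] := t_iso; have [[fun_t' inj_t' _] _ _ _ _] := t'_iso.
exists t, t'; split=> //.
  by split; [exact: (star_iso_is_rep t_iso) | exact: (star_iso_is_rep t'_iso)].
split=> // B vB; have ut'B := fun_t' _ vB; have vtt'B := fun_t _ ut'B.
by apply: inj_t'; [exact: mem_set | exact: mem_set | rewrite t't].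
Qed.

Lemma sim_opnorm_le H K (u : unitary_tuple d H) (v : unitary_tuple d K) p : sim u v ->
  opnorm (peval v p) <= opnorm (peval u p).
Proof.
move=> /sim_reps[t [_ [[t_rep _] _ _ _ tu]]].
have u_alg := Cstar_alg (ut_bop u); have u1 := @ut_Cstar1 _ u.
have [up tp] := rep_peval p u_alg u1 t_rep (@Cstar_gen _ u).
have -> : peval v p = t (peval u p).
  by rewrite tp; congr (peval _ p); apply/funext.
exact: (rep_opnorm u_alg u1 t_rep up).
Qed.

Lemma sim_sym H K (u : unitary_tuple d H) (v : unitary_tuple d K) : sim u v -> sim v u.
Proof.
move=> [t [t_iso tu]].
have [g [g_iso gt]] := star_iso_inverse (Cstar_alg (ut_bop u)) t_iso.
by exists g; split=> // i; rewrite -tu gt //; exact: Cstar_gen.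
Qed.

(* Injective *-homomorphisms are isometric. *)
Theorem simP H K (u : unitary_tuple d H) (v : unitary_tuple d K) :
  sim u v <-> forall p, opnorm (peval u p) = opnorm (peval v p).
Proof.
split=> [uv p|uv].
  by apply/le_anti; rewrite !sim_opnorm_le //; exact: sim_sym.
by apply: pnorm_star_iso => //; [exact: ut_bop|exact: ut_bop|exact: ut_Cstar1|exact: ut_Cstar1].
Qed.

Lemma sim_refl H (u : unitary_tuple d H) : sim u u.
Proof. by apply/simP. Qed.

Lemma sim_trans H K L (u : unitary_tuple d H) (v : unitary_tuple d K)
  (w : unitary_tuple d L) : sim u v -> sim v w -> sim u w.
Proof. by move=> /simP uv /simP vw; apply/simP => p; rewrite uv vw. Qed.

End UnitaryTuples.
End Polynomials.

(** * Amalgamation of representations *)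

Section RepresentationSums.
Variable R : realType.
Implicit Types H K L M N : hilbert R.

(** The blocks [s i D] are uniformly bounded by [opnorm D] because representations are contractive,
    so infinitely many of them can be summed. *)
Lemma orth_rep H (I : eqType) (M : I -> hilbert R) L (g : forall i, M i -> L)
    (s : forall i, (H -> H) -> (M i -> M i)) :
  orth_family g -> (forall i, is_rep (@bounded_op R H H) (s i)) ->
  exists2 r : (H -> H) -> (L -> L), is_rep (@bounded_op R H H) r &
    forall i D (x : M i), bounded_op D -> r D (g i x) = g i (s i D x).
Proof.
move=> g_orth s_rep; have [gi go gt] := g_orth; have H_alg := @bop_Cstar R H.
have ext D : exists T : L -> L, bounded_op D ->
    bounded_op T /\ forall i x, T (g i x) = g i (s i D x).
  have [hD|] := pselect (bounded_op D); last by exists 0.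
  have [|||T Tb TE] := orth_family_op g_orth (D := fun i => s i D) (r := opnorm D).
  - by move=> i; exact: (rep_bop (s_rep i) hD).
  - by move=> i; exact: (rep_opnorm H_alg (@bop_id R H) (s_rep i) hD).
  - exact: opnorm_ge0.
  - by exists T.
have [r rP] := choice ext.
have rb D (hD : bounded_op D) : bounded_op (r D) := (rP D hD).1.
have rE D (hD : bounded_op D) i x : r D (g i x) = g i (s i D x) := (rP D hD).2 i x.
exists r => [|i D x hD]; last exact: rE.
split.
- exact: rb.
- split=> [A B hA hB|a A hA].
    have hAB := bopD hA hB.
    apply: (total_ext gt); [exact: rb|by apply: bopD; exact: rb|move=> [i x]].
    by rewrite opE !rE //= (repD (s_rep i) hA hB) opE (linD (proj1 (gi i))).
  have haA := bopZ a hA.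
  apply: (total_ext gt); [exact: rb|by apply: bopZ; exact: rb|move=> [i x]].
  by rewrite opE !rE //= (repZ (s_rep i) _ hA) opE (linZ (proj1 (gi i))).
- move=> A B hA hB; have hAB := bop_comp hA hB.
  apply: (total_ext gt); [exact: rb|by apply: bop_comp; exact: rb|move=> [i x]] => /=.
  by rewrite !rE // (rep_comp (s_rep i) hA hB).
- move=> A hA; have hAa := bop_adj hA.
  apply: (total_ext gt); [exact: rb|by apply: bop_adj; exact: rb|move=> [i x] /=].
  rewrite rE //; apply: (total_eq gt) => -[k y] /=.
  rewrite (adjEr _ _ (rb _ hA)) rE //.
  have [ik|ik] := eqVneq i k; last by rewrite !go.
  case: _ / ik y => y; have [_ gin] := gi i; rewrite !gin.
  by rewrite (rep_adj (s_rep i) hA) adjEr //; exact: (rep_bop (s_rep i) hA).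
- apply: (total_ext gt); [by apply: rb; exact: bop_id|exact: bop_id|move=> [i x] /=].
  by rewrite rE; [rewrite (rep_id (s_rep i)) | exact: bop_id].
Qed.

Lemma rep_comp_rep H K N (S : set (H -> H)) (T : set (K -> K))
    (f : (H -> H) -> (K -> K)) (t : (K -> K) -> (N -> N)) :
  Cstar_subalgebra S ->
  is_rep S f -> (forall A, S A -> T (f A)) -> is_rep T t -> is_rep S (fun A => t (f A)).
Proof.
move=> S_alg f_rep fT t_rep; split.
- by move=> A SA; apply: (rep_bop t_rep); exact: fT.
- split=> [A B SA SB|a A SA].
    by rewrite (repD f_rep SA SB) (repD t_rep) //; exact: fT.
  by rewrite (repZ f_rep _ SA) (repZ t_rep) //; exact: fT.
- by move=> A B SA SB; rewrite (rep_comp f_rep SA SB) (rep_comp t_rep (fT _ SA) (fT _ SB)).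
- by move=> A SA; rewrite (rep_adj f_rep SA) (rep_adj t_rep (fT _ SA)).
- by rewrite (rep_id f_rep) (rep_id t_rep).
Qed.

(** The complement is the kernel space of [<P x, P y>] with [P = 1 - j j^*]. Its canonical map [f]
    satisfies [f^* f = P] and [f f^* = 1], so [f^*] is the required isometry. *)
Lemma complement_isometry N M (j : N -> M) : isometry j ->
  exists (N' : hilbert R) (j' : N' -> M),
    [/\ isometry j', forall y, adj j (j' y) = 0 &
        forall z, j (adj j z) + j' (adj j' z) = z].
Proof.
move=> j_iso; have jb := isometry_bop j_iso; have jab := bop_adj jb.
pose P z := z - j (adj j z).
have Pb : bounded_op P by apply: (bopB (@bop_id R M)); exact: bop_comp.
have Pl := bop_lin Pb.
have Pj z x : inner M (P z) (j x) = 0.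
  by rewrite innerBl (proj2 j_iso) adjEr // subrr.
have jP x : P (j x) = 0 by rewrite /P isometry_adjK // subrr.
have PP z w : inner M (P z) (P w) = inner M (P z) w by rewrite innerBr Pj subr0.
have [N' [f [fP f_total]]] := kernel_hilbert (psd_inner P).
have fl : linear f.
  move=> a x y; apply: (total_eq f_total) => z.
  by rewrite innerDl innerZl !fP Pl innerDl innerZl.
have fb : bounded_op f.
  apply: (linear_bop (r := opnorm P) fl) => z; apply: le_trans (opnormP z Pb).
  by rewrite -(@ler_pXn2r _ 2) ?nnegrE ?rnorm_ge0 // !rnorm_sqr fP.
have fj x : f (j x) = 0.
  by apply: (total_eq f_total) => z; rewrite fP jP !inner0l.
have afj y x : inner M (adj f y) (j x) = 0 by rewrite adjEr // fj inner0r.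
have aff z : adj f (f z) = P z.
  by apply: inner_ext => w; rewrite adjEr // fP PP.
have ffa y : f (adj f y) = y.
  apply: (total_eq f_total) => w; rewrite (adjE _ _ fb) aff innerBr afj subr0.
  by rewrite adjEr.
have fab := bop_adj fb.
exists N', (adj f); split=> [|y|z].
- split; first exact: bop_lin.
  by move=> x y; rewrite adjEr // ffa.
- by apply: inner_ext => x; rewrite adjEr // inner0l afj.
- by rewrite (adjK fb) aff addrC subrK.
Qed.

(* Besides extending [t] to B(K), record the representation on the complement. *)
Lemma rep_step H K N (S : set (H -> H)) (T : set (K -> K))
    (e : (H -> H) -> (K -> K)) (e' : (K -> K) -> (H -> H)) (t : (H -> H) -> (N -> N)) :
  Cstar_subalgebra S -> S idfun -> Cstar_subalgebra T -> T idfun ->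
  is_rep S e -> (forall A, S A -> T (e A)) ->
  is_rep T e' -> (forall B, T B -> S (e' B)) -> (forall A, S A -> e' (e A) = A) ->
  is_rep S t ->
  exists (M : hilbert R) (s : (K -> K) -> (M -> M)) (j : N -> M)
    (N' : hilbert R) (j' : N' -> M) (t' : (H -> H) -> (N' -> N')),
    [/\ is_rep (@bounded_op R K K) s, is_rep S t',
        [/\ isometry j, isometry j', forall y, adj j (j' y) = 0 &
            forall z, j (adj j z) + j' (adj j' z) = z],
        forall A x, S A -> s (e A) (j x) = j (t A x) &
        forall A y, S A -> s (e A) (j' y) = j' (t' A y)].
Proof.
move=> S_alg S1 T_alg T1 e_rep eT e'_rep e'S e'e t_rep.
have te_rep := rep_comp_rep T_alg e'_rep e'S t_rep.
have [M [s [j [s_rep j_iso sj]]]] := rep_extension T_alg T1 te_rep.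
have [N' [j' [j'_iso jj' jj'E]]] := complement_isometry j_iso.
have {}sj A x : S A -> s (e A) (j x) = j (t A x).
  by move=> SA; rewrite sj ?e'e //; exact: eT.
have eb A : S A -> bounded_op (e A) := rep_bop e_rep (A := A).
have sb A : S A -> bounded_op (s (e A)) by move=> SA; exact: (rep_bop s_rep (eb _ SA)).
have jb := isometry_bop j_iso; have j'b := isometry_bop j'_iso.
have j'ab := bop_adj j'b.
have sadj A : S A -> s (e (adj A)) = adj (s (e A)).
  by move=> SA; rewrite (rep_adj e_rep SA) (rep_adj s_rep (eb _ SA)).
pose t' A : N' -> N' := (adj j' \o s (e A)) \o j'.
(* The complement is invariant because [range j] is invariant under the adjoints too. *)
have sj' A y : S A -> s (e A) (j' y) = j' (t' A y).
  move=> SA; rewrite -[LHS]jj'E.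
  suff -> : adj j (s (e A) (j' y)) = 0 by rewrite (lin0 (bop_lin jb)) add0r.
  apply: inner_ext => x; rewrite adjEr // inner0l -(adjK (sb _ SA)) -sadj //.
  rewrite adjEr; last exact: (sb _ (Cstar_adj S_alg SA)).
  by rewrite sj; [rewrite -adjEr // jj' inner0l | exact: Cstar_adj].
have j'inj x y : j' x = j' y -> x = y.
  by move=> /(congr1 (adj j')); rewrite !isometry_adjK.
exists M, s, j, N', j', t'; split=> //; split.
- by move=> A SA; apply: bop_comp => //; apply: bop_comp => //; exact: sb.
- split=> [A B SA SB|a A SA]; apply/funext => y; apply: j'inj.
    rewrite opE (linD (bop_lin j'b)) -!sj' //; last exact: CstarD.
    by rewrite (repD e_rep SA SB) (repD s_rep (eb _ SA) (eb _ SB)).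
  rewrite opE (linZ (bop_lin j'b)) -!sj' //; last exact: CstarZ.
  by rewrite (repZ e_rep _ SA) (repZ s_rep _ (eb _ SA)).
- move=> A B SA SB; apply/funext => y; apply: j'inj.
  rewrite /= -sj'; last exact: Cstar_comp.
  rewrite (rep_comp e_rep SA SB) (rep_comp s_rep (eb _ SA) (eb _ SB)) /=.
  by rewrite (sj' B) // (sj' A).
- move=> A SA; rewrite /t' (adj_comp (bop_comp j'ab (sb _ SA)) j'b).
  by rewrite (adj_comp j'ab (sb _ SA)) (adjK j'b) sadj.
- apply/funext => y; apply: j'inj; rewrite -sj' // (rep_id e_rep) (rep_id s_rep).
  by [].
Qed.

End RepresentationSums.

Section Glue.
Variables (R : realType) (M N N' L : hilbert R).
Variables (j : N -> M) (j' : N' -> M) (h : N -> L) (h' : N' -> L).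
Hypotheses (jP : [/\ isometry j, isometry j', forall y, adj j (j' y) = 0 &
  forall z, j (adj j z) + j' (adj j' z) = z]).
Hypotheses (h_iso : isometry h) (h'_iso : isometry h').

(** The decomposition of [M] given by [jP] is transplanted into [L]; with orthogonal ranges of [h]
    and [h'] this is an isometry. *)
Definition glue (z : M) : L := h (adj j z) + h' (adj j' z).

Lemma glue_in x : glue (j x) = h x.
Proof.
have [ji j'i jj' _] := jP; rewrite /glue isometry_adjK //.
have -> : adj j' (j x) = 0.
  apply: inner_ext => y; rewrite adjEr ?inner0l; last exact: isometry_bop.
  by rewrite (adjE _ _ (isometry_bop ji)) jj' inner0r.
by rewrite (lin0 (proj1 h'_iso)) addr0.
Qed.

Lemma glue_in' y : glue (j' y) = h' y.
Proof.
have [ji j'i jj' _] := jP.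
by rewrite /glue jj' isometry_adjK // (lin0 (proj1 h_iso)) add0r.
Qed.

Lemma glue_isometry : (forall x y, inner L (h x) (h' y) = 0) -> isometry glue.
Proof.
move=> hh'; have [ji j'i _ jj'] := jP.
have jb := isometry_bop ji; have j'b := isometry_bop j'i.
have h'h x y : inner L (h' y) (h x) = 0 by rewrite innerC hh' conjc0.
apply: inner_preserving_isometry => z w; rewrite /glue !innerDl !innerDr.
rewrite hh' h'h (proj2 h_iso) (proj2 h'_iso) add0r addr0.
by rewrite !adjEr // -[in RHS](jj' w) innerDr.
Qed.

End Glue.

(** * Amalgamation by alternating enlargement *)

Section Amalgamation.
Variables (R : realType) (H K : hilbert R) (S : set (H -> H)) (T : set (K -> K)).
Variables (e : (H -> H) -> (K -> K)) (e' : (K -> K) -> (H -> H)).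
Hypotheses (S_alg : Cstar_subalgebra S) (S1 : S idfun).
Hypotheses (T_alg : Cstar_subalgebra T) (T1 : T idfun).
Hypotheses (e_rep : is_rep S e) (eT : forall A, S A -> T (e A)).
Hypotheses (e'_rep : is_rep T e') (e'S : forall B, T B -> S (e' B)).
Hypothesis e'e : forall A, S A -> e' (e A) = A.

Record module := Module {
  mod_space : hilbert R;
  mod_rep : (H -> H) -> (mod_space -> mod_space);
  mod_repP : is_rep S mod_rep }.
Arguments mod_rep : clear implicits.

(** With [S] mapped into B(L) by [f], the module [n] sits in a B(L)-module whose remaining part
    [ext_next] is a module over [S] again. Keeping that part as a module is what allows the
    construction to be iterated. *)
Record extension (L : hilbert R) (f : (H -> H) -> (L -> L)) (n : module) := Extension {
  ext_space : hilbert R;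
  ext_rep : (L -> L) -> (ext_space -> ext_space);
  ext_in : mod_space n -> ext_space;
  ext_next : module;
  ext_in' : mod_space ext_next -> ext_space;
  ext_repP : is_rep (@bounded_op R L L) ext_rep;
  ext_inP : [/\ isometry ext_in, isometry ext_in', forall y, adj ext_in (ext_in' y) = 0 &
    forall z, ext_in (adj ext_in z) + ext_in' (adj ext_in' z) = z];
  ext_inE : forall A x, S A -> ext_rep (f A) (ext_in x) = ext_in (mod_rep n A x);
  ext_in'E : forall A y, S A ->
    ext_rep (f A) (ext_in' y) = ext_in' (mod_rep ext_next A y) }.

Arguments ext_in {L f n}.
Arguments ext_in' {L f n}.
Arguments ext_rep {L f n}.

Lemma extension_ex (L : hilbert R) (f : (H -> H) -> (L -> L)) (n : module) U f' :
  Cstar_subalgebra U -> U idfun -> is_rep S f -> (forall A, S A -> U (f A)) ->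
  is_rep U f' -> (forall B, U B -> S (f' B)) -> (forall A, S A -> f' (f A) = A) ->
  exists _ : extension f n, True.
Proof.
move=> U_alg U1 f_rep fU f'_rep f'S f'f.
have [M [s [j [N' [j' [t' [s_rep t'_rep jP sj sj']]]]]]] :=
  rep_step S_alg S1 U_alg U1 f_rep fU f'_rep f'S f'f (mod_repP n).
by exists (@Extension _ _ n M s j (Module t'_rep) j' s_rep jP sj sj').
Qed.

Let extA_ex n : exists _ : extension (fun A : H -> H => A) n, True.
Proof.
have id_rep : is_rep S (fun A : H -> H => A) by split=> // A; exact: Cstar_bop.
exact: (extension_ex n S_alg S1 id_rep (fun _ h => h) id_rep).
Qed.

Let extB_ex n : exists _ : extension e n, True.
Proof. exact: (extension_ex n T_alg T1 e_rep eT e'_rep). Qed.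

Let extA n := sval (cid (extA_ex n)).
Let extB n := sval (cid (extB_ex n)).

(** The pieces [md k] and [md' k] together form a B(H)-module, while [md' k] and [md k.+1] form a
    B(K)-module; [md 0] is K, a B(K)-module by itself. So one family of pieces is exhausted by both
    pairings. *)
Let md := fix md (k : nat) : module :=
  if k is l.+1 then ext_next (extB (ext_next (extA (md l)))) else Module e_rep.

Let md' k := ext_next (extA (md k)).

Let piece (i : nat * bool) : hilbert R :=
  mod_space (if i.2 then md' i.1 else md i.1).

(* A module over S that is a B(K)-module at the start is enlarged alternately to a
   B(H)-module and to a B(K)-module.  The sum of all the complements arising in this
   way is a module over both algebras at once. *)
Theorem amalgam_half : exists (L : hilbert R) (r : (H -> H) -> (L -> L))
    (r' : (K -> K) -> (L -> L)) (j : K -> L),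
  [/\ is_rep (@bounded_op R H H) r, is_rep (@bounded_op R K K) r',
      forall A, S A -> r A = r' (e A), isometry j &
      forall B x, bounded_op B -> r' B (j x) = j (B x)].
Proof.
have [L [g g_orth]] := direct_sum piece.
have [gi go gt] := g_orth.
pose g0 k : mod_space (md k) -> L := g (k, false).
pose g1 k : mod_space (md' k) -> L := g (k, true).
have g0i k : isometry (g0 k) := gi (k, false).
have g1i k : isometry (g1 k) := gi (k, true).
have g01 k l x y : inner L (g0 k x) (g1 l y) = 0.
  by apply: (go (k, false) (l, true)); rewrite xpair_eqE andbF.
have g10 k l x y : inner L (g1 k x) (g0 l y) = 0.
  by apply: (go (k, true) (l, false)); rewrite xpair_eqE andbF.
have g00 k l x y : k != l -> inner L (g0 k x) (g0 l y) = 0.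
  by move=> kl; apply: (go (k, false) (l, false)); rewrite xpair_eqE andbT.
have g11 k l x y : k != l -> inner L (g1 k x) (g1 l y) = 0.
  by move=> kl; apply: (go (k, true) (l, true)); rewrite xpair_eqE andbT.
have g_ext z : (forall k x, inner L z (g0 k x) = 0) ->
    (forall k x, inner L z (g1 k x) = 0) -> z = 0.
  by move=> z0 z1; apply: gt => -[[k [] x]]; [exact: z1 | exact: z0].
pose EA k := extA (md k); pose EB k := extB (md' k).
pose hA k : ext_space (EA k) -> L :=
  glue (ext_in (EA k)) (ext_in' (EA k)) (g0 k) (g1 k).
pose hB k : ext_space (EB k) -> L :=
  glue (ext_in (EB k)) (ext_in' (EB k)) (g1 k) (g0 k.+1).
have hA0 k x : hA k (ext_in (EA k) x) = g0 k x.
  exact: (glue_in (g0 k) (ext_inP (EA k)) (g1i k)).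
have hA1 k x : hA k (ext_in' (EA k) x) = g1 k x.
  exact: (glue_in' (g1 k) (ext_inP (EA k)) (g0i k)).
have hB0 k x : hB k (ext_in (EB k) x) = g1 k x.
  exact: (glue_in (g1 k) (ext_inP (EB k)) (g0i k.+1)).
have hB1 k x : hB k (ext_in' (EB k) x) = g0 k.+1 x.
  exact: (glue_in' (g0 k.+1) (ext_inP (EB k)) (g1i k)).
have hA_orth : orth_family hA.
  split=> [k|k l x y kl|z hz].
  - exact: (glue_isometry (ext_inP (EA k)) (g0i k) (g1i k)).
  - by rewrite /hA /glue !innerDl !innerDr g01 g10 g00 ?g11 // !addr0.
  apply: g_ext => k x; first by rewrite -hA0; exact: (hz (Tagged _ _)).
  by rewrite -hA1; exact: (hz (Tagged _ _)).
(* In the pairing for B(K) the first piece remains single and is indexed by [None]; it carries the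
   identity representation. *)
pose MB (o : option nat) : hilbert R := if o is Some k then ext_space (EB k) else K.
pose hB' (o : option nat) : MB o -> L :=
  match o return MB o -> L with Some k => hB k | None => g0 0%N end.
pose sB (o : option nat) : (K -> K) -> (MB o -> MB o) :=
  match o return (K -> K) -> (MB o -> MB o) with
  | Some k => ext_rep (EB k) | None => fun B => B end.
have hB_orth : orth_family hB'.
  split=> [[k|]|[k|] [l|] x y kl //|z hz] /=.
  - exact: (glue_isometry (ext_inP (EB k)) (g1i k) (g0i k.+1)).
  - exact: (g0i 0%N).
  - have {}kl : k != l by apply: contra_neq kl => ->.
    by rewrite /hB /glue !innerDl !innerDr g01 g10 g00 ?g11 // !addr0.
  - by rewrite /hB /glue innerDl g10 g00 // addr0.
  - by rewrite /hB /glue innerDr g01 g00 // addr0.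
  apply: g_ext => [[|k] x|k x].
  - exact: (hz (Tagged MB (x : MB None))).
  - by rewrite -hB1; exact: (hz (Tagged MB (_ : MB (Some k)))).
  - by rewrite -hB0; exact: (hz (Tagged MB (_ : MB (Some k)))).
have [r r_rep rE] := orth_rep hA_orth (fun k => ext_repP (EA k)).
have [r' r'_rep r'E] : exists2 r' : (K -> K) -> (L -> L), is_rep (@bounded_op R K K) r' &
    forall o D (x : MB o), bounded_op D -> r' D (hB' o x) = hB' o (sB o D x).
  apply: (orth_rep hB_orth) => -[k|]; first exact: ext_repP.
  by split.
have Sb A : S A -> bounded_op A := @Cstar_bop _ _ _ S_alg A.
have eb A : S A -> bounded_op (e A) := rep_bop e_rep (A := A).
exists L, r, r', (g0 0%N); split => // [A SA||B x hB0'].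
- have rg0 k x : r A (g0 k x) = g0 k (mod_rep (md k) A x).
    by rewrite -[in LHS]hA0 rE ?ext_inE ?hA0 //; exact: Sb.
  have rg1 k x : r A (g1 k x) = g1 k (mod_rep (md' k) A x).
    by rewrite -[in LHS]hA1 rE ?ext_in'E ?hA1 //; exact: Sb.
  apply: (total_ext gt); [exact: (rep_bop r_rep (Sb _ SA))|exact: (rep_bop r'_rep (eb _ SA))|].
  case=> -[k []] x /=.
    rewrite [LHS](rg1 k x).
    have -> : g (k, true) x = hB' (Some k) (ext_in (EB k) x) by rewrite /= hB0.
    by rewrite r'E /= ?ext_inE ?hB0 //; exact: eb.
  rewrite [LHS](rg0 k x); case: k x => [|k] x.
    by rewrite [RHS](r'E None); [|exact: eb].
  have -> : g (k.+1, false) x = hB' (Some k) (ext_in' (EB k) x) by rewrite /= hB1.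
  by rewrite r'E /= ?ext_in'E ?hB1 //; exact: eb.
- exact: (g0i 0%N).
- exact: (r'E None).
Qed.

End Amalgamation.

Section Amalgam.
Variables (R : realType) (d : nat) (d_gt0 : (0 < d)%N).
Implicit Types H K L M N : hilbert R.

(** [amalgam_half] contains the identity representation of B(K) only, and so guarantees isometry
    there only. The sum of the two halves, with the roles of [u] and [v] exchanged, is isometric on
    both algebras. *)
Theorem amalgam H K (u : unitary_tuple d H) (v : unitary_tuple d K) : sim u v ->
  exists (L : hilbert R) (r : (H -> H) -> (L -> L)) (r' : (K -> K) -> (L -> L)),
  [/\ is_rep (@bounded_op R H H) r, is_rep (@bounded_op R K K) r',
      forall i, r (u i) = r' (v i),
      forall A, bounded_op A -> opnorm (r A) = opnorm A &
      forall B, bounded_op B -> opnorm (r' B) = opnorm B].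
Proof.
move=> /(sim_reps d_gt0)[e [e' [[e_rep e'_rep] eT e'S [e'e ee'] eu]]].
have u_alg := Cstar_alg (ut_bop u); have v_alg := Cstar_alg (ut_bop v).
have u1 := @ut_Cstar1 _ _ d_gt0 _ u; have v1 := @ut_Cstar1 _ _ d_gt0 _ v.
have [L1 [r1 [r1' [j1 [r1_rep r1'_rep r1E j1_iso r1'j]]]]] :=
  amalgam_half u_alg u1 v_alg v1 e_rep eT e'_rep e'S e'e.
have [L2 [r2 [r2' [j2 [r2_rep r2'_rep r2E j2_iso r2'j]]]]] :=
  amalgam_half v_alg v1 u_alg u1 e'_rep e'S e_rep eT ee'.
pose M (b : bool) := if b then L1 else L2.
have [L [g g_orth]] := direct_sum M; have [gi go gt] := g_orth.
pose s (b : bool) : (H -> H) -> (M b -> M b) :=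
  if b as b return (H -> H) -> (M b -> M b) then r1 else r2'.
pose s' (b : bool) : (K -> K) -> (M b -> M b) :=
  if b as b return (K -> K) -> (M b -> M b) then r1' else r2.
have [r r_rep rE] : exists2 r : (H -> H) -> (L -> L), is_rep (@bounded_op R H H) r &
    forall b D (x : M b), bounded_op D -> r D (g b x) = g b (s b D x).
  by apply: (orth_rep g_orth) => -[].
have [r' r'_rep r'E] : exists2 r' : (K -> K) -> (L -> L), is_rep (@bounded_op R K K) r' &
    forall b D (x : M b), bounded_op D -> r' D (g b x) = g b (s' b D x).
  by apply: (orth_rep g_orth) => -[].
have ub := ut_bop u; have vb := ut_bop v.
exists L, r, r'; split => // [i|A hA|B hB].
- apply: (total_ext gt); [exact: (rep_bop r_rep (ub i))|exact: (rep_bop r'_rep (vb i))|].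
  have ui : Cstar u (u i) := @Cstar_gen _ _ _ u i.
  have vi : Cstar v (v i) := @Cstar_gen _ _ _ v i.
  move=> [[] x]; rewrite rE ?r'E //=.
    by rewrite r1E // eu.
  by rewrite r2E // -eu e'e.
- apply/le_anti; rewrite (rep_opnorm (bop_Cstar H) (@bop_id R H) r_rep hA) /=.
  apply: opnorm_le => [|x]; first exact: (opnorm_ge0 (rep_bop r_rep hA)).
  have := opnormP (g false (j2 x)) (rep_bop r_rep hA).
  by rewrite rE //= r2'j // !(isometry_rnorm _ (gi _)) !(isometry_rnorm _ j2_iso).
- apply/le_anti; rewrite (rep_opnorm (bop_Cstar K) (@bop_id R K) r'_rep hB) /=.
  apply: opnorm_le => [|x]; first exact: (opnorm_ge0 (rep_bop r'_rep hB)).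
  have := opnormP (g true (j1 x)) (rep_bop r'_rep hB).
  by rewrite r'E //= r1'j // !(isometry_rnorm _ (gi _)) !(isometry_rnorm _ j1_iso).
Qed.

Lemma rep_unitary_tuple H L (r : (H -> H) -> (L -> L)) (u : unitary_tuple d H) :
  is_rep (@bounded_op R H H) r ->
  exists w : unitary_tuple d L, forall i, w i = r (u i).
Proof.
move=> r_rep; have ub := ut_bop u.
have ru i : unitary (r (u i)).
  have hu := bop_adj (ub i).
  apply: unitaryP; first exact: (rep_bop r_rep (ub i)).
    by rewrite -(rep_adj r_rep (ub i)) -(rep_comp r_rep hu (ub i)) ut_adjK (rep_id r_rep).
  by rewrite -(rep_adj r_rep (ub i)) -(rep_comp r_rep (ub i) hu) ut_adjKr (rep_id r_rep).
by exists (UnitaryTuple ru).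
Qed.

Lemma rep_peval_tuple H L (r : (H -> H) -> (L -> L)) (u : unitary_tuple d H)
    (w : unitary_tuple d L) p :
  is_rep (@bounded_op R H H) r -> (forall i, w i = r (u i)) ->
  peval w p = r (peval u p).
Proof.
move=> r_rep wr.
have [_ ->] := rep_peval p (bop_Cstar H) (@bop_id R H) r_rep (ut_bop u).
by congr (peval _ p); apply/funext => i; rewrite wr.
Qed.

End Amalgam.

(** * Approximate intertwining and norms of polynomials *)

Section ApproximateIntertwining.
Variables (R : realType) (d : nat).
Implicit Types H K L M N : hilbert R.

Lemma opnorm_ut H (u : unitary_tuple d H) i : opnorm (u i) <= 1.
Proof.
apply: opnorm_le => // x; rewrite mul1r isometry_rnorm //; exact: ut_isometry.
Qed.

Lemma peval_norm_bound (p : starpoly R d) : exists2 B : R, 0 <= B &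
  forall H (u : unitary_tuple d H) x, rnorm (peval u p x) <= B * rnorm x.
Proof.
elim: p => [i|i||p [B B0 hB] q [C C0 hC]|a p [B B0 hB]|p [B B0 hB] q [C C0 hC]].
- exists 1 => // H u x; rewrite mul1r /= isometry_rnorm //; exact: ut_isometry.
- exists 1 => // H u x; apply: le_trans (rnorm_adj _ (ut_bop u i)) _.
  by rewrite ler_wpM2r ?rnorm_ge0 ?opnorm_ut.
- by exists 1 => // H u x; rewrite mul1r.
- exists (B + C); first exact: addr_ge0.
  by move=> H u x; rewrite mulrDl; apply: le_trans (rnormD _ _) (lerD _ _).
- exists (cmod a * B); first by rewrite mulr_ge0 ?cmod_ge0.
  by move=> H u x; rewrite /= opZE rnormZ -mulrA ler_wpM2l ?cmod_ge0.
- exists (B * C); first exact: mulr_ge0.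
  move=> H u x; apply: le_trans (hB _ _ _) _; rewrite -mulrA.
  by rewrite ler_wpM2l.
Qed.

(* [l] lists the vectors met while evaluating [p] at [u] on [x]. *)
Lemma peval_trace (p : starpoly R d) : exists C D : R, [/\ 0 <= C, 0 <= D &
  forall H (u : unitary_tuple d H) x, exists2 l : seq H,
    forall y, y \in l -> rnorm y <= D * rnorm x &
    forall K (V : unitary_tuple d K) (j : H -> K) (e : R), linear j -> 0 <= e ->
      (forall i y, y \in l -> rnorm (V i (j y) - j (u i y)) <= e) ->
      rnorm (peval V p (j x) - j (peval u p x)) <= C * e].
Proof.
elim: p => [i|i||p [C [D [C0 D0 IHp]]] q [C' [D' [C'0 D'0 IHq]]]
    |a p [C [D [C0 D0 IHp]]]|p [C [D [C0 D0 IHp]]] q [C' [D' [C'0 D'0 IHq]]]].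
- exists 1, 1; split=> // H u x; exists [:: x] => [y|K V j e _ _ h].
    by rewrite inE => /eqP ->; rewrite mul1r.
  by rewrite mul1r; apply: h; rewrite inE.
- exists 1, 1; split=> // H u x; exists [:: adj (u i) x] => [y|K V j e jl _ h].
    rewrite inE => /eqP ->; apply: le_trans (rnorm_adj _ (ut_bop u i)) _.
    by rewrite ler_wpM2r ?rnorm_ge0 ?opnorm_ut.
  (* For an adjoint the vector to list is [y = u_i^* x]: the isometry [V i] takes
     [V_i^* (j x) - j y] to [j (u_i y) - V_i (j y)]. *)
  have := h i _ (mem_head _ _); rewrite mul1r /=.
  have -> : u i (adj (u i) x) = x by have := congr1 (fun f => f x) (ut_adjKr u i).
  have Vi := ut_isometry V i; set y := adj (u i) x.
  rewrite -{1}[j x](_ : V i (adj (V i) (j x)) = _).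
    by rewrite -(linB (proj1 Vi)) isometry_rnorm // rnormB.
  by have := congr1 (fun f => f (j x)) (ut_adjKr V i).
- exists 0, 0; split=> // H u x; exists [::] => // K V j e _ _ _.
  by rewrite /= subrr rnorm0 mul0r.
- exists (C + C'), (D + D'); split; rewrite ?addr_ge0 // => H u x.
  have [l lD hl] := IHp H u x; have [m mD hm] := IHq H u x.
  exists (l ++ m) => [y|K V j e jl e0 h].
    rewrite mem_cat mulrDl => /orP[/lD|/mD] h; apply: le_trans h _.
      by rewrite lerDl mulr_ge0 ?rnorm_ge0.
    by rewrite lerDr mulr_ge0 ?rnorm_ge0.
  rewrite /= !opDE (linD jl) opprD addrACA mulrDl.
  apply: le_trans (rnormD _ _) (lerD _ _).
    by apply: hl => // i y yl; apply: h; rewrite mem_cat yl.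
  by apply: hm => // i y ym; apply: h; rewrite mem_cat ym orbT.
- exists (cmod a * C), D; split; rewrite ?mulr_ge0 ?cmod_ge0 // => H u x.
  have [l lD hl] := IHp H u x; exists l => // K V j e jl e0 h.
  rewrite /= !opZE (linZ jl) -scalerBr rnormZ -mulrA ler_wpM2l ?cmod_ge0 //.
  exact: hl.
- have [B B0 hB] := peval_norm_bound p; have [B' B'0 hB'] := peval_norm_bound q.
  exists (B * C' + C), (D' + D * B').
  split; rewrite ?addr_ge0 ?mulr_ge0 // => H u x.
  have [m mD hm] := IHq H u x; have [l lD hl] := IHp H u (peval u q x).
  exists (m ++ l) => [y|K V j e jl e0 h].
    rewrite mem_cat mulrDl => /orP[/mD|/lD] h; apply: le_trans h _.
      by rewrite lerDl !mulr_ge0 ?rnorm_ge0.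
    rewrite -mulrA; apply: le_trans (ler_wpM2l D0 (hB' _ _ _)) _.
    by rewrite lerDr mulr_ge0 ?rnorm_ge0.
  have h1 : rnorm (peval V q (j x) - j (peval u q x)) <= C' * e.
    by apply: hm => // i y ym; apply: h; rewrite mem_cat ym.
  have h2 : rnorm (peval V p (j (peval u q x)) - j (peval u p (peval u q x))) <= C * e.
    by apply: hl => // i y yl; apply: h; rewrite mem_cat yl orbT.
  rewrite /=; apply: le_trans (rnorm_sub_trans _ (peval V p (j (peval u q x))) _) _.
  rewrite mulrDl; apply: lerD h2.
  have Vp := peval_bop (ut_bop V) p.
  rewrite -(linB (bop_lin Vp)); apply: le_trans (hB _ _ _) _.
  by rewrite -mulrA ler_wpM2l.
Qed.

(** [C] and [D] of [peval_trace] are fixed before the spaces, so representatives may vary with [e];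
    the error is at most [C D e] times the norm of the vector. *)
Lemma opnorm_le_of_approx H K (u : unitary_tuple d H) (v : unitary_tuple d K) :
  (0 < d)%N ->
  (forall e : R, 0 < e -> exists (H' K' : hilbert R) (u' : unitary_tuple d H')
     (v' : unitary_tuple d K') (j : H' -> K'),
     [/\ sim u' u, sim v' v, isometry j &
       forall i y, rnorm (v' i (j y) - j (u' i y)) <= e * rnorm y]) ->
  forall p, opnorm (peval u p) <= opnorm (peval v p).
Proof.
move=> d_gt0 appr p; have [C [D [C0 D0 tr]]] := peval_trace p.
apply: (@ler_eps_mul _ _ _ (C * D)) => e e0.
have [H' [K' [u' [v' [j [/(simP d_gt0) <- /(simP d_gt0) <- j_iso h]]]]]] := appr e e0.
have vb := peval_bop (ut_bop v') p.
apply: opnorm_le => [|x].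
  by rewrite addr_ge0 ?opnorm_ge0 // mulr_ge0 ?(ltW e0) // mulr_ge0.
have [l lD hl] := tr H' u' x.
have := hl K' v' j (e * (D * rnorm x)) (proj1 j_iso).
move=> /(_ (mulr_ge0 (ltW e0) (mulr_ge0 D0 (rnorm_ge0 _)))) {}hl.
have {}hl : rnorm (peval v' p (j x) - j (peval u' p x)) <= C * (e * (D * rnorm x)).
  apply: hl => i y yl; apply: le_trans (h i y) _.
  by rewrite ler_wpM2l ?(ltW e0) ?lD.
rewrite -(isometry_rnorm _ j_iso) -[j (peval u' p x)](subKr (peval v' p (j x))).
apply: le_trans (rnormD _ _) _; rewrite rnormN.
have := opnormP (j x) vb; rewrite (isometry_rnorm x j_iso); lra.
Qed.

End ApproximateIntertwining.

(** * Descent to equivalence classes *)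

Section OnClasses.
Variables (R : realType) (d : nat) (d_gt0 : (0 < d)%N).
Implicit Types u v w : unitaries R d.

Lemma class_ofP u v : class_of u = class_of v <-> sim u v.
Proof.
split=> [/(congr1 sval) /= uv|uv].
  have : sim_class u v by rewrite uv; exact: sim_refl.
  by [].
apply: eq_exist; apply/funext => w; apply/propext; split.
  by move=> uw; exact: (sim_trans d_gt0 (sim_sym uv) uw).
by move=> vw; exact: (sim_trans d_gt0 uv vw).
Qed.

Lemma class_of_surj (C : calU R d) : exists u, class_of u = C.
Proof. by case: C => C [u Cu]; exists u; apply: eq_exist; rewrite Cu. Qed.

(** Invariance under [sim] comes for free: equivalent tuples have distance 0, and the triangle
    inequality is applied through them on both sides. *)
Lemma on_classes_extended (f : unitaries R d -> unitaries R d -> \bar R) :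
  (forall u v, 0 <= f u v)%E -> (forall u v, f u v = 0%E <-> sim u v) ->
  (forall u v, f u v = f v u) -> (forall u v w, f u w <= f u v + f v w)%E ->
  on_classes (@extended_metric R (calU R d)) f.
Proof.
move=> f0 fE fC f_tri.
have le u u' v v' : sim u u' -> sim v v' -> (f u v <= f u' v')%E.
  move=> /fE uu' /fE; rewrite fC => vv'.
  apply: (le_trans (f_tri u u' v)); rewrite uu' add0e.
  by apply: (le_trans (f_tri u' v' v)); rewrite vv' adde0.
pose D C C' := f (sval (cid (class_of_surj C))) (sval (cid (class_of_surj C'))).
have DE u v : D (class_of u) (class_of v) = f u v.
  have h w : sim (sval (cid (class_of_surj (class_of w)))) w.
    by apply/class_ofP; exact: (svalP (cid (class_of_surj (class_of w)))).
  by apply/le_anti; rewrite !le //; apply: sim_sym.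
exists D; split=> //; split.
- by move=> C C'; exact: f0.
- move=> C C'; have [u <-] := class_of_surj C; have [v <-] := class_of_surj C'.
  by rewrite DE fE class_ofP.
- by move=> C C'; exact: fC.
- by move=> C C' C''; exact: f_tri.
Qed.

Lemma on_classes_finite (f : unitaries R d -> unitaries R d -> \bar R) :
  (forall u v, f u v \is a fin_num) ->
  on_classes (@extended_metric R (calU R d)) f ->
  on_classes (@finite_metric R (calU R d)) f.
Proof.
move=> f_fin [D [DE D_metric]]; exists D; split=> //; split=> // C C'.
have [u <-] := class_of_surj C; have [v <-] := class_of_surj C'.
by rewrite DE.
Qed.

End OnClasses.

(** * The Haagerup-Rordam distance *)

Section HaagerupRordam.
Variables (R : realType) (d : nat) (d_gt0 : (0 < d)%N).
Implicit Types u v w : unitaries R d.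

Lemma opnorm_tuple_ge (H : hilbert R) (A : 'I_d -> H -> H) i : opnorm (A i) <= opnorm_tuple A.
Proof. exact: le_bigmax. Qed.

Lemma opnorm_tuple_le (H : hilbert R) (A : 'I_d -> H -> H) (r : R) :
  0 <= r -> (forall i, opnorm (A i) <= r) -> opnorm_tuple A <= r.
Proof. by move=> r0 Ar; apply: bigmax_le. Qed.

Lemma opnorm_tuple_ge0 (H : hilbert R) (A : 'I_d -> H -> H) : 0 <= opnorm_tuple A.
Proof.
rewrite /opnorm_tuple; elim/big_rec: _ => // i x _ x0.
by rewrite le_max x0 orbT.
Qed.

Lemma d_HR_le u v (H : hilbert R) (u' v' : unitary_tuple d H) (r : R) :
  sim u' u -> sim v' v -> 0 <= r -> (forall i, opnorm (u' i - v' i) <= r) ->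
  (d_HR u v <= r%:E)%E.
Proof.
move=> u'u v'v r0 h; apply: ge_ereal_inf.
exists (opnorm_tuple (fun i => u' i - v' i))%:E; last by rewrite lee_fin opnorm_tuple_le.
by exists H, u', v'.
Qed.

Lemma d_HR_lt u v (r : R) : (d_HR u v < r%:E)%E ->
  exists (H : hilbert R) (u' v' : unitary_tuple d H),
    [/\ sim u' u, sim v' v & forall i, opnorm (u' i - v' i) <= r].
Proof.
move=> /ereal_inf_lt[_ [H [u' [v' [u'u v'v ->]]]]]; rewrite lte_fin => h.
exists H, u', v'; split=> // i.
exact: le_trans (opnorm_tuple_ge (fun i => u' i - v' i) i) (ltW h).
Qed.

Lemma d_HR_ge0 u v : (0 <= d_HR u v)%E.
Proof.
apply: le_ereal_inf_tmp => _ [H [u' [v' [_ _ ->]]]].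
by rewrite lee_fin opnorm_tuple_ge0.
Qed.

Lemma d_HRC u v : d_HR u v = d_HR v u.
Proof.
suff le (a b : unitaries R d) : (d_HR a b <= d_HR b a)%E by apply/le_anti; rewrite !le.
apply: le_ereal_inf_tmp => _ [H [b' [a' [b'b a'a ->]]]].
apply: (d_HR_le a'a b'b); first exact: opnorm_tuple_ge0.
move=> i; rewrite opnormB; exact: (opnorm_tuple_ge (fun i => b' i - a' i)).
Qed.

(** Distances are infima or suprema in the extended reals; this reduces triangle inequalities to
    strict real bounds, an infinite summand making the claim trivial. *)
Lemma lee_of_reals (a b c : \bar R) : (0 <= a)%E -> (0 <= b)%E ->
  (forall r s : R, (a < r%:E)%E -> (b < s%:E)%E -> (c <= (r + s)%:E)%E) -> (c <= a + b)%E.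
Proof.
case: a => [a| |] //; case: b => [b| |] // a0 b0 h; rewrite ?leey //.
apply/lee_addgt0Pr => e e0.
have -> : (a%:E + b%:E + e%:E = ((a + e / 2) + (b + e / 2))%:E)%E.
  by rewrite -!EFinD; congr (_%:E); lra.
by apply: h; rewrite lte_fin ltrDl divr_gt0.
Qed.

Lemma d_HR_triangle u v w : (d_HR u w <= d_HR u v + d_HR v w)%E.
Proof.
apply: lee_of_reals; try exact: d_HR_ge0.
move=> r s /d_HR_lt[H [u1 [v1 [u1u v1v h1]]]] /d_HR_lt[K [v2 [w2 [v2v w2w h2]]]].
have v12 : sim v1 v2 := sim_trans d_gt0 v1v (sim_sym v2v).
(* Both representations are isometric on all bounded operators, so the norms of [u1 - v1] and
   [v2 - w2] and the classes of [u1] and [w2] survive in [L], where the images of [v1] and [v2]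
   coincide. *)
have [L [f [f' [f_rep f'_rep ff' fN f'N]]]] := amalgam d_gt0 v12.
have [u3 u3E] := rep_unitary_tuple u1 f_rep.
have [w3 w3E] := rep_unitary_tuple w2 f'_rep.
pose i0 := Ordinal d_gt0.
have le0 (M : hilbert R) (a b : unitary_tuple d M) t :
    (forall i, opnorm (a i - b i) <= t) -> 0 <= t.
  by move=> /(_ i0); apply: le_trans; apply/opnorm_ge0/bopB; exact: ut_bop.
apply: (@d_HR_le _ _ L u3 w3).
- apply: (sim_trans d_gt0 _ u1u); apply/simP => // p.
  by rewrite (rep_peval_tuple p f_rep u3E) fN //; exact: peval_bop (ut_bop u1) p.
- apply: (sim_trans d_gt0 _ w2w); apply/simP => // p.
  by rewrite (rep_peval_tuple p f'_rep w3E) f'N //; exact: peval_bop (ut_bop w2) p.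
- by rewrite addr_ge0 ?(le0 _ _ _ _ h1) ?(le0 _ _ _ _ h2).
move=> i; have u1b := ut_bop u1 i; have v1b := ut_bop v1 i.
have v2b := ut_bop v2 i; have w2b := ut_bop w2 i.
rewrite u3E w3E.
have fv := rep_bop f_rep v1b.
apply: le_trans (opnorm_triangle (rep_bop f_rep u1b) fv (rep_bop f'_rep w2b)) _.
rewrite -(repB (bop_Cstar H) f_rep u1b v1b) ff' -(repB (bop_Cstar K) f'_rep v2b w2b).
by rewrite fN ?f'N ?lerD //; exact: bopB.
Qed.

Lemma d_HR_eq0 u v : d_HR u v = 0%E <-> sim u v.
Proof.
split=> [uv0|uv]; last first.
  apply/le_anti; rewrite d_HR_ge0 andbT.
  apply: (@d_HR_le _ _ _ (uops u) (uops u)) => //; first exact: sim_refl.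
  by move=> i; rewrite subrr opnorm0.
have appr e : 0 < e -> exists (H : hilbert R) (u' v' : unitary_tuple d H),
    [/\ sim u' u, sim v' v & forall i, opnorm (u' i - v' i) <= e].
  by move=> e0; apply: d_HR_lt; rewrite uv0 lte_fin.
apply/simP => // p; apply/le_anti/andP; split.
- apply: opnorm_le_of_approx => // e /appr[H [u' [v' [u'u v'v h]]]].
  exists H, H, u', v', idfun; split=> // i y; rewrite /= rnormB -opBE.
  apply: le_trans (opnormP _ (bopB (ut_bop u' i) (ut_bop v' i))) _.
  by rewrite ler_wpM2r ?rnorm_ge0.
- apply: opnorm_le_of_approx => // e /appr[H [u' [v' [u'u v'v h]]]].
  exists H, H, v', u', idfun; split=> // i y; rewrite /= -opBE.
  apply: le_trans (opnormP _ (bopB (ut_bop u' i) (ut_bop v' i))) _.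
  by rewrite ler_wpM2r ?rnorm_ge0.
Qed.

Lemma id_unitary (H : hilbert R) : unitary (@idfun H).
Proof. by apply: unitaryP; rewrite ?adj_id //; exact: bop_id. Qed.

Definition id_tuple (H : hilbert R) : unitary_tuple d H :=
  UnitaryTuple (fun _ : 'I_d => id_unitary H).

Definition id_unitaries u : unitaries R d :=
  Unitaries (uspace_neq0 u) (id_tuple (uspace u)).

Lemma opnorm_scalar (H : hilbert R) (a : R[i]) : (exists x : H, x != 0) ->
  opnorm (a *: @idfun H) = cmod a.
Proof.
move=> [x x0]; apply/le_anti/andP; split.
  by apply: opnorm_le => [|y]; [exact: cmod_ge0 | rewrite opZE rnormZ].
have := opnormP x (bopZ a (bop_id H)); rewrite opZE rnormZ ler_pM2r //.
by rewrite lt_def rnorm_ge0 andbT; apply: contra_neq x0; exact: rnorm_eq0.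
Qed.

(* Evaluated at identity operators, a *-polynomial is a scalar not depending on the space. *)
Lemma id_unitaries_sim u v : sim (id_unitaries u) (id_unitaries v).
Proof.
have ev p : exists a, forall H : hilbert R, peval (id_tuple H) p = a *: idfun.
  elim: p => [i|i||p [a ha] q [b hb]|b p [a ha]|p [a ha] q [b hb]].
  - by exists 1 => H; rewrite scale1r.
  - by exists 1 => H; rewrite scale1r /= adj_id.
  - by exists 1 => H; rewrite scale1r.
  - by exists (a + b) => H; rewrite /= ha hb scalerDl.
  - by exists (b * a) => H; rewrite /= ha scalerA.
  - exists (a * b) => H; rewrite /= ha hb; apply/funext => x.
    by rewrite /= !opE /= scalerA.
apply/simP => // p; have [a ha] := ev p.
by rewrite !ha !opnorm_scalar //; exact: uspace_neq0.
Qed.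

Lemma d_HR_id_le u : (d_HR u (id_unitaries u) <= 2%:E)%E.
Proof.
apply: (@d_HR_le _ _ _ (uops u) (id_tuple (uspace u))) => //; try exact: sim_refl.
move=> i; have h1 := opnorm_ut u i; have h2 := opnorm_ut (id_tuple (uspace u)) i.
have ub := ut_bop u i; have idb := ut_bop (id_tuple (uspace u)) i.
have := opnorm_dist (bopB ub idb) ub.
have -> : u i - id_tuple (uspace u) i - u i = - id_tuple (uspace u) i.
  by rewrite addrAC subrr add0r.
rewrite opnormN; lra.
Qed.

Lemma d_HR_fin u v : d_HR u v \is a fin_num.
Proof.
rewrite ge0_fin_numE ?d_HR_ge0 //; apply: (@le_lt_trans _ _ (4%:E)); last exact: ltry.
apply: le_trans (d_HR_triangle u (id_unitaries v) v) _.
have h1 : (d_HR u (id_unitaries v) <= 2%:E)%E.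
  apply: le_trans (d_HR_triangle _ (id_unitaries u) _) _.
  have /d_HR_eq0 -> := id_unitaries_sim u v.
  by rewrite adde0 d_HR_id_le.
have h2 := d_HR_id_le v; rewrite d_HRC in h2.
have -> : (4%:E = 2%:E + 2%:E :> \bar R)%E by rewrite -EFinD; congr (_%:E); lra.
exact: leeD.
Qed.

Theorem d_HR_metric : on_classes (@finite_metric R (calU R d)) (@d_HR R d).
Proof.
apply: on_classes_finite; first exact: d_HR_fin.
apply: (on_classes_extended d_gt0);
  [exact: d_HR_ge0|exact: d_HR_eq0|exact: d_HRC|exact: d_HR_triangle].
Qed.

End HaagerupRordam.

(** * The dilation distance *)

Section DilationDistance.
Variables (R : realType) (d : nat) (d_gt0 : (0 < d)%N).
Implicit Types u v w : unitaries R d.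
Local Notation Re := (@complex.Re R).

Lemma orthoproj_id (K : hilbert R) (P : K -> K) (S : set K) x :
  orthoproj P S -> S x -> P x = x.
Proof.
move=> [_ PP _ <-] [y _ <-].
by have := congr1 (fun f => f y) PP => /=.
Qed.

Lemma isometry_orthoproj (H K : hilbert R) (j : H -> K) : isometry j ->
  orthoproj (j \o adj j) (range j).
Proof.
move=> ji; have jb := isometry_bop ji; have jab := bop_adj jb; split.
- exact: bop_comp.
- by apply/funext => x /=; rewrite isometry_adjK.
- by move=> x y /=; rewrite adjE // adjEr.
- apply/seteqP; split=> [_ [x _ <-]|_ [x _ <-]]; first by exists (adj j x).
  by exists (j x) => //=; rewrite isometry_adjK.
Qed.

(** Testing against [j y] removes the projection: it is self-adjoint and fixes the range of [j]. *)
Lemma dilation_inner (H K : hilbert R) (U : H -> H) (V : K -> K) (j : H -> K)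
    (P : K -> K) (c : R) x y :
  isometry j -> orthoproj P (range j) -> j (U x) = P (c%:C *: V (j x)) ->
  inner H (U x) y = c%:C * inner K (V (j x)) (j y).
Proof.
move=> ji hP jU; have [_ _ Psa _] := hP.
by rewrite -(proj2 ji) jU Psa (orthoproj_id hP) ?innerZl //; exists y.
Qed.

Lemma dilates_isometry u v c : dilates u v c -> exists (H K : hilbert R)
    (U : unitary_tuple d H) (V : unitary_tuple d K) (j : H -> K),
  [/\ sim U u, sim V v, isometry j &
    forall i x y, inner H (U i x) y = c%:C * inner K (V i (j x)) (j y)].
Proof.
move=> [H [K [U [V [j [P [[Uu Vv] jl ji hP jU]]]]]]].
exists H, K, U, V, j; split=> // i x y.
exact: (dilation_inner y (conj jl ji) hP (jU i x)).
Qed.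

Lemma isometry_dilates u v c (H K : hilbert R)
    (U : unitary_tuple d H) (V : unitary_tuple d K) (j : H -> K) :
  sim U u -> sim V v -> isometry j ->
  (forall i x y, inner H (U i x) y = c%:C * inner K (V i (j x)) (j y)) ->
  dilates u v c.
Proof.
move=> Uu Vv ji UV; exists H, K, U, V, j, (j \o adj j); split=> //; try by case: ji.
  exact: isometry_orthoproj.
move=> i x /=; congr j; apply: inner_ext => y.
by rewrite UV adjEr ?innerZl //; exact: isometry_bop.
Qed.

Lemma ut_inner_self (H : hilbert R) (U : unitary_tuple d H) i x :
  inner H (U i x) (U i x) = inner H x x.
Proof. by have [_ ->] := ut_isometry U i. Qed.

Lemma sim_space_neq0 (H : hilbert R) (U : unitary_tuple d H) u : sim U u ->
  exists x : H, x != 0.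
Proof.
move=> /(simP d_gt0)/(_ (POne R d)) /= h; apply: contrapT => n.
have [x x0] := uspace_neq0 u.
have : opnorm (@idfun (uspace u)) = 0.
  rewrite -h; apply/le_anti; rewrite opnorm_ge0 ?andbT; last exact: bop_id.
  apply: opnorm_le => // y; have [->|y0] := eqVneq y 0; first by rewrite rnorm0 mulr0.
  by case: n; exists y.
have := opnormP x (bop_id (uspace u)) => /[swap] ->; rewrite mul0r => /rnorm_le0 x0'.
by move/eqP: x0; apply; exact: x0'.
Qed.

(** For [x] nonzero, the squared norm of [U_i x] equals [c Re <V_i j x, j U_i x>], which is at most
    [c] times the squared norm of [x]. *)
Lemma dilates_ge1 u v (c : R) : 0 < c -> dilates u v c -> 1 <= c.
Proof.
move=> c0 /dilates_isometry[H [K [U [V [j [Uu Vv ji UV]]]]]].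
have [x x0] := sim_space_neq0 Uu; pose i := Ordinal d_gt0.
have n0 : 0 < rnorm x.
  by rewrite lt_def rnorm_ge0 andbT; apply: contra_neq x0; exact: rnorm_eq0.
have := congr1 Re (UV i x (U i x)); rewrite ut_inner_self -rnorm_sqr Re_realM => h.
have := Re_inner_le (V i (j x)) (j (U i x)).
rewrite !(isometry_rnorm _ (ut_isometry _ _)) !(isometry_rnorm _ ji).
rewrite !(isometry_rnorm _ (ut_isometry _ _)) -expr2 => /(ler_wpM2l (ltW c0)).
by rewrite -h -{1}[_ ^+ 2]mul1r ler_pM2r // exprn_gt0.
Qed.

(** The compression identity gives [Re <V_i j y, j U_i y> = |y|^2 / c], so the squared error is
    [2 (1 - 1/c) |y|^2], at most [2 (c - 1) |y|^2] as [c >= 1]. *)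
Lemma dilates_approx u v (c e : R) : 0 <= e -> 0 < c -> 2 * (c - 1) <= e ^+ 2 ->
  dilates u v c -> exists (H K : hilbert R)
    (U : unitary_tuple d H) (V : unitary_tuple d K) (j : H -> K),
  [/\ sim U u, sim V v, isometry j &
    forall i y, rnorm (V i (j y) - j (U i y)) <= e * rnorm y].
Proof.
move=> e0 c0 ce hc; have c1 := dilates_ge1 c0 hc.
have [H [K [U [V [j [Uu Vv ji UV]]]]]] := dilates_isometry hc.
exists H, K, U, V, j; split=> // i y.
rewrite -(@ler_pXn2r _ 2) ?nnegrE ?mulr_ge0 ?rnorm_ge0 // exprMn.
rewrite rnormD_sqr rnormN !(isometry_rnorm _ ji) !(isometry_rnorm _ (ut_isometry _ _)).
rewrite (isometry_rnorm _ ji) innerNr ReN.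
have := congr1 Re (UV i y (U i y)); rewrite ut_inner_self -rnorm_sqr Re_realM => h.
move: (Re (inner K _ _)) h => t h.
have n0 := sqr_ge0 (rnorm y).
have t0 : 0 <= t by rewrite -(pmulr_rge0 _ c0) -h.
have := ler_wpM2r n0 ce; have : 0 <= (c - 1) * ((c - 1) * t).
  by rewrite !mulr_ge0 // subr_ge0.
rewrite h; nra.
Qed.

Lemma sim_dilates u v : sim u v -> dilates u v 1.
Proof.
move=> uv; apply: (@isometry_dilates _ _ _ _ _ (uops u) (uops u) idfun) => //.
  exact: sim_refl.
by move=> i x y; rewrite mul1r.
Qed.

Theorem dilates_trans u v w (c c' : R) : 0 < c' ->
  dilates u v c -> dilates v w c' -> dilates u w (c * c').
Proof.
move=> c'0 /dilates_isometry[H [K [U [V [j [Uu Vv ji UV]]]]]].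
move=> /dilates_isometry[K' [L [V' [W [j' [V'v Ww j'i V'W]]]]]].
have V'V : sim V' V := sim_trans d_gt0 V'v (sim_sym Vv).
have [t [_ [[t_rep _] _ _ _ tV]]] := sim_reps d_gt0 V'V.
have V'b := ut_bop V'; have V'_alg := Cstar_alg V'b.
have V'1 := @ut_Cstar1 _ _ d_gt0 _ V'.
pose Phi0 A (x y : K) := inner K (t A x) y.
have Phi0_cp : cp_form (Cstar V') Phi0.
  split=> [A B x y SA SB|a A x y SA|T A x SA A_pos].
  - by rewrite /Phi0 (repD t_rep) // innerDl.
  - by rewrite /Phi0 (repZ t_rep) // innerZl.
  - exact: (rep_posmx V'_alg V'1 t_rep SA A_pos x).
have [Phi [[PhiD PhiZ Phi_pos] PhiE]] := arveson V'_alg V'1 Phi0_cp.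
have j'b := isometry_bop j'i; have j'ab := bop_adj j'b.
pose comp (A : L -> L) : K' -> K' := (adj j' \o A) \o j'.
have compb A : bounded_op A -> bounded_op (comp A).
  by move=> hA; apply: bop_comp => //; exact: bop_comp.
pose Psi A x y := Phi (comp A) x y.
have Psi_cp : cp_form (@bounded_op R L L) Psi.
  split=> [A B x y hA hB|a A x y hA|T A x hA A_pos].
  - rewrite /Psi -PhiD; try exact: compb.
    congr (Phi _ _ _); apply/funext => z; rewrite /comp /= !opE /=.
    by rewrite (linD (bop_lin j'ab)).
  - rewrite /Psi -PhiZ; last exact: compb.
    congr (Phi _ _ _); apply/funext => z; rewrite /comp /= !opE /=.
    by rewrite (linZ (bop_lin j'ab)).
  - apply: (Phi_pos T (fun i k => comp (A i k))) => [i k|h]; first exact: compb.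
    have := A_pos (fun i => j' (h i)).
    by under eq_bigr => i _ do under eq_bigr => k _ do rewrite -(adjEr _ _ j'b).
have [M [s [J [s_rep sE]]]] := stinespring Psi_cp.
have comp1 : comp idfun = idfun.
  by apply/funext => z; rewrite /comp /= isometry_adjK.
have J_iso : isometry J.
  apply: inner_preserving_isometry => x y.
  have := sE idfun x y (bop_id L); rewrite (rep_id s_rep) /= => ->.
  by rewrite /Psi comp1 PhiE // /Phi0 (rep_id t_rep).
have Wb := ut_bop W.
have compW i : comp (W i) = (c'^-1)%:C *: V' i.
  apply/funext => z; apply: inner_ext => y.
  rewrite opZE innerZl V'W mulrA -realCM mulVf ?lt0r_neq0 // mul1r.
  by rewrite /comp /= adjEr.
have sW i x y : inner M (s (W i) (J x)) (J y) = (c'^-1)%:C * inner K (V i x) y.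
  rewrite sE // /Psi compW PhiZ // PhiE; last exact: Cstar_gen.
  by rewrite /Phi0 tV.
(* The Stinespring representation may decrease norms of polynomials in [W]. Adding the identity
   representation on [L] restores them, so that the sum is equivalent to [w]. *)
pose F (b : bool) := if b then M else L.
have [Q [g g_orth]] := direct_sum F; have [gi _ _] := g_orth.
pose sF (b : bool) : (L -> L) -> (F b -> F b) :=
  if b as b return (L -> L) -> (F b -> F b) then s else id.
have [r r_rep rE] : exists2 r : (L -> L) -> (Q -> Q), is_rep (@bounded_op R L L) r &
    forall b D (x : F b), bounded_op D -> r D (g b x) = g b (sF b D x).
  by apply: (orth_rep g_orth) => -[] //; split.
have [W2 W2E] := rep_unitary_tuple W r_rep.
have W2w : sim W2 w.
  apply: (sim_trans d_gt0 _ Ww); apply/simP => // p.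
  rewrite (rep_peval_tuple p r_rep W2E); have pb := peval_bop Wb p.
  apply/le_anti; rewrite (rep_opnorm (bop_Cstar L) (@bop_id R L) r_rep pb) /=.
  apply: opnorm_le => [|x]; first exact: (opnorm_ge0 (rep_bop r_rep pb)).
  have := opnormP (g false x) (rep_bop r_rep pb).
  by rewrite rE //= !(isometry_rnorm _ (gi _)).
have gJj_iso : isometry (fun x => g true (J (j x))).
  apply: inner_preserving_isometry => x y.
  by rewrite (proj2 (gi true)) (proj2 J_iso) (proj2 ji).
apply: (isometry_dilates Uu W2w gJj_iso) => i x y.
rewrite W2E rE //= (proj2 (gi true)) sW UV realCM -mulrA; congr (_ * _).
by rewrite mulrA -realCM mulfV ?lt0r_neq0 // mul1r.
Qed.

Lemma dilation_const_ge1 u v : (1 <= dilation_const u v)%E.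
Proof.
apply: le_ereal_inf_tmp => _ [c [c0 /(dilates_ge1 c0) c1] <-].
by rewrite lee_fin.
Qed.

Lemma dilation_const_lt u v (r : R) : (dilation_const u v < r%:E)%E ->
  exists c, [/\ 0 < c, dilates u v c & c < r].
Proof.
by move=> /ereal_inf_lt[_ [c [c0 hc] <-]]; rewrite lte_fin => cr; exists c.
Qed.

Lemma dilation_const_le u v (c : R) : 0 < c -> dilates u v c ->
  (dilation_const u v <= c%:E)%E.
Proof. by move=> c0 hc; apply: ge_ereal_inf; exists c%:E => //; exists c. Qed.

Lemma dilation_const_trans u v w :
  (dilation_const u w <= dilation_const u v * dilation_const v w)%E.
Proof.
have := dilation_const_ge1 u v; have := dilation_const_ge1 v w.
have lt := @dilation_const_lt u v; have lt' := @dilation_const_lt v w.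
move: (dilation_const u v) (dilation_const v w) lt lt' => [a| |] [b| |] // lt lt' b1 a1;
  rewrite ?lee_fin in a1 b1; last first.
- by rewrite mulyy leey.
- by rewrite gt0_mulye ?leey // lte_fin (lt_le_trans ltr01).
- by rewrite gt0_muley ?leey // lte_fin (lt_le_trans ltr01).
apply/lee_addgt0Pr => e e0.
(* Because [e' <= 1], the product [(a + e') (b + e')] is at most [a b + e' (a + b + 1)]. *)
pose e' := Num.min (e / (a + b + 1)) 1.
have ab1 : 0 < a + b + 1 by lra.
have e'0 : 0 < e' by rewrite lt_min ltr01 divr_gt0.
have e'1 : e' <= 1 by rewrite ge_min lexx orbT.
have e'e : e' * (a + b + 1) <= e by rewrite -ler_pdivlMr // ge_min lexx.
have [|c [c0 hc ca]] := lt (a + e'); first by rewrite lte_fin ltrDl.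
have [|c' [c'0 hc' cb]] := lt' (b + e'); first by rewrite lte_fin ltrDl.
apply: le_trans (dilation_const_le (mulr_gt0 c0 c'0) (dilates_trans c'0 hc hc')) _.
rewrite -EFinM -EFinD lee_fin.
have : c * c' <= (a + e') * (b + e') by apply: ler_pM => //; exact: ltW.
have : e' * e' <= e' * 1 by rewrite ler_wpM2l // ltW.
nra.
Qed.

Let dmax u v := maxe (dilation_const u v) (dilation_const v u).

Let dmax_ge1 u v : (1 <= dmax u v)%E.
Proof. by rewrite le_max dilation_const_ge1. Qed.

Lemma d_D_ge0 u v : (0 <= d_D u v)%E.
Proof. by rewrite /d_D lne_ge0; exact: dmax_ge1. Qed.

Lemma d_DC u v : d_D u v = d_D v u.
Proof. by rewrite /d_D maxC. Qed.

Lemma d_D_triangle u v w : (d_D u w <= d_D u v + d_D v w)%E.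
Proof.
have pos (x : \bar R) : (1 <= x -> x \in `]0%E, +oo%E] :> bool)%E.
  by move=> x1; rewrite in_itv /=; apply/andP; split; [exact: lt_le_trans x1 | exact: leey].
have nneg (x : \bar R) : (1 <= x -> x \in `[0%E, +oo%E] :> bool)%E.
  by move=> x1; rewrite in_itv /=; apply/andP; split; [exact: le_trans x1 | exact: leey].
have h1 := dmax_ge1 u v; have h2 := dmax_ge1 v w.
have h3 : (1 <= dmax u v * dmax v w)%E by rewrite -[1%E]mule1; exact: lee_pmul.
rewrite /d_D -lneM; [|exact: pos|exact: pos].
rewrite lee_lne; [|exact: (nneg _ (dmax_ge1 u w))|exact: (nneg _ h3)].
have c0 (a b : unitaries R d) : (0 <= dilation_const a b)%E.
  exact: (le_trans lee01 (dilation_const_ge1 a b)).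
rewrite ge_max; apply/andP; split.
  apply: le_trans (dilation_const_trans u v w) _.
  by apply: lee_pmul => //; rewrite le_max lexx.
apply: le_trans (dilation_const_trans w v u) _; rewrite muleC.
by apply: lee_pmul => //; rewrite le_max lexx orbT.
Qed.

Lemma d_D_eq0 u v : d_D u v = 0%E <-> sim u v.
Proof.
have le1 (a b : unitaries R d) : sim a b -> (dilation_const a b <= 1)%E.
  by move=> ab; apply: dilation_const_le => //; exact: sim_dilates.
split=> [/eqP|uv]; last first.
  apply/eqP; rewrite lne_eq0; apply/eqP/le_anti/andP; split; last exact: dmax_ge1.
  by rewrite ge_max !le1 //; exact: sim_sym.
rewrite lne_eq0 => /eqP uv1.
have appr (a b : unitaries R d) : (dilation_const a b <= 1)%E ->
    forall p, opnorm (peval a p) <= opnorm (peval b p).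
  move=> ab1; apply: opnorm_le_of_approx => // e e0.
  have e2 : 0 < e ^+ 2 / 2 by rewrite divr_gt0 // exprn_gt0.
  have [|c [c0 hc ce]] := @dilation_const_lt a b (1 + e ^+ 2 / 2).
    by apply: le_lt_trans ab1 _; rewrite lte_fin ltrDl.
  by apply: (dilates_approx (ltW e0) c0 _ hc); lra.
apply/simP => // p; apply/le_anti; rewrite !appr // -uv1 le_max lexx ?orbT //.
Qed.

(** The value [+oo] does occur: for [d = 1] a compression of [c] times the identity is the scalar
    [c > 0], so the class of [-1] is not dilated by that of [1] for any [c]. *)
Theorem d_D_metric : on_classes (@extended_metric R (calU R d)) (@d_D R d).
Proof.
apply: (on_classes_extended d_gt0);
  [exact: d_D_ge0|exact: d_D_eq0|exact: d_DC|exact: d_D_triangle].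
Qed.

End DilationDistance.

(** * The matrix range distance *)

Section EuclideanSpace.
Variables (R : realType) (n : nat).
Implicit Types (x y z : 'cV[R[i]]_n) (A B : 'M[R[i]]_n).
Local Notation Re := (@complex.Re R).

(** Column vectors with [cdot] are placed isometrically in a Hilbert space, by means of the identity
    matrix as kernel, so that facts about [inner] and [rnorm] carry over to [cdot] and [cnorm]. *)
Lemma euclidean_embedding : exists (M : hilbert R) (c : 'cV[R[i]]_n -> M),
  [/\ forall x y, inner M (c x) (c y) = cdot x y,
      forall x y, c (x + y) = c x + c y & forall a x, c (a *: x) = a *: c x].
Proof.
have k_psd : psd (fun i j : 'I_n => ((i == j)%:R : R[i])).
  move=> l; rewrite /kform.
  suff -> : \sum_(p <- l) \sum_(q <- l) p.1 * q.1^*%C * (p.2 == q.2)%:R =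
      \sum_(k < n) (\sum_(p <- l) p.1 * (p.2 == k)%:R) *
        (\sum_(q <- l) q.1 * (q.2 == k)%:R)^*%C.
    by apply: sumr_ge0 => k _; rewrite mulrC mulJ lecR sqr_ge0.
  under [RHS]eq_bigr => k _ do rewrite conj_sum mulr_suml.
  rewrite [RHS]exchange_big; apply: eq_bigr => p _ /=.
  under [RHS]eq_bigr => k _ do rewrite mulr_sumr.
  rewrite [RHS]exchange_big; apply: eq_bigr => q _ /=.
  rewrite (bigD1 p.2) //= big1 ?addr0 => [|k kp]; last first.
    by rewrite [p.2 == k]eq_sym (negPf kp) mulr0 mul0r.
  by rewrite eqxx mulr1 conjM [q.2 == _]eq_sym conjc_nat mulrA.
have [M [g [gk _]]] := kernel_hilbert k_psd.
exists M, (fun x => \sum_i x i ord0 *: g i); split.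
- move=> x y; rewrite inner_suml; apply: eq_bigr => i _.
  rewrite inner_sumr (bigD1 i) //= big1 ?addr0 => [|j ji].
    by rewrite innerZl innerZr gk eqxx mulr1.
  by rewrite innerZl innerZr gk eq_sym (negPf ji) !mulr0.
- move=> x y; rewrite -big_split; apply: eq_bigr => i _ /=.
  by rewrite mxE scalerDl.
- move=> a x; rewrite scaler_sumr; apply: eq_bigr => i _ /=.
  by rewrite mxE scalerA.
Qed.

Lemma cnorm_ge0 x : 0 <= cnorm x. Proof. exact: sqrtr_ge0. Qed.

Lemma cnormE (M : hilbert R) (c : 'cV[R[i]]_n -> M) x :
  (forall x y, inner M (c x) (c y) = cdot x y) -> cnorm x = rnorm (c x).
Proof. by move=> cP; rewrite /cnorm -cP inner_rnorm sqrtr_sqr ger0_norm ?rnorm_ge0. Qed.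

Lemma cdot_cnorm x : cdot x x = (cnorm x ^+ 2)%:C.
Proof.
have [M [c [cP _ _]]] := euclidean_embedding.
by rewrite (cnormE _ cP) -cP inner_rnorm.
Qed.

Lemma cdotDl x y z : cdot (x + y) z = cdot x z + cdot y z.
Proof.
have [M [c [cP cD _]]] := euclidean_embedding.
by rewrite -!cP cD innerDl.
Qed.

Lemma cdotZl a x z : cdot (a *: x) z = a * cdot x z.
Proof.
have [M [c [cP _ cZ]]] := euclidean_embedding.
by rewrite -!cP cZ innerZl.
Qed.

Lemma cdotNl x z : cdot (- x) z = - cdot x z.
Proof. by rewrite -scaleN1r cdotZl mulN1r. Qed.

Lemma cdot_CauchySchwarz x y : cmod (cdot x y) <= cnorm x * cnorm y.
Proof.
have [M [c [cP _ _]]] := euclidean_embedding.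
by rewrite -cP !(cnormE _ cP) CauchySchwarz.
Qed.

Lemma cnormD x y : cnorm (x + y) <= cnorm x + cnorm y.
Proof.
have [M [c [cP cD _]]] := euclidean_embedding.
by rewrite !(cnormE _ cP) cD rnormD.
Qed.

Lemma cnormZ a x : cnorm (a *: x) = cmod a * cnorm x.
Proof.
have [M [c [cP _ cZ]]] := euclidean_embedding.
by rewrite !(cnormE _ cP) cZ rnormZ.
Qed.

Lemma cnormN x : cnorm (- x) = cnorm x.
Proof. by rewrite -scaleN1r cnormZ cmodN cmod1 mul1r. Qed.

Lemma cnorm0 : cnorm (0 : 'cV[R[i]]_n) = 0.
Proof. by rewrite -(scale0r 0) cnormZ cmod0 mul0r. Qed.

Lemma cnorm_sum (I : Type) (r : seq I) (F : I -> 'cV[R[i]]_n) :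
  cnorm (\sum_(i <- r) F i) <= \sum_(i <- r) cnorm (F i).
Proof.
elim: r => [|i r ih]; first by rewrite !big_nil cnorm0.
by rewrite !big_cons; apply: le_trans (cnormD _ _) (lerD _ ih).
Qed.

Lemma cnorm_eq0 x : cnorm x = 0 -> x = 0.
Proof.
move=> x0; apply/matrixP => i j; rewrite ord1 mxE; apply: cmod_eq0.
have := cdot_cnorm x; rewrite x0 expr0n => /(congr1 Re) /=.
rewrite Re_sum (eq_bigr (fun k => cmod (x k ord0) ^+ 2)) => [|k _]; last first.
  by rewrite -Re_mulJ mulrC.
move/eqP; rewrite psumr_eq0 => [/allP /(_ i)|k _]; last exact: sqr_ge0.
by rewrite mem_index_enum /= sqrf_eq0 => /(_ isT)/eqP.
Qed.

Lemma coord_le x i : cmod (x i ord0) <= cnorm x.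
Proof.
rewrite -(@ler_pXn2r _ 2) ?nnegrE ?cmod_ge0 ?cnorm_ge0 //.
have -> : cnorm x ^+ 2 = \sum_k cmod (x k ord0) ^+ 2.
  have := cdot_cnorm x => /(congr1 Re) /= <-; rewrite Re_sum; apply: eq_bigr => k _.
  by rewrite -Re_mulJ mulrC.
by rewrite (bigD1 i) //= lerDl sumr_ge0 // => k _; exact: sqr_ge0.
Qed.

Lemma mx_bounded A : exists2 C : R, 0 <= C & forall x, cnorm (A *m x) <= C * cnorm x.
Proof.
exists (\sum_j cnorm (col j A)); first by apply: sumr_ge0 => j _; exact: cnorm_ge0.
move=> x; have -> : A *m x = \sum_j x j ord0 *: col j A.
  apply/matrixP => i k; rewrite ord1 summxE mxE; apply: eq_bigr => j _.
  by rewrite !mxE mulrC.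
apply: le_trans (cnorm_sum _ _) _; rewrite mulr_suml; apply: ler_sum => j _.
by rewrite cnormZ mulrC ler_wpM2l ?cnorm_ge0 ?coord_le.
Qed.

Lemma mxopnorm_has_sup A :
  has_sup [set cnorm (A *m x) | x in [set x : 'cV[R[i]]_n | cnorm x <= 1]].
Proof.
split; first by exists (cnorm (A *m 0)), 0; rewrite //= cnorm0.
have [C C0 AC] := mx_bounded A; exists C => _ [x /= x1 <-].
by apply: le_trans (AC x) _; rewrite ler_piMr.
Qed.

Lemma mxopnorm_ge0 A : 0 <= mxopnorm A.
Proof.
apply: le_trans (cnorm_ge0 (A *m 0)) _.
by apply: sup_upper_bound (mxopnorm_has_sup A) _ _; exists 0; rewrite //= cnorm0.
Qed.

Lemma mxopnormP A x : cnorm (A *m x) <= mxopnorm A * cnorm x.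
Proof.
have [x0|x0] := eqVneq (cnorm x) 0.
  by rewrite (cnorm_eq0 x0) mulmx0 cnorm0 mulr0.
have {}x0 : 0 < cnorm x by rewrite lt_def x0 cnorm_ge0.
have c0 : cmod (cnorm x)^-1%:C = (cnorm x)^-1.
  by rewrite cmod_real ger0_norm // invr_ge0 ltW.
rewrite -ler_pdivrMr // mulrC -c0 -cnormZ scalemxAr.
apply: sup_upper_bound (mxopnorm_has_sup A) _ _; exists ((cnorm x)^-1%:C *: x) => //=.
by rewrite cnormZ c0 mulVf // lt0r_neq0.
Qed.

Lemma mxopnorm_le A (r : R) : 0 <= r ->
  (forall x, cnorm (A *m x) <= r * cnorm x) -> mxopnorm A <= r.
Proof.
move=> r0 Ar; apply: ge_sup; first by case: (mxopnorm_has_sup A).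
by move=> _ [x /= x1 <-]; apply: le_trans (Ar x) _; rewrite ler_piMr.
Qed.

Lemma mxopnormD A B : mxopnorm (A + B) <= mxopnorm A + mxopnorm B.
Proof.
apply: mxopnorm_le => [|x]; first by rewrite addr_ge0 ?mxopnorm_ge0.
by rewrite mulmxDl mulrDl; apply: le_trans (cnormD _ _) (lerD _ _); exact: mxopnormP.
Qed.

Lemma mxopnormB A B : mxopnorm (A - B) = mxopnorm (B - A).
Proof.
rewrite /mxopnorm; congr (sup _); apply: eq_imagel => x _.
by rewrite -(opprB B A) mulNmx cnormN.
Qed.

Lemma mxopnorm0 : mxopnorm (0 : 'M[R[i]]_n) = 0.
Proof.
apply/le_anti; rewrite mxopnorm_ge0 andbT.
by apply: mxopnorm_le => // x; rewrite mul0mx cnorm0 mul0r.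
Qed.

Lemma mxopnorm_triangle A B C : mxopnorm (A - C) <= mxopnorm (A - B) + mxopnorm (B - C).
Proof. by apply: le_trans (mxopnormD _ _); rewrite addrA subrK. Qed.

Section Tuples.
Variable d : nat.
Implicit Types X Y Z : 'I_d -> 'M[R[i]]_n.

Definition mxdist X Y : R := mxnorm_tuple (fun i => X i - Y i).

Lemma mxdist_le X Y (r : R) : 0 <= r -> (forall i, mxopnorm (X i - Y i) <= r) ->
  mxdist X Y <= r.
Proof. by move=> r0 h; apply: bigmax_le. Qed.

Lemma mxdist_ge X Y i : mxopnorm (X i - Y i) <= mxdist X Y.
Proof. exact: (le_bigmax _ (fun i => mxopnorm (X i - Y i))). Qed.

Lemma mxdist_ge0 X Y : 0 <= mxdist X Y.
Proof.
rewrite /mxdist /mxnorm_tuple; elim/big_rec: _ => // i x _ x0.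
by rewrite le_max x0 orbT.
Qed.

Lemma mxdist_xx X : mxdist X X = 0.
Proof.
apply/le_anti; rewrite mxdist_ge0 andbT; apply: mxdist_le => // i.
by rewrite subrr mxopnorm0.
Qed.

Lemma mxdistC X Y : mxdist X Y = mxdist Y X.
Proof.
by rewrite /mxdist /mxnorm_tuple; apply: eq_bigr => i _; rewrite mxopnormB.
Qed.

Lemma mxdist_triangle X Y Z : mxdist X Z <= mxdist X Y + mxdist Y Z.
Proof.
apply: mxdist_le => [|i]; first by rewrite addr_ge0 ?mxdist_ge0.
by apply: le_trans (mxopnorm_triangle _ (Y i) _) (lerD _ _); exact: mxdist_ge.
Qed.

End Tuples.
End EuclideanSpace.

(** * The Hausdorff distance with extended real values *)

Section Hausdorff.
Variables (R : realType) (T : Type) (dist : T -> T -> R).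
Hypotheses (dist_ge0 : forall x y, 0 <= dist x y) (dist_xx : forall x, dist x x = 0).
Hypotheses (distC : forall x y, dist x y = dist y x).
Hypothesis dist_tri : forall x y z, dist x z <= dist x y + dist y z.
Implicit Types A B C : set T.

Let half A B : \bar R := ereal_sup [set ereal_inf [set (dist x y)%:E | y in B] | x in A].

Lemma hausdorff_half A B : hausdorff_dist dist A B = maxe (half A B) (half B A).
Proof.
congr (maxe _ _); congr ereal_sup; apply: eq_imagel => y _; congr ereal_inf.
by apply: eq_imagel => x _; rewrite distC.
Qed.

(** For empty [A] the supremum would be [-oo]. An empty [B] gives [+oo] and is harmless. *)
Let half_ge0 A B : A !=set0 -> (0 <= half A B)%E.
Proof.
move=> [x Ax]; apply: le_ereal_sup_tmp.
exists (ereal_inf [set (dist x y)%:E | y in B]); first by exists x.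
by apply: le_ereal_inf_tmp => _ [y _ <-]; rewrite lee_fin.
Qed.

Let half_lt A B (r : R) x : (half A B < r%:E)%E -> A x ->
  exists2 y, B y & dist x y < r.
Proof.
move=> ABr Ax; have : (ereal_inf [set (dist x y)%:E | y in B] < r%:E)%E.
  by apply: le_lt_trans ABr; apply: ereal_sup_ubound; exists x.
by move=> /ereal_inf_lt[_ [y By <-]]; rewrite lte_fin; exists y.
Qed.

Let half_le A B (r : R) : (forall x, A x -> exists2 y, B y & dist x y <= r) ->
  (half A B <= r%:E)%E.
Proof.
move=> h; apply: ub_ereal_sup => _ [x Ax <-]; have [y By xy] := h x Ax.
by apply: ge_ereal_inf; exists (dist x y)%:E; [exists y | rewrite lee_fin].
Qed.

Let half_triangle A B C : A !=set0 -> B !=set0 -> (half A C <= half A B + half B C)%E.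
Proof.
move=> A0 B0; apply: lee_of_reals; try exact: half_ge0.
move=> r s ABr BCs; apply: half_le => x Ax.
have [y By xy] := half_lt ABr Ax; have [z Cz yz] := half_lt BCs By.
by exists z => //; apply: le_trans (dist_tri x y z) _; lra.
Qed.

Lemma hausdorff_ge0 A B : A !=set0 -> (0 <= hausdorff_dist dist A B)%E.
Proof. by move=> A0; rewrite hausdorff_half le_max half_ge0. Qed.

Lemma hausdorff_distC A B : hausdorff_dist dist A B = hausdorff_dist dist B A.
Proof. by rewrite !hausdorff_half maxC. Qed.

Lemma hausdorff_lt A B (r : R) x : (hausdorff_dist dist A B < r%:E)%E -> A x ->
  exists2 y, B y & dist x y < r.
Proof. by rewrite hausdorff_half gt_max => /andP[h _]; exact: half_lt. Qed.

Lemma hausdorff_le A B (r : R) : (forall x, A x -> exists2 y, B y & dist x y <= r) ->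
  (forall y, B y -> exists2 x, A x & dist y x <= r) ->
  (hausdorff_dist dist A B <= r%:E)%E.
Proof. by move=> h1 h2; rewrite hausdorff_half ge_max !half_le. Qed.

Lemma hausdorff_triangle A B C : A !=set0 -> B !=set0 -> C !=set0 ->
  (hausdorff_dist dist A C <= hausdorff_dist dist A B + hausdorff_dist dist B C)%E.
Proof.
move=> A0 B0 C0; rewrite !hausdorff_half ge_max; apply/andP; split.
  apply: le_trans (half_triangle C A0 B0) (leeD _ _); by rewrite le_max lexx.
apply: le_trans (half_triangle A C0 B0) _; rewrite addeC.
by apply: leeD; rewrite le_max lexx orbT.
Qed.

End Hausdorff.

(** * Unital completely positive maps into matrices *)

Section MatrixRange.
Variables (R : realType).
Implicit Types H K M : hilbert R.
Local Notation Re := (@complex.Re R).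

Lemma sum_enum_val2 (T : finType) (F : T -> T -> R[i]) :
  \sum_i \sum_j F i j = \sum_(i < #|T|) \sum_(j < #|T|) F (enum_val i) (enum_val j).
Proof.
have re (G : T -> R[i]) : \sum_i G i = \sum_(i < #|T|) G (enum_val i).
  by apply: reindex; exact: onW_bij (enum_val_bij T).
by rewrite re; apply: eq_bigr => i _; rewrite re.
Qed.

Lemma ucp_cp_form H n (phi : (H -> H) -> 'M[R[i]]_n) : ucp phi ->
  cp_form (@bounded_op R H H) (fun A (a b : 'cV_n) => cdot (phi A *m a) b).
Proof.
move=> [phiD phiZ _ phi_pos]; split=> [A B x y hA hB|a A x y hA|T A x hA A_pos].
- by rewrite phiD // mulmxDl cdotDl.
- by rewrite phiZ // -scalemxAl cdotZl.
rewrite sum_enum_val2.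
apply: (phi_pos _ (fun i j => A (enum_val i) (enum_val j)) _ _ (fun i => x (enum_val i))) => //.
move=> z; have := A_pos (fun t => z (enum_rank t)); rewrite sum_enum_val2.
by under eq_bigr => i _ do under eq_bigr => j _ do rewrite !enum_valK.
Qed.

(** Testing on basis vectors is enough: the coordinates of the columns [x i] are absorbed into the
    matrix indexed by pairs, with entry [conj (x i a) x j b A i j] at [(i, a)], [(j, b)], which is
    positive whenever [A] is. *)
Lemma cp_form_ucp H n (Phi : (H -> H) -> 'I_n -> 'I_n -> R[i]) :
  cp_form (@bounded_op R H H) Phi -> (forall i j, Phi idfun j i = (i == j)%:R) ->
  ucp (fun A => \matrix_(i, j) Phi A j i).
Proof.
move=> [PhiD PhiZ Phi_pos] Phi1; split=> [A B hA hB|a A hA||k A hA A_pos x].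
- by apply/matrixP => i j; rewrite !mxE PhiD.
- by apply/matrixP => i j; rewrite !mxE PhiZ.
- by apply/matrixP => i j; rewrite !mxE Phi1.
pose T := ('I_k * 'I_n)%type.
pose c (p q : T) := (x p.1 p.2 ord0)^*%C * x q.1 q.2 ord0.
have := Phi_pos T (fun p q => c p q *: A p.1 q.1) snd.
have -> : \sum_(p : T) \sum_(q : T) Phi (c p q *: A p.1 q.1) q.2 p.2 =
    \sum_i \sum_j cdot ((\matrix_(a, b) Phi (A i j) b a) *m x j) (x i).
  rewrite -(pair_bigA _ (fun i a => \sum_(q : T) Phi (c (i, a) q *: A i q.1) q.2 a)) /=.
  apply: eq_bigr => i _; rewrite /cdot.
  under eq_bigr => a _.
    rewrite -(pair_bigA _ (fun j b => Phi (c (i, a) (j, b) *: A i j) b a)) /=; over.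
  rewrite exchange_big; apply: eq_bigr => j _; apply: eq_bigr => a _.
  rewrite mxE mulr_suml; apply: eq_bigr => b _.
  by rewrite PhiZ // mxE /c mulrC [_^*%C * _]mulrC mulrA.
apply=> [p q|y']; first exact: bopZ.
have [y ->] : exists y, y' = fun p : T => y p.1 p.2.
  by exists (fun i a => y' (i, a)); apply/funext; case.
have := A_pos (fun j => \sum_b x j b ord0 *: y j b); congr (0 <= _); symmetry.
rewrite -(pair_bigA _ (fun i a => \sum_(q : T) inner H ((c (i, a) q *: A i q.1) (y q.1 q.2)) (y i a))) /=.
apply: eq_bigr => i _.
under eq_bigr => a _.
  rewrite -(pair_bigA _ (fun j b => inner H ((c (i, a) (j, b) *: A i j) (y j b)) (y i a))) /=; over.
rewrite exchange_big; apply: eq_bigr => j _.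
rewrite inner_sumr; apply: eq_bigr => a _.
rewrite (lin_sum (bop_lin (hA i j))) inner_suml; apply: eq_bigr => b _.
by rewrite (linZ (bop_lin (hA i j))) opZE !innerZl innerZr mulrCA mulrA.
Qed.

Lemma cdot_delta n (A : 'M[R[i]]_n) j i :
  cdot (A *m delta_mx j ord0) (delta_mx i ord0) = A i j.
Proof.
rewrite /cdot (bigD1 i) //= big1 ?addr0 => [|k ki]; last first.
  by rewrite [delta_mx _ _ _ _]mxE (negPf ki) /= rmorph0 mulr0.
by rewrite -colE !mxE !eqxx /= rmorph1 mulr1.
Qed.

Lemma ucp_pullback H K (S : set (K -> K)) (t : (K -> K) -> (H -> H)) n
    (phi : (H -> H) -> 'M[R[i]]_n) :
  Cstar_subalgebra S -> S idfun -> is_rep S t -> ucp phi ->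
  exists psi : (K -> K) -> 'M[R[i]]_n, ucp psi /\ forall A, S A -> psi A = phi (t A).
Proof.
move=> S_alg S1 t_rep phi_ucp; have [PD PZ Ppos] := ucp_cp_form phi_ucp.
pose e (i : 'I_n) : 'cV[R[i]]_n := delta_mx i ord0.
have Phi0_cp : cp_form S (fun A j i => cdot (phi (t A) *m e j) (e i)).
  split=> [A B x y SA SB|a A x y SA|T A x SA A_pos].
  - by rewrite (repD t_rep) // PD //; exact: (rep_bop t_rep).
  - by rewrite (repZ t_rep) // PZ //; exact: (rep_bop t_rep).
  - apply: (Ppos T (fun i j => t (A i j)) (fun i => e (x i))) => [i j|].
      exact: (rep_bop t_rep).
    exact: rep_posmx S_alg S1 t_rep SA A_pos.
have [Phi [Phi_cp PhiE]] := arveson S_alg S1 Phi0_cp.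
exists (fun A => \matrix_(i, j) Phi A j i); split=> [|A SA].
  apply: cp_form_ucp => // i j; have [_ _ phi1 _] := phi_ucp.
  by rewrite PhiE // (rep_id t_rep) phi1 cdot_delta mxE.
by apply/matrixP => i j; rewrite mxE PhiE // cdot_delta.
Qed.

Lemma ucp_compression H n (e : 'I_n -> H) :
  (forall i j, inner H (e i) (e j) = (i == j)%:R) ->
  ucp (fun A => \matrix_(i, j) inner H (A (e j)) (e i)).
Proof.
move=> e_orth.
apply: (@cp_form_ucp _ _ (fun A j i => inner H (A (e j)) (e i))) => [|i j]; last first.
  by rewrite e_orth eq_sym.
split=> [A B x y _ _|a A x y _|T A x _ A_pos]; last exact: A_pos.
- by rewrite opE innerDl.
- by rewrite opE innerZl.
Qed.

(** A vector state times the identity matrix; it shows that matrix ranges are nonempty. For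
    positivity the indices [i] are sorted by the value [y i], one family of multiples of [x] for
    each value. *)
Lemma ucp_scalar H n (x : H) : rnorm x = 1 ->
  ucp (fun A => (inner H (A x) x)%:M : 'M[R[i]]_n).
Proof.
move=> x1.
have -> : (fun A : H -> H => (inner H (A x) x)%:M) =
    fun A => \matrix_(i < n, j < n) ((i == j)%:R * inner H (A x) x).
  by apply/funext => A; apply/matrixP => i j; rewrite !mxE mulr_natl.
apply: (@cp_form_ucp _ _ (fun A j i => (i == j)%:R * inner H (A x) x)) => [|i j]; last first.
  by rewrite inner_rnorm x1 expr1n mulr1.
split=> [A B i j _ _|a A i j _|T A y hA A_pos].
- by rewrite opE innerDl mulrDr.
- by rewrite opE innerZl mulrCA.
have -> : \sum_i \sum_j (y i == y j)%:R * inner H (A i j x) x =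
    \sum_(k < n) \sum_i \sum_j
      inner H (A i j ((y j == k)%:R *: x)) ((y i == k)%:R *: x).
  rewrite [RHS]exchange_big; apply: eq_bigr => i _; rewrite [RHS]exchange_big.
  apply: eq_bigr => j _; rewrite (bigD1 (y i)) //= big1 ?addr0 => [|k ki]; last first.
    by rewrite [y i == k]eq_sym (negPf ki) scale0r inner0r.
  by rewrite eqxx scale1r (linZ (bop_lin (hA i j))) innerZl eq_sym.
by apply: sumr_ge0 => k _; exact: A_pos.
Qed.

Lemma unit_vector H : (exists x : H, x != 0) -> exists x : H, rnorm x = 1.
Proof.
move=> [x x0]; exists ((rnorm x)^-1%:C *: x).
have r0 : 0 < rnorm x.
  by rewrite lt_def rnorm_ge0 andbT; apply: contra_neq x0; exact: rnorm_eq0.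
by rewrite rnormZ cmod_real ger0_norm ?invr_ge0 ?ltW // mulVf ?lt0r_neq0.
Qed.

Lemma ucp_stinespring H n (phi : (H -> H) -> 'M[R[i]]_n) : ucp phi ->
  exists (M : hilbert R) (s : (H -> H) -> (M -> M)) (j : 'cV[R[i]]_n -> M),
    [/\ is_rep (@bounded_op R H H) s,
        forall a x y, j (a *: x + y) = a *: j x + j y,
        forall x y, inner M (j x) (j y) = cdot x y &
        forall A x y, bounded_op A -> inner M (s A (j x)) (j y) = cdot (phi A *m x) y].
Proof.
move=> phi_ucp; have [M [s [j [s_rep sE]]]] := stinespring (ucp_cp_form phi_ucp).
have jj x y : inner M (j x) (j y) = cdot x y.
  have := sE _ x y (bop_id H); rewrite (rep_id s_rep) => ->.
  by have [_ _ -> _] := phi_ucp; rewrite mul1mx.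
exists M, s, j; split=> // a x y; apply/eqP; rewrite -subr_eq0; apply/eqP/rnorm_eq0/eqP.
rewrite -sqrf_eq0 rnorm_sqr; set z := _ - _.
have zj w : inner M z (j w) = 0.
  by rewrite /z innerBl innerDl innerZl !jj cdotDl cdotZl subrr.
by rewrite {2}/z innerBr innerDr innerZr !zj mulr0 addr0 subrr.
Qed.

(** By Stinespring [phi A] is a compression of [s A], and representations are contractive. *)
Lemma ucp_contractive H n (phi : (H -> H) -> 'M[R[i]]_n) A :
  ucp phi -> bounded_op A -> mxopnorm (phi A) <= opnorm A.
Proof.
move=> phi_ucp hA; have [M [s [j [s_rep _ jj sE]]]] := ucp_stinespring phi_ucp.
have n0 := opnorm_ge0 hA.
apply: mxopnorm_le => // x; set b := phi A *m x.
have jn y : rnorm (j y) = cnorm y by rewrite (cnormE _ jj).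
have h : cnorm b ^+ 2 <= opnorm A * cnorm x * cnorm b.
  have -> : cnorm b ^+ 2 = cmod (inner M (s A (j x)) (j b)).
    by rewrite sE // -/b cdot_cnorm cmod_real ger0_norm ?sqr_ge0.
  apply: le_trans (CauchySchwarz _ _) _; rewrite jn ler_wpM2r ?cnorm_ge0 //.
  have hsA := rep_bop s_rep hA.
  apply: le_trans (opnormP _ hsA) _; rewrite jn ler_wpM2r ?cnorm_ge0 //.
  exact: (rep_opnorm (bop_Cstar H) (bop_id H) s_rep hA).
have [b0|b0] := eqVneq (cnorm b) 0.
  by rewrite b0 mulr_ge0 ?cnorm_ge0.
by move: h; rewrite expr2 ler_pM2r // lt_def b0 cnorm_ge0.
Qed.

Lemma sum_option H (T : finType) (F : option T -> H) :
  \sum_o F o = F None + \sum_i F (Some i).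
Proof.
rewrite (bigD1 None) //=; congr (_ + _).
rewrite (reindex_omap (fun i => Some i) id) => [|[i|]] //=.
by apply: eq_bigl => i; rewrite eqxx.
Qed.

(** Gram-Schmidt, the index type growing by [option] when the next vector is independent of the
    previous ones. It starts from an arbitrary unit vector, so that [n] is positive even if [l] has
    no nonzero vector. *)
Lemma finite_orthonormal H (l : seq H) : (exists x : H, x != 0) ->
  exists n (e : 'I_n -> H), [/\ (1 <= n)%N,
    forall i j, inner H (e i) (e j) = (i == j)%:R &
    forall y, y \in l -> y = \sum_i inner H y (e i) *: e i].
Proof.
move=> H_neq0.
suff [T [e [T0 e_orth eP]]] : exists (T : finType) (e : T -> H), [/\ (0 < #|T|)%N,
    forall i j, inner H (e i) (e j) = (i == j)%:R &
    forall y, y \in l -> y = \sum_i inner H y (e i) *: e i].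
  exists #|T|, (fun i => e (enum_val i)); split=> // [i j|y yl].
    by rewrite e_orth (inj_eq enum_val_inj).
  by rewrite {1}(eP y yl); apply: reindex; exact: onW_bij (enum_val_bij T).
elim: l => [|y l [T [e [T0 e_orth eP]]]].
  have [x x1] := unit_vector H_neq0; exists 'I_1, (fun=> x); split=> // [|i j].
    by rewrite card_ord.
  by rewrite inner_rnorm x1 expr1n !ord1.
pose z := y - \sum_i inner H y (e i) *: e i.
have ze i : inner H z (e i) = 0.
  rewrite innerBl inner_suml (bigD1 i) //= big1 ?addr0 => [|k ki]; last first.
    by rewrite innerZl e_orth (negPf ki) mulr0.
  by rewrite innerZl e_orth eqxx mulr1 subrr.
have [z0|z0] := eqVneq z 0.
  exists T, e; split=> // x; rewrite inE => /orP[/eqP ->|]; last exact: eP.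
  by apply/eqP; rewrite -subr_eq0 -/z z0.
pose r := rnorm z.
have r0 : 0 < r.
  by rewrite lt_def rnorm_ge0 andbT; apply: contra_neq z0; exact: rnorm_eq0.
pose f := r^-1%:C *: z.
have fe i : inner H f (e i) = 0 by rewrite innerZl ze mulr0.
have ef i : inner H (e i) f = 0 by rewrite innerC fe conjc0.
have ff : inner H f f = 1.
  rewrite inner_rnorm rnormZ cmod_real ger0_norm ?invr_ge0 ?ltW //.
  by rewrite mulVf ?lt0r_neq0 // expr1n.
exists (option T), (fun o => if o is Some i then e i else f); split.
- by rewrite card_option.
- by move=> [i|] [j|].
move=> x; rewrite inE => /orP[/eqP ->|xl]; rewrite sum_option /=.
  have -> : inner H y f = r%:C.
    have -> : y = z + \sum_i inner H y (e i) *: e i by rewrite /z subrK.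
    rewrite innerDl inner_suml [X in _ + X]big1 ?addr0 => [|i _]; last first.
      by rewrite innerZl ef mulr0.
    have -> : z = r%:C *: f by rewrite /f scalerA -realCM divff ?lt0r_neq0 ?scale1r.
    by rewrite innerZl ff mulr1.
  by rewrite /f scalerA -realCM divff ?lt0r_neq0 // scale1r /z subrK.
have -> : inner H x f = 0.
  rewrite (eP x xl) inner_suml big1 // => i _; by rewrite innerZl ef mulr0.
by rewrite scale0r add0r; exact: eP.
Qed.

End MatrixRange.

(** * Comparison of matrix ranges *)

Section MatrixRangeDistance.
Variables (R : realType) (d : nat) (d_gt0 : (0 < d)%N).
Implicit Types u v w : unitaries R d.
Local Notation Re := (@complex.Re R).

Lemma matrix_range_neq0 u n : matrix_range u n !=set0.
Proof.
have [x x1] := unit_vector (uspace_neq0 u); exists (fun i => (inner _ (u i x) x)%:M).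
by exists (fun A => (inner _ (A x) x)%:M); split=> //; exact: ucp_scalar.
Qed.

Lemma matrix_range_sim u v n : sim u v -> matrix_range u n `<=` matrix_range v n.
Proof.
move=> uv _ [phi [phi_ucp ->]].
have [t [_ [[t_rep _] _ _ _ tv]]] := sim_reps d_gt0 (sim_sym uv).
have v_alg := Cstar_alg (ut_bop v).
have [psi [psi_ucp psiE]] := ucp_pullback v_alg (@ut_Cstar1 _ _ d_gt0 _ v) t_rep phi_ucp.
exists psi; split=> //; apply/funext => i; rewrite psiE ?tv //; exact: Cstar_gen.
Qed.

Lemma matrix_range_contractive u n A i : matrix_range u n A -> mxopnorm (A i) <= 1.
Proof.
move=> [phi [phi_ucp ->]]; apply: le_trans (opnorm_ut u i).
by apply: ucp_contractive => //; exact: ut_bop.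
Qed.

(* Compress [u] to a finite-dimensional space containing [l] and the [u i y], [y] in
   [l], and dilate a nearby point of the matrix range of [v]. *)
Lemma matrix_range_intertwiner u v (l : seq (uspace u)) (e : R) : 0 < e ->
  (forall n A, (1 <= n)%N -> matrix_range u n A ->
     exists2 B, matrix_range v n B & mxdist A B <= e) ->
  exists (K : hilbert R) (V : unitary_tuple d K) (J : uspace u -> K),
    [/\ forall p, opnorm (peval V p) <= opnorm (peval v p), linear J,
        forall y, y \in l -> rnorm (J y) = rnorm y &
        forall i y, y \in l ->
          rnorm (V i (J y) - J (u i y)) ^+ 2 <= 2 * e * rnorm y ^+ 2].
Proof.
move=> e0 near; pose m := l ++ [seq u i y | i <- enum 'I_d, y <- l].
have [n [f [n1 f_orth fP]]] := finite_orthonormal m (uspace_neq0 u).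
pose w (y : uspace u) : 'cV[R[i]]_n := \col_i inner _ y (f i).
have wD a x y : w (a *: x + y) = a *: w x + w y.
  by apply/matrixP => i j; rewrite !mxE innerDl innerZl.
have ww x y : y \in m -> cdot (w x) (w y) = inner _ x y.
  move=> ym; rewrite {2}(fP y ym) inner_sumr; apply: eq_bigr => i _.
  by rewrite !mxE innerZr mulrC.
have wn y : y \in m -> cnorm (w y) = rnorm y.
  move=> ym; apply/eqP; rewrite -(@eqrXn2 _ 2) ?cnorm_ge0 ?rnorm_ge0 //; apply/eqP.
  by rewrite rnorm_sqr -ww // cdot_cnorm.
pose phi (A : uspace u -> uspace u) : 'M[R[i]]_n := \matrix_(i, j) inner _ (A (f j)) (f i).
have phiw A y : bounded_op A -> y \in m -> phi A *m w y = w (A y).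
  move=> hA ym; apply/matrixP => i j; rewrite !mxE {2}(fP y ym).
  rewrite (lin_sum (bop_lin hA)) inner_suml; apply: eq_bigr => k _.
  by rewrite !mxE (linZ (bop_lin hA)) innerZl mulrC.
have [|_ [psi [psi_ucp ->]] Be] := near n (fun i => phi (u i)) n1.
  by exists phi; split=> //; exact: ucp_compression.
have [K [s [j [s_rep jl jj sE]]]] := ucp_stinespring psi_ucp.
have [V VE] := rep_unitary_tuple (uops v) s_rep.
have Jn y : y \in m -> rnorm (j (w y)) = rnorm y.
  by move=> ym; rewrite -(cnormE _ jj) wn.
have lm y : y \in l -> y \in m by move=> yl; rewrite mem_cat yl.
exists K, V, (fun y => j (w y)); split=> [p|a x y|y /lm|i y yl].
- rewrite (rep_peval_tuple p s_rep VE).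
  have vp := peval_bop (ut_bop v) p.
  exact: (rep_opnorm (bop_Cstar _) (bop_id _) s_rep vp).
- by rewrite wD jl.
- exact: Jn.
have ym := lm y yl; have uym : u i y \in m.
  by rewrite mem_cat (allpairs_f (fun i y => u i y)) ?orbT ?mem_enum.
have uy : rnorm (u i y) = rnorm y := isometry_rnorm y (ut_isometry u i).
have Vy : rnorm (V i (j (w y))) = rnorm y.
  by rewrite (isometry_rnorm _ (ut_isometry V i)) Jn.
rewrite rnormD_sqr rnormN innerNr ReN Vy Jn // uy VE sE; last exact: ut_bop.
(* As [phi (u i)] takes [w y] to [w (u i y)], of squared norm [|y|^2], the squared error equals [2
   Re <(phi (u i) - psi (v i)) w y, w (u i y)>]. *)
have h : Re (cdot ((phi (u i) - psi (v i)) *m w y) (w (u i y))) <= e * rnorm y ^+ 2.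
  apply: le_trans (Re_le _) (le_trans (cdot_CauchySchwarz _ _) _).
  rewrite wn // uy expr2 mulrA ler_wpM2r ?rnorm_ge0 // -(wn y) //.
  apply: le_trans (mxopnormP _ _) _; rewrite ler_wpM2r ?cnorm_ge0 //.
  exact: le_trans (mxdist_ge (fun i => phi (u i)) (fun i => psi (v i)) i) Be.
move: h; rewrite mulmxBl cdotDl cdotNl phiw //; last exact: ut_bop.
by rewrite ww // ReB -rnorm_sqr uy; lra.
Qed.

(** The map [J] is norm preserving on finitely many prescribed vectors only, and the norms at [V]
    are merely dominated by those at [v]. So, unlike in [opnorm_le_of_approx], the vector [x] and
    its trace under [p] are fixed before [J] is chosen. *)
Lemma peval_le_of_matrix_range u v :
  (forall n A (e : R), (1 <= n)%N -> 0 < e -> matrix_range u n A ->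
     exists2 B, matrix_range v n B & mxdist A B <= e) ->
  forall p, opnorm (peval u p) <= opnorm (peval v p).
Proof.
move=> near p; have [C [D [C0 D0 tr]]] := peval_trace p.
apply: (@ler_eps_mul _ _ _ (C * D)) => e e0.
have vb := peval_bop (ut_bop v) p.
apply: opnorm_le => [|x].
  by rewrite addr_ge0 ?opnorm_ge0 // mulr_ge0 ?(ltW e0) // mulr_ge0.
have [l lD hl] := tr _ (uops u) x.
(* The squared error of the intertwiner is twice the tolerance. Both [x] and [peval u p x] are put
   in the list since [J] must preserve their norms. *)
have e2 : 0 < e ^+ 2 / 2 by rewrite divr_gt0 ?exprn_gt0.
have [|K [V [J [Vp J_lin Jn JV]]]] :=
    @matrix_range_intertwiner u v (x :: peval u p x :: l) _ e2.
  by move=> n A n1; exact: near.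
have {}hl : rnorm (peval V p (J x) - J (peval u p x)) <= C * (e * (D * rnorm x)).
  apply: hl => // [|i y yl]; first exact: mulr_ge0 (ltW e0) (mulr_ge0 D0 (rnorm_ge0 _)).
  apply: (@le_trans _ _ (e * rnorm y)); last by rewrite ler_wpM2l ?(ltW e0) ?lD.
  rewrite -(@ler_pXn2r _ 2) ?nnegrE ?mulr_ge0 ?(ltW e0) ?rnorm_ge0 // exprMn.
  have := JV i y; rewrite !inE yl !orbT => /(_ isT); lra.
rewrite -Jn ?inE ?eqxx ?orbT // -[J (peval u p x)](subKr (peval V p (J x))).
apply: le_trans (rnormD _ _) _; rewrite rnormN.
have := opnormP (J x) (peval_bop (ut_bop V) p).
rewrite (Jn x) ?inE ?eqxx // => h.
have := le_trans h (ler_wpM2r (rnorm_ge0 x) (Vp p)); lra.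
Qed.

Lemma d_mr_ge u v n : (1 <= n)%N ->
  (hausdorff_dist (@mxdist R n d) (matrix_range u n) (matrix_range v n) <= d_mr u v)%E.
Proof. by move=> n1; apply: ereal_sup_ubound; exists n. Qed.

Lemma d_mr_le u v (r : \bar R) :
  (forall n, (1 <= n)%N ->
    (hausdorff_dist (@mxdist R n d) (matrix_range u n) (matrix_range v n) <= r)%E) ->
  (d_mr u v <= r)%E.
Proof. by move=> h; apply: ub_ereal_sup => _ [n n1 <-]; exact: h. Qed.

Lemma d_mr_ge0 u v : (0 <= d_mr u v)%E.
Proof.
apply: le_trans (d_mr_ge u v (leqnn 1)); apply: hausdorff_ge0.
- exact: mxdist_ge0.
- exact: mxdistC.
- exact: matrix_range_neq0.
Qed.

Lemma d_mrC u v : d_mr u v = d_mr v u.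
Proof.
by congr ereal_sup; apply: eq_imagel => n _; apply: hausdorff_distC; exact: mxdistC.
Qed.

Lemma d_mr_triangle u v w : (d_mr u w <= d_mr u v + d_mr v w)%E.
Proof.
apply: d_mr_le => n n1; apply: (@le_trans _ _ (_ + _)%E); last first.
  exact: leeD (d_mr_ge u v n1) (d_mr_ge v w n1).
by apply: (@hausdorff_triangle _ _ (@mxdist R n d)); [exact: mxdist_ge0|exact: mxdistC|exact: mxdist_triangle|
  exact: matrix_range_neq0..].
Qed.

Lemma d_mr_eq0 u v : d_mr u v = 0%E <-> sim u v.
Proof.
split=> [uv0|uv]; last first.
  apply/le_anti; rewrite d_mr_ge0 andbT; apply: d_mr_le => n n1.
  apply: hausdorff_le => [|A hA|A hA]; first exact: mxdistC.
    by exists A; [exact: matrix_range_sim uv A hA | rewrite mxdist_xx].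
  by exists A; [exact: matrix_range_sim (sim_sym uv) A hA | rewrite mxdist_xx].
have key (a b : unitaries R d) : d_mr a b = 0%E ->
    forall p, opnorm (peval a p) <= opnorm (peval b p).
  move=> ab0; apply: peval_le_of_matrix_range => n A e n1 e0 aA.
  have [||B bB AB] := @hausdorff_lt _ _ (@mxdist R n d) (@mxdistC R n d) (matrix_range a n)
      (matrix_range b n) e A.
  - by apply: le_lt_trans (d_mr_ge a b n1) _; rewrite ab0 lte_fin.
  - exact: aA.
  - by exists B => //; exact: ltW.
by apply/simP => // p; apply/le_anti; rewrite !key // d_mrC.
Qed.

(** Points of matrix ranges are tuples of contractions, so any two of them are at distance at most
    2. *)
Lemma d_mr_fin u v : d_mr u v \is a fin_num.
Proof.
rewrite ge0_fin_numE ?d_mr_ge0 //; apply: (@le_lt_trans _ _ (2%:E)); last exact: ltry.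
have bound n A B (a b : unitaries R d) : matrix_range a n A -> matrix_range b n B ->
    mxdist A B <= 2.
  move=> aA bB; apply: mxdist_le => // i.
  have := mxopnorm_triangle (A i) 0 (B i).
  rewrite (mxopnormB 0) !subr0.
  have := matrix_range_contractive i aA; have := matrix_range_contractive i bB; lra.
apply: d_mr_le => n n1; apply: hausdorff_le => [|A aA|A bA]; first exact: mxdistC.
  by have [B bB] := matrix_range_neq0 v n; exists B => //; exact: bound aA bB.
by have [B aB] := matrix_range_neq0 u n; exists B => //; exact: bound bA aB.
Qed.

Theorem d_mr_metric : on_classes (@finite_metric R (calU R d)) (@d_mr R d).
Proof.
apply: on_classes_finite; first exact: d_mr_fin.
apply: (on_classes_extended d_gt0);
  [exact: d_mr_ge0|exact: d_mr_eq0|exact: d_mrC|exact: d_mr_triangle].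
Qed.

End MatrixRangeDistance.

Theorem proposition2p3 (R : realType) (d : nat) (d_gt0 : (0 < d)%N) :
  [/\ on_classes (@finite_metric R (calU R d)) (@d_HR R d),
      on_classes (@extended_metric R (calU R d)) (@d_D R d) &
      on_classes (@finite_metric R (calU R d)) (@d_mr R d)].
Proof.
by split; [exact: d_HR_metric | exact: d_D_metric | exact: d_mr_metric].
Qed.
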